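(* Let $\mathbb{H},\mathbb{U}$ be Hilbert spaces, let $(A,\mathcal{D}(A))$ be the infinitesimal generator of a strongly continuous group on $\mathbb{H}$, and let $B\in\mathcal{L}(\mathbb{U},\mathcal{D}(A^* )')$ be an admissible control operator. Assume that the control system $y'=Ay+Bu$ is exactly controllable in some positive time. Then the system $y'=Ay+Bu$ is rapidly dynamically stabilizable.
   Context: Notation. $e^{tA}$ is the group generated by $A$; $A^*$ is the adjoint of $A$. $\mathcal{D}(A^* )$ carries the graph scalar product, and $\mathcal{D}(A^* )'$ is its dual with respect to the pivot space $\mathbb{H}$. $B^*\in\mathcal{L}(\mathcal{D}(A^* ),\mathbb{U})$ is the adjoint of $B$: $\langle Bu,\varphi\rangle=\langle u,B^*\varphi\rangle_{\mathbb{U}}$. Admissibility: for every $T>0$ and $u\in L^2((0,T);\mathbb{U})$, the function $t\mapsto\int_0^te^{(t-s)A}Bu(s)\,ds$ (computed in $\mathcal{D}(A^* )'$) belongs to $C([0,T];\mathbb{H})$. Weak solution: for $u\in L^2((0,T);\mathbb{U})$ and $y_0\in\mathbb{H}$, the weak solution of $y'=Ay+Bu$, $y(0)=y_0$, is the unique $y\in C([0,T];\mathbb{H})$ with $y(0)=y_0$ and $\frac{d}{dt}\langle y,\varphi\rangle_{\mathbb{H}}=\langle y,A^*\varphi\rangle_{\mathbb{H}}+\langle u,B^*\varphi\rangle_{\mathbb{U}}$ in the distributional sense on $(0,T)$ for all $\varphi\in\mathcal{D}(A^* )$. Exact controllability in time $T>0$: for all $y_0,y_T\in\mathbb{H}$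 there is $u\in L^2((0,T);\mathbb{U})$ such that the weak solution satisfies $y(T)=y_T$. Dynamic stabilizability: the system is dynamically stabilizable if it can be embedded as a subsystem of a larger, well-posed, exponentially stable system; it is rapidly dynamically stabilizable if this can be done with an arbitrary exponential decay rate. Explicitly, rapidly dynamically stabilizable means: for every $\nu>0$ there exist a Hilbert space $\mathbb{K}$, a constant $C>0$ and a strongly continuous semigroup $(\mathcal{T}(t))_{t\ge0}$ on $\mathbb{H}\times\mathbb{K}$ with $\|\mathcal{T}(t)\|\le Ce^{-\nu t}$ for all $t\ge0$, such that for every $(y_0,k_0)\in\mathbb{H}\times\mathbb{K}$, writing $(y(t),k(t))=\mathcal{T}(t)(y_0,k_0)$, there is $u$ with $u\in L^2((0,T);\mathbb{U})$ for all $T>0$ such that $y$ is the weak solution of $y'=Ay+Bu$, $y(0)=y_0$, on $[0,T]$ for every $T>0$. *)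

(* Defs.v *)
From HB Require Import structures.
From mathcomp Require Import all_boot all_order all_algebra.
From mathcomp Require Import complex.
From mathcomp Require Import all_classical all_reals all_analysis.

Set Implicit Arguments.
Unset Strict Implicit.
Unset Printing Implicit Defensive.

Import Order.TTheory GRing.Theory Num.Theory.
Import numFieldNormedType.Exports.

Local Open Scope classical_set_scope.
Local Open Scope ring_scope.

(* Hilbert spaces are over the real or the complex field: the type [scalars]
   selects which one, and everything below treats both cases at once. *)
Variant scalars := RealScalars | ComplexScalars.

Definition scal (R : realType) (k : scalars) : numFieldType :=
  match k with RealScalars => R | ComplexScalars => R[i] end.

Section ScalarOperations.
Variable R : realType.

Definition scal_re (k : scalars) : scal R k -> R :=
  match k with
  | RealScalars => fun z : R => z
  | ComplexScalars => fun z : R[i] => complex.Re z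
  end.

Definition scal_of (k : scalars) : R -> scal R k :=
  match k with
  | RealScalars => fun r : R => r
  | ComplexScalars => fun r : R => (Complex r 0 : R[i])
  end.

Definition scal_conj (k : scalars) : scal R k -> scal R k :=
  match k with
  | RealScalars => fun z : R => z
  | ComplexScalars => fun z : R[i] => conjc z
  end.

(* Lebesgue integral of a scalar function, componentwise in the complex case. *)
Definition scal_int (k : scalars) (D : set R) : (R -> scal R k) -> scal R k :=
  match k with
  | RealScalars => fun f : R -> R =>
      \int[@lebesgue_measure R]_(t in D) f t
  | ComplexScalars => fun f : R -> R[i] =>
      (Complex (\int[@lebesgue_measure R]_(t in D) complex.Re (f t))
               (\int[@lebesgue_measure R]_(t in D) complex.Im (f t)) : R[i])
  end.

Variable k : scalars.
Implicit Types z w : scal R k.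

Lemma scal_conjD z w : scal_conj (z + w) = scal_conj z + scal_conj w.
Proof. by case: k z w => //= z w; rewrite rmorphD. Qed.

Lemma scal_conjM z w : scal_conj (z * w) = scal_conj z * scal_conj w.
Proof. by case: k z w => //= z w; rewrite rmorphM. Qed.

Lemma scal_conj1 : scal_conj (1 : scal R k) = 1.
Proof. by case: k => //=; exact: (rmorph1 (@conjc R)). Qed.

Lemma scal_conjN z : scal_conj (- z) = - scal_conj z.
Proof. by case: k z => //= -[a b]. Qed.

Lemma scal_conjK z : scal_conj (scal_conj z) = z.
Proof. by case: k z => //= z; rewrite conjcK. Qed.

Lemma scal_mulconj z : z * scal_conj z = `|z| ^+ 2.
Proof.
case: k z => /= z; first by rewrite real_normK ?num_real// expr2.
by rewrite normCK.
Qed.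

Lemma scal_ofD (r s : R) : scal_of k (r + s) = scal_of k r + scal_of k s.
Proof. by case: k => //=; rewrite -[in RHS](rmorphD (real_complex R)). Qed.

Lemma scal_ofM (r s : R) : scal_of k (r * s) = scal_of k r * scal_of k s.
Proof. by case: k => //=; rewrite -[in RHS](rmorphM (real_complex R)). Qed.

Lemma scal_of_le (r s : R) : (scal_of k r <= scal_of k s) = (r <= s).
Proof. by case: k => //=; rewrite -(lecR r s). Qed.

Lemma scal_of0 : scal_of k 0 = 0.
Proof. by case: k. Qed.

Lemma scal_reK z : 0 <= z -> scal_of k (scal_re z) = z.
Proof. by case: k z => //= -[a b]; rewrite lecE /= => /andP[/eqP <-]. Qed.

End ScalarOperations.

HB.mixin Record isHilbert (R : realType) (k : scalars) H
    of CompleteNormedModule (scal R k) H := {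
  dotp : H -> H -> scal R k ;
  dotp_linear : forall (a : scal R k) (x y z : H),
    dotp (a *: x + y) z = a * dotp x z + dotp y z ;
  dotpC : forall x y : H, dotp y x = scal_conj (dotp x y) ;
  dotpxx : forall x : H, dotp x x = `|x| ^+ 2 }.

#[short(type="hilbertType")]
HB.structure Definition Hilbert (R : realType) (k : scalars) :=
  {H of isHilbert R k H & CompleteNormedModule (scal R k) H}.

(* The norms of the library take values in the scalar field; [rnorm] is the
   same number seen in [R]. *)
Definition rnorm (R : realType) (k : scalars) (V : normedModType (scal R k))
  (x : V) : R := scal_re `|x|.

Section Norms.
Variables (R : realType) (k : scalars).

Section RealNorm.
Variable V : normedModType (scal R k).
Implicit Types x y : V.

Lemma rnormE x : scal_of k (rnorm x) = `|x|.
Proof. exact: scal_reK. Qed.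

Lemma rnorm_ge0 x : 0 <= rnorm x.
Proof. by rewrite -(scal_of_le k) rnormE scal_of0. Qed.

Lemma rnorm0 : rnorm (0 : V) = 0.
Proof. by apply/eqP; rewrite eq_le -!(scal_of_le k) rnormE normr0 scal_of0 lexx. Qed.

Lemma rnorm0_eq0 x : rnorm x = 0 -> x = 0.
Proof. by move=> h; apply/eqP; rewrite -normr_eq0 -rnormE h scal_of0. Qed.

Lemma rnormD x y : rnorm (x + y) <= rnorm x + rnorm y.
Proof. by rewrite -(scal_of_le k) scal_ofD !rnormE ler_normD. Qed.

End RealNorm.

(* Scalars form a normed module over themselves. *)
Definition sabs (z : scal R k) : R := @rnorm R k (scal R k)^o z.

Lemma sabsE z : scal_of k (sabs z) = `|z|.
Proof. exact: rnormE. Qed.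

Lemma sabs1 : sabs 1 = 1.
Proof.
apply/eqP; rewrite eq_le -!(scal_of_le k) sabsE normr1.
by case: k => /=; rewrite lexx.
Qed.

Lemma sabsM z w : sabs (z * w) = sabs z * sabs w.
Proof.
by apply/eqP; rewrite eq_le -!(scal_of_le k) scal_ofM !sabsE normrM lexx.
Qed.

Lemma rnormZ (V : normedModType (scal R k)) a (x : V) :
  rnorm (a *: x) = sabs a * rnorm x.
Proof.
by apply/eqP; rewrite eq_le -!(scal_of_le k) scal_ofM sabsE !rnormE normrZ lexx.
Qed.

Lemma sabs_conj z : sabs (scal_conj z) = sabs z.
Proof.
apply/eqP; rewrite -(eqrXn2 (n:=2))// ?rnorm_ge0//.
rewrite !expr2; apply/eqP.
apply/eqP; rewrite eq_le -!(scal_of_le k) !scal_ofM !sabsE -!expr2.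
by rewrite -!scal_mulconj scal_conjK mulrC lexx.
Qed.

End Norms.

Section CauchySchwarz.
Variables (R : realType) (k : scalars) (H : hilbertType R k).
Implicit Types x y : H.

Lemma dotpDl x y z : dotp (x + y) z = dotp x z + dotp y z.
Proof. by rewrite -[x in LHS]scale1r dotp_linear mul1r. Qed.

Lemma dotp0l y : dotp (0 : H) y = 0.
Proof.
have /eqP := dotpDl 0 0 y.
by rewrite addr0 addrC -subr_eq subrr => /eqP.
Qed.

Lemma dotpZl a x y : dotp (a *: x) y = a * dotp x y.
Proof. by rewrite -[a *: x]addr0 dotp_linear dotp0l addr0. Qed.

Lemma dotp_antilinear a x y z :
  dotp x (a *: y + z) = scal_conj a * dotp x y + dotp x z.
Proof.
by rewrite dotpC dotp_linear scal_conjD scal_conjM -!dotpC.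
Qed.

Lemma dotp0r x : dotp x 0 = 0.
Proof.
have /eqP := dotp_antilinear 1 x 0 0.
by rewrite scal_conj1 scale1r addr0 mul1r addrC -subr_eq subrr => /eqP.
Qed.

Lemma dotpZr a x y : dotp x (a *: y) = scal_conj a * dotp x y.
Proof. by rewrite -[a *: y]addr0 dotp_antilinear dotp0r addr0. Qed.

Lemma dotp_normM x y : sabs (dotp x y) <= rnorm x * rnorm y.
Proof.
have [->|y0] := eqVneq y 0.
  by rewrite dotp0r [sabs _]rnorm0 rnorm0 mulr0.
have s_gt0 : 0 < dotp y y by rewrite dotpxx exprn_gt0 ?normr_gt0.
have : 0 <= dotp (- dotp x y *: y + dotp y y *: x)
                 (- dotp x y *: y + dotp y y *: x).
  by rewrite dotpxx exprn_ge0.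
rewrite dotp_linear dotpZl !dotp_antilinear !dotpZr -!dotpC.
set s := dotp y y; set p := dotp x y; set q := dotp y x.
have -> : scal_conj (- p) = - q by rewrite scal_conjN -dotpC.
have -> : - p * (- q * s + s * q) + s * (- q * p + s * dotp x x) =
          s * (s * dotp x x - p * q).
  by rewrite [s * q]mulrC (mulNr q s) addNr mulr0 add0r mulNr [q * p]mulrC addrC.
rewrite pmulr_rge0 // subr_ge0 /q (dotpC x y) -/p scal_mulconj.
rewrite /s !dotpxx -exprMn ler_pXn2r ?nnegrE ?mulr_ge0// => le_xy.
by rewrite -(scal_of_le k) scal_ofM sabsE !rnormE mulrC.
Qed.

End CauchySchwarz.

(* An unbounded operator is a domain together with a map whose values outside
   the domain are irrelevant. *)
Record operator (V : Type) := Operator { dom : set V ; app :> V -> V }.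

Section UnboundedOperators.
Variables (R : realType) (k : scalars) (H : hilbertType R k).
Implicit Types (A X : operator H) (x y phi psi : H).

Definition adjoint_at A phi psi : Prop :=
  forall x, dom A x -> dotp (A x) phi = dotp x psi.

(* When [dom A] is dense, [psi] below is determined by [phi]. *)
Definition adjoint A : operator H :=
  Operator [set phi | exists psi, adjoint_at A phi psi]
           (fun phi => xget 0 [set psi | adjoint_at A phi psi]).

Definition graph_norm X phi : R :=
  Num.sqrt (rnorm phi ^+ 2 + rnorm (X phi) ^+ 2).

Lemma graph_norm_ge0 X phi : 0 <= graph_norm X phi.
Proof. exact: sqrtr_ge0. Qed.

Lemma graph_norm_ge X phi : rnorm phi <= graph_norm X phi.
Proof.
rewrite -[leLHS]ger0_norm ?rnorm_ge0// -sqrtr_sqr.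
by rewrite ler_sqrt ?addr_ge0 ?sqr_ge0// lerDl sqr_ge0.
Qed.

(* [antidual X] is the space of continuous antilinear forms on [dom X] endowed
   with the graph norm of [X]. A form is represented by its extension by 0
   outside [dom X], so that equality is the usual one. The forms are
   antilinear because [dotp] is antilinear on the right, so that the pivot
   embedding of [H] reads [h |-> dotp h]. *)
Definition antidual_bound X (f : H -> scal R k) (C : R) : Prop :=
  0 <= C /\ forall phi, dom X phi -> sabs (f phi) <= C * graph_norm X phi.

Definition in_antidual X (f : H -> scal R k) : Prop :=
  [/\ forall phi, ~ dom X phi -> f phi = 0,
      forall (a : scal R k) phi psi, dom X phi -> dom X psi ->
        f (a *: phi + psi) = scal_conj a * f phi + f psi &
      exists C, antidual_bound X f C].

Definition antidual_pred X : {pred H -> (scal R k)^o} :=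
  [pred f | `[< in_antidual X f >]].

Record antidual X := Antidual {
  antidual_val :> H -> (scal R k)^o ;
  antidual_valP : antidual_val \in antidual_pred X }.

HB.instance Definition _ X := [isSub for @antidual_val X].
HB.instance Definition _ X := [Choice of antidual X by <:].

Lemma antidual_boundD X (a : scal R k) (f g : H -> (scal R k)^o) C D :
  antidual_bound X f C -> antidual_bound X g D ->
  antidual_bound X (a *: f + g) (sabs a * C + D).
Proof.
move=> [C0 hC] [D0 hD]; split.
  by rewrite addr_ge0 ?mulr_ge0 ?rnorm_ge0.
move=> phi Xphi; apply: le_trans (rnormD _ _) _.
rewrite mulrDl lerD ?hD// -[rnorm _]/(sabs (a * f phi)) sabsM -mulrA.
by rewrite ler_wpM2l ?rnorm_ge0 ?hC.
Qed.

Fact antidual_submod_closed X : submod_closed (antidual_pred X).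
Proof.
split.
  apply/asboolP; split=> // [a phi psi _ _|]; first by rewrite mulr0 addr0.
  by exists 0; split=> // phi _; rewrite mul0r [sabs _]rnorm0.
move=> a f g /asboolP[f0 fL [C fC]] /asboolP[g0 gL [D gD]]; apply/asboolP; split.
- move=> phi Xphi; rewrite -[LHS]/(a * f phi + g phi) f0// g0//.
  by rewrite mulr0 addr0.
- move=> b phi psi Xphi Xpsi.
  rewrite -[LHS]/(a * f (b *: phi + psi) + g (b *: phi + psi)).
  rewrite -[RHS]/(scal_conj b * (a * f phi + g phi) + (a * f psi + g psi)).
  by rewrite fL// gL// !mulrDr addrACA !mulrA (mulrC a).
- by exists (sabs a * C + D); exact: antidual_boundD.
Qed.

HB.instance Definition _ X := GRing.isSubmodClosed.Build _ _
  (antidual_pred X) (antidual_submod_closed X).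
HB.instance Definition _ X := [SubChoice_isSubLmodule of antidual X by <:].

Definition antidual_opnorm X (f : antidual X) : R :=
  inf [set C | antidual_bound X f C].

Lemma antidual_in X (f : antidual X) : in_antidual X f.
Proof. exact/asboolP/(valP f). Qed.

Lemma antidual_has_inf X (f : antidual X) :
  has_inf [set C | antidual_bound X f C].
Proof.
split; first by have [_ _ []] := antidual_in f => C fC; exists C.
by exists 0 => C [].
Qed.

Lemma antidual_opnormP X (f : antidual X) : antidual_bound X f (antidual_opnorm f).
Proof.
have [fn0 flb] := antidual_has_inf f.
split; first by apply: lb_le_inf => // C [].
move=> phi Xphi; have := graph_norm_ge0 X phi; rewrite le_eqVlt => /predU1P[g0|g0].
  by have [C [_ /(_ _ Xphi)]] := fn0; rewrite -g0 !mulr0.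
rewrite -ler_pdivrMr//; apply: lb_le_inf => // C [_ /(_ _ Xphi)].
by rewrite ler_pdivrMr.
Qed.

Lemma antidual_opnorm_le X (f : antidual X) C :
  antidual_bound X f C -> antidual_opnorm f <= C.
Proof. by move=> fC; apply: ge_inf => //; exact: (antidual_has_inf f).2. Qed.

Definition antidual_norm X (f : antidual X) : scal R k :=
  scal_of k (antidual_opnorm f).

Lemma antidual_normD X (f g : antidual X) :
  antidual_norm (f + g) <= antidual_norm f + antidual_norm g.
Proof.
rewrite /antidual_norm -scal_ofD scal_of_le; apply: antidual_opnorm_le.
have := antidual_boundD 1 (antidual_opnormP f) (antidual_opnormP g).
by rewrite scale1r sabs1 mul1r.
Qed.

Lemma antidual_normZ_le X (l : scal R k) (f : antidual X) :
  antidual_norm (l *: f) <= `|l| * antidual_norm f.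
Proof.
rewrite /antidual_norm -sabsE -scal_ofM scal_of_le; apply: antidual_opnorm_le.
have b0 : antidual_bound X (0 : H -> (scal R k)^o) 0.
  by split=> // phi _; rewrite mul0r [sabs _]rnorm0.
have := antidual_boundD l (antidual_opnormP f) b0.
by rewrite !addr0.
Qed.

Lemma antidual_norm_ge0 X (f : antidual X) : 0 <= antidual_norm f.
Proof.
by rewrite /antidual_norm -(scal_of0 R k) scal_of_le; case: (antidual_opnormP f).
Qed.

Lemma antidual_normZ X (l : scal R k) (f : antidual X) :
  antidual_norm (l *: f) = `|l| * antidual_norm f.
Proof.
apply/eqP; rewrite eq_le antidual_normZ_le/=.
have [->|l0] := eqVneq l 0; first by rewrite normr0 mul0r antidual_norm_ge0.
rewrite mulrC -ler_pdivlMr ?normr_gt0// mulrC -normfV.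
by rewrite -[f in leLHS]scale1r -(mulVf l0) -scalerA antidual_normZ_le.
Qed.

Lemma antidual_norm0_eq0 X (f : antidual X) : antidual_norm f = 0 -> f = 0.
Proof.
move=> f0; apply/val_inj/funext => phi.
have [fout _ _] := antidual_in f.
have [Xphi|/fout//] := pselect (dom X phi).
have [_ /(_ _ Xphi)] := antidual_opnormP f.
rewrite -(scal_of_le k) scal_ofM [scal_of k (antidual_opnorm f)]f0 mul0r sabsE.
by rewrite normr_le0 => /eqP.
Qed.

HB.instance Definition _ X := Lmodule_isNormed.Build (scal R k) (antidual X)
  (@antidual_normD X) (@antidual_normZ X) (@antidual_norm0_eq0 X).

End UnboundedOperators.

Section Pivot.
Variables (R : realType) (k : scalars) (H : hilbertType R k) (A : operator H).

(* The embedding of [H] into the dual of [dom A^*], with [H] as pivot space. *)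
Definition pivot_fun (h : H) : H -> (scal R k)^o :=
  fun phi => if `[< dom (adjoint A) phi >] then dotp h phi else 0.

Fact pivot_subproof (h : H) : pivot_fun h \in antidual_pred (adjoint A).
Proof.
have domD a phi psi : dom (adjoint A) phi -> dom (adjoint A) psi ->
    dom (adjoint A) (a *: phi + psi).
  move=> [phi' Aphi] [psi' Apsi]; exists (a *: phi' + psi') => x Ax.
  by rewrite !dotp_antilinear Aphi// Apsi.
apply/asboolP; split.
- by rewrite /pivot_fun => phi; case: asboolP.
- move=> a phi psi Dphi Dpsi; rewrite /pivot_fun !asboolT ?dotp_antilinear//.
  exact: domD.
- exists (rnorm h); split; first exact: rnorm_ge0.
  move=> phi Dphi; rewrite /pivot_fun asboolT//.
  apply: le_trans (dotp_normM _ _) _.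
  by rewrite ler_wpM2l ?rnorm_ge0 ?graph_norm_ge.
Qed.

Definition pivot (h : H) : antidual (adjoint A) := Antidual (pivot_subproof h).

End Pivot.

Section Integration.
Variables (R : realType) (k : scalars) (V : normedModType (scal R k)).

(* Borel simple functions, and strongly measurable functions as their
   pointwise limits. Convergence is required everywhere on [D] rather than
   almost everywhere: the sigma-algebra is the Borel one, and every class of
   functions modulo null sets has such a representative. *)
Definition simple_fun (s : R -> V) : Prop :=
  finite_set (range s) /\ forall v, measurable (s @^-1` [set v]).

Definition strongly_measurable (D : set R) (f : R -> V) : Prop :=
  exists s : nat -> R -> V, (forall n, simple_fun (s n)) /\
    forall t, D t -> s n t @[n --> \oo] --> f t.

Definition simple_integral (D : set R) (s : R -> V) : V :=
  \sum_(v \in range s)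
    scal_of k (fine (@lebesgue_measure R (D `&` s @^-1` [set v]))) *: v.

Definition is_bochner_integral (D : set R) (f : R -> V) (v : V) : Prop :=
  exists s : nat -> R -> V,
    [/\ forall n, simple_fun (s n),
        forall t, D t -> s n t @[n --> \oo] --> f t,
        (\int[@lebesgue_measure R]_(t in D) (rnorm (f t - s n t))%:E)%E
          @[n --> \oo] --> 0%E &
        simple_integral D (s n) @[n --> \oo] --> v].

Definition in_L2 (T : R) (u : R -> V) : Prop :=
  strongly_measurable `]0, T[ u /\
  (\int[@lebesgue_measure R]_(t in `]0%R, T[) (rnorm (u t) ^+ 2)%:E < +oo)%E.

End Integration.

Section Semigroups.
Variables (R : realType) (k : scalars).

Definition c0_semigroup (V : normedModType (scal R k))
    (T : R -> {linear V -> V}) : Prop :=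
  [/\ forall t, 0 <= t -> continuous (T t),
      forall x, T 0 x = x,
      forall s t x, 0 <= s -> 0 <= t -> T (s + t) x = T s (T t x) &
      forall x, T t x @[t --> 0^'+] --> x].

Definition c0_group (V : normedModType (scal R k))
    (S : R -> {linear V -> V}) : Prop :=
  [/\ forall t, continuous (S t),
      forall x, S 0 x = x,
      forall s t x, S (s + t) x = S s (S t x) &
      forall x, S t x @[t --> 0^'] --> x].

Definition is_generator (V : normedModType (scal R k))
    (S : R -> {linear V -> V}) (A : operator V) : Prop :=
  let rate x t := scal_of k t^-1 *: (S t x - x) in
  (forall x, dom A x <-> exists y : V, rate x t @[t --> 0^'] --> y) /\
  (forall x, dom A x -> rate x t @[t --> 0^'] --> A x).

End Semigroups.

Section ControlSystem.
Variables (R : realType) (k : scalars) (H U : hilbertType R k).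
Variables (A : operator H) (B : {linear U -> antidual (adjoint A)}).

(* [B^*], determined on the domain of [A^*] by the Riesz theorem. *)
Definition control_adjoint (phi : H) : U :=
  xget 0 [set w | forall v : U, B v phi = dotp v w].

(* The extension of [e^{tA}] to the dual of [dom A^*]: the transpose of the
   restriction of [(e^{tA})^*] to [dom A^*]. *)
Definition extended_group (S : R -> {linear H -> H}) (t : R)
    (f : antidual (adjoint A)) : antidual (adjoint A) :=
  xget 0 [set g : antidual (adjoint A) |
    forall phi, dom (adjoint A) phi ->
      g phi = f (adjoint (Operator [set: H] (S t)) phi)].

Definition admissible (S : R -> {linear H -> H}) : Prop :=
  forall (T : R) (u : R -> U), 0 < T -> in_L2 T u ->
  exists y : R -> H, {within `[0, T], continuous y} /\
    forall t, t \in `[0, T] ->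
      is_bochner_integral `]0, t[
        (fun s => extended_group S (t - s) (B (u s))) (pivot A (y t)).

Definition test_function (T : R) (theta : R -> R) : Prop :=
  [/\ forall n x, derivable (derive1n n theta) x 1,
      compact (closure [set x | theta x != 0]) &
      closure [set x | theta x != 0] `<=` `]0, T[].

Definition weak_solution (T : R) (u : R -> U) (y0 : H) (y : R -> H) : Prop :=
  [/\ {within `[0, T], continuous y}, y 0 = y0 &
      forall phi, dom (adjoint A) phi ->
      forall theta, test_function T theta ->
        - scal_int `]0, T[
            (fun t => scal_of k (derive1 theta t) * dotp (y t) phi) =
        scal_int `]0, T[
          (fun t => scal_of k (theta t) *
            (dotp (y t) (adjoint A phi) + dotp (u t) (control_adjoint phi)))].

Definition exactly_controllable (T : R) : Prop :=
  forall y0 yT : H, exists (u : R -> U) (y : R -> H),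
    [/\ in_L2 T u, weak_solution T u y0 y & y T = yT].

(* The library norm on a product is the maximum of the norms; it induces the
   same topology as the Hilbert norm of [H * K], which is [prod_norm]. *)
Definition prod_norm (K : hilbertType R k) (z : H * K) : R :=
  Num.sqrt (rnorm z.1 ^+ 2 + rnorm z.2 ^+ 2).

Definition rapidly_dynamically_stabilizable : Prop :=
  forall nu : R, 0 < nu ->
  exists (K : hilbertType R k) (C : R) (T : R -> {linear H * K -> H * K}%type),
    [/\ 0 < C, c0_semigroup T,
        forall t, 0 <= t -> forall z : H * K,
          prod_norm (T t z) <= C * expR (- nu * t) * prod_norm z &
        forall (y0 : H) (k0 : K), exists u : R -> U,
          (forall tau, 0 < tau -> in_L2 tau u) /\
          (forall tau, 0 < tau ->
             weak_solution tau u y0 (fun t => (T t (y0, k0)).1))].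

End ControlSystem.

(* Main.v *)
Require Import Defs.
From HB Require Import structures.
From mathcomp Require Import all_boot all_order all_algebra.
From mathcomp Require Import all_classical all_reals all_analysis.
From mathcomp Require Import measurable_realfun complex ring lra.
Set Implicit Arguments.
Unset Strict Implicit.
Unset Printing Implicit Defensive.
Import Order.TTheory GRing.Theory Num.Theory.
Import numFieldNormedType.Exports.
Local Open Scope classical_set_scope.
Local Open Scope ring_scope.

(** Rapid stabilization by the Gramian of the time-reversed dual system.

    For [phi] in the domain of the adjoint [A^*], let [obs phi s] be the
    observation by [B^*] of the adjoint orbit of [phi] at time [s], and let
    [gram phi psi] be the integral over [s >= 0] of the product of [obs phi (- s)]
    and [obs psi (- s)] with the discount [exp (- lam s)].

    - The form is bounded for the norm of [H]. Admissibility bounds the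
      observation over a unit of time ([admissible_bound]), and the discount beats
      the growth of the adjoint orbits ([gram_at_bound]).
    - The form is coercive. Exact controllability is equivalent by duality to an
      observability inequality ([observability]), which already bounds from below
      the observation over a finite time.

    Hence the form is represented by a bounded operator [G] of [H] with a bounded
    inverse ([form_operator], [form_operator_onto]). A time shift reproduces the
    form up to a finite time term ([gram_shift]), and the derivative of this
    identity is the Lyapunov equation ([lyapunov])
        [lam G + G A^* + A G = B B^*],
    in a weak sense. It says that [A - B B^* G^-1] is conjugated by [G] to
    [- A^* - lam], so that the closed loop
        [y (t) = exp (- lam t) G (S (- t))^* G^-1 y (0)]
    is driven by the feedback control [u = - B^* G^-1 y] and decays at any
    prescribed rate once [lam] is large ([traj_le]). This trajectory makes sense
    for every initial state, since [G] and its inverse are bounded. The control is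
    explicit only when [G^-1 y (0)] is in the domain of [A^*], where the weak
    equation is checked directly ([weak_form_dom]). In general it is a limit in
    mean square, which exists because the form bounds the energy of the controls
    ([feedback_control]). The stabilizing semigroup is this closed loop next to an
    independent scalar decay on the added space.

    Two quantitative facts are extracted from qualitative hypotheses by gliding
    hump arguments: the boundedness of the group and the observability inequality
    come from the uniform boundedness principle ([weakly_bounded]), and the
    admissibility inequality from [form_bounded]. Trajectories are only weak
    solutions; the duality with the adjoint equation is obtained by first
    integrating the weak formulation in time ([du_bois_reymond]) and then summing
    small increments ([weak_solution_dual]). *)

(** * Scalars, norms and limits *)

Section Scalars.
Variables (R : realType) (k : scalars).
Implicit Types z w : scal R k.

Lemma scal_reD z w : scal_re (z + w) = scal_re z + scal_re w.
Proof. by case: k z w => //= -[a b] [c d]. Qed.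

Lemma scal_reN z : scal_re (- z) = - scal_re z.
Proof. by case: k z => //= -[a b]. Qed.

Lemma scal_re0 : scal_re (0 : scal R k) = 0.
Proof. by case: k. Qed.

Lemma scal_ofK (r : R) : scal_re (scal_of k r) = r.
Proof. by case: k. Qed.

Lemma scal_re_ofM (r : R) z : scal_re (scal_of k r * z) = r * scal_re z.
Proof. by case: k z => //= -[a b] /=; rewrite mul0r subr0. Qed.

Lemma scal_re_conj z : scal_re (scal_conj z) = scal_re z.
Proof. by case: k z => //= -[a b]. Qed.

Lemma scal_conj_of (r : R) : scal_conj (scal_of k r) = scal_of k r.
Proof. by case: k => //=; rewrite oppr0. Qed.

Lemma scal_of1 : scal_of k (1 : R) = 1.
Proof. by case: k. Qed.

Lemma scal_ofN (r : R) : scal_of k (- r) = - scal_of k r.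
Proof. by case: k => //=; rewrite -[in RHS](rmorphN (real_complex R)). Qed.

Lemma scal_ofB (r s : R) : scal_of k (r - s) = scal_of k r - scal_of k s.
Proof. by rewrite scal_ofD scal_ofN. Qed.

Lemma scal_of_lt (r s : R) : (scal_of k r < scal_of k s) = (r < s).
Proof. by case: k => //=; rewrite -(ltcR r s). Qed.

(** Multiplication by [- i] turns the imaginary part into the real part, so
    real parts are enough once all multiples are considered. *)
Lemma scal_ext z w : (forall a, scal_re (a * z) = scal_re (a * w)) -> z = w.
Proof.
case: k z w => /= [z w /(_ 1)|]; first by rewrite !mul1r.
move=> [a b] [c d] h; congr Complex.
  by have := h 1; rewrite !mul1r.
by have := h (Complex 0 (- 1)); rewrite /= !mul0r !sub0r !mulN1r !opprK.
Qed.

Lemma sabs_of (r : R) : sabs (scal_of k r) = `|r|.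
Proof.
apply/eqP; rewrite eq_le -!(scal_of_le k) sabsE.
suff -> : `|scal_of k r| = scal_of k `|r| by rewrite lexx.
by case: k => //=; rewrite normc_def /= expr0n addr0 sqrtr_sqr.
Qed.

Lemma sabs_re z : `|scal_re z| <= sabs z.
Proof.
rewrite -(scal_of_le k) sabsE; case: k z => //= z; exact: normc_ge_Re.
Qed.

Lemma cvg_scal_of (T : Type) (F : set_system T) {FF : Filter F} (f : T -> R) (r : R) :
  f x @[x --> F] --> r -> scal_of k (f x) @[x --> F] --> scal_of k r.
Proof.
move=> /cvgrPdist_lt h; apply/cvgrPdist_lt => e e0.
have e' : scal_of k (scal_re e) = e by rewrite scal_reK// ltW.
have /h : 0 < scal_re e by rewrite -(scal_of_lt) e' scal_of0.
apply: filterS => x lt_e.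
by rewrite -scal_ofB -e' -sabsE sabs_of scal_of_lt.
Qed.

End Scalars.

Section RealNorm.
Variables (R : realType) (k : scalars) (V : normedModType (scal R k)).
Implicit Types x y z : V.

Lemma rnormN x : rnorm (- x) = rnorm x.
Proof. by rewrite /rnorm normrN. Qed.

Lemma rnormB x y : rnorm (x - y) = rnorm (y - x).
Proof. by rewrite /rnorm distrC. Qed.

Lemma rnormrZ (r : R) x : rnorm (scal_of k r *: x) = `|r| * rnorm x.
Proof. by rewrite rnormZ sabs_of. Qed.

Lemma rnorm_triB x y z : rnorm (x - z) <= rnorm (x - y) + rnorm (y - z).
Proof. by apply: le_trans (rnormD _ _); rewrite addrA subrK. Qed.

Lemma rnorm_dist x y : `|rnorm x - rnorm y| <= rnorm (x - y).
Proof.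
rewrite ler_norml; apply/andP; split.
  by rewrite lerNl opprB lerBlDr rnormB; apply: le_trans (rnormD _ _); rewrite subrK.
by rewrite lerBlDr; apply: le_trans (rnormD _ _); rewrite subrK.
Qed.

Section Filters.
Context {T : Type} {F : set_system T} {FF : Filter F}.

Lemma cvg_rnormP (f : T -> V) (l : V) :
  f x @[x --> F] --> l <-> rnorm (f x - l) @[x --> F] --> (0 : R).
Proof.
split=> [/cvgrPdist_lt h|/cvgrPdist_lt h].
  apply/cvgrPdist_lt => e e0.
  have /h : 0 < scal_of k e by rewrite -(scal_of0 R k) scal_of_lt.
  apply: filterS => x; rewrite -rnormE scal_of_lt sub0r normrN ger0_norm ?rnorm_ge0//.
  by rewrite rnormB.
apply/cvgrPdist_lt => e e0.
have e' : scal_of k (scal_re e) = e by rewrite scal_reK// ltW.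
have /h : 0 < scal_re e by rewrite -(scal_of_lt k) e' scal_of0.
apply: filterS => x; rewrite sub0r normrN ger0_norm ?rnorm_ge0// => lt_e.
by rewrite -e' -rnormE scal_of_lt rnormB.
Qed.

Lemma cvg_rnorm_le (f : T -> V) (l : V) (g : T -> R) :
  (\forall x \near F, rnorm (f x - l) <= g x) ->
  g x @[x --> F] --> (0 : R) -> f x @[x --> F] --> l.
Proof.
move=> fg g0; apply/cvg_rnormP.
apply: (squeeze_cvgr _ (@cvg_cst _ 0 _ F _) g0).
by apply: filterS fg => x -> ; rewrite rnorm_ge0.
Qed.

Lemma cvg_rnorm (f : T -> V) (l : V) :
  f x @[x --> F] --> l -> rnorm (f x) @[x --> F] --> rnorm l.
Proof.
move=> /cvg_rnormP/cvgrPdist_lt h; apply/cvgrPdist_lt => e /h.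
apply: filterS => x; rewrite sub0r normrN ger0_norm ?rnorm_ge0// => lt_e.
by rewrite distrC (le_lt_trans (rnorm_dist _ _)).
Qed.

Lemma cvg_rscale (f : T -> R) (g : T -> V) (r : R) (l : V) :
  f x @[x --> F] --> r -> g x @[x --> F] --> l ->
  scal_of k (f x) *: g x @[x --> F] --> scal_of k r *: l.
Proof. by move=> /cvg_scal_of fr gl; exact: cvgZ. Qed.

End Filters.

End RealNorm.

Section Complete.
Variables (R : realType) (k : scalars) (V : completeNormedModType (scal R k)).

Lemma rcauchy_cvg (u : nat -> V) :
  (forall e : R, 0 < e -> exists N, forall m n, (N <= m)%N -> (N <= n)%N ->
     rnorm (u m - u n) < e) -> exists l : V, u n @[n --> \oo] --> l.
Proof.
move=> h; suff: cvgn u by move=> /cvg_ex.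
apply/cauchy_cvgP/cauchy_ballP => e e0.
have e' : scal_of k (scal_re e) = e by rewrite scal_reK// ltW.
have /h[N hN] : 0 < scal_re e by rewrite -(scal_of_lt k) e' scal_of0.
exists (u @` [set n | (N <= n)%N], u @` [set n | (N <= n)%N]) => /=.
  by split; exists N => // n /= Nn; exists n.
move=> [_ _] /= [[m Nm <-] [n Nn <-]].
by rewrite -ball_normE /ball_ /= -e' -rnormE scal_of_lt; exact: hN.
Qed.

Lemma geo_dist (W : normedModType (scal R k)) (u : nat -> W) (C r : R) : 0 <= C -> 0 <= r < 1 ->
  (forall n, rnorm (u n.+1 - u n) <= C * r ^+ n) ->
  forall n m, (n <= m)%N -> rnorm (u m - u n) <= C / (1 - r) * r ^+ n.
Proof.
move=> C0 /andP[r0 r1] h n m nm.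
have r1' : 0 < 1 - r by rewrite subr_gt0.
suff : rnorm (u m - u n) <= C / (1 - r) * (r ^+ n - r ^+ m).
  move=> /le_trans; apply; rewrite ler_wpM2l ?divr_ge0 ?(ltW r1')//.
  by rewrite gerBl exprn_ge0.
rewrite -(subnK nm); elim: (m - n)%N => [|j ih].
  by rewrite add0n !subrr rnorm0 mulr0.
rewrite addSn; apply: le_trans (rnorm_triB _ (u (j + n)%N) _) _.
apply: le_trans (lerD (h _) ih) _.
rewrite -subr_ge0 exprS; set X := r ^+ (j + n); set Y := r ^+ n.
suff -> : C / (1 - r) * (Y - r * X) - (C * X + C / (1 - r) * (Y - X)) = 0 by [].
by field; rewrite gt_eqF.
Qed.

Lemma geo_cvg (u : nat -> V) (C r : R) : 0 <= C -> 0 <= r < 1 ->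
  (forall n, rnorm (u n.+1 - u n) <= C * r ^+ n) ->
  exists l : V, u n @[n --> \oo] --> l.
Proof.
move=> C0 r01 h; have gd := geo_dist C0 r01 h.
apply: rcauchy_cvg => e e0.
have [r0 r1] := andP r01.
have : (C / (1 - r) * r ^+ n) @[n --> \oo] --> (0 : R).
  rewrite -[X in _ --> X](mulr0 (C / (1 - r))); apply: cvgMl_tmp.
  by apply: cvg_expr; rewrite ger0_norm.
move=> /cvgrPdist_lt/(_ _ (divr_gt0 e0 (ltr0n R 2)))[N _ hN]; exists N => m n Nm Nn.
apply: le_lt_trans (rnorm_triB _ (u N) _) _.
rewrite [ltRHS]splitr; apply: ltrD.
  apply: le_lt_trans (gd _ _ Nm) _; apply: le_lt_trans (hN N (leqnn N)).
  by rewrite sub0r normrN ler_norm.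
rewrite rnormB; apply: le_lt_trans (gd _ _ Nn) _; apply: le_lt_trans (hN N (leqnn N)).
by rewrite sub0r normrN ler_norm.
Qed.

End Complete.

Lemma rcvg_unique (R : realType) (T : Type) (F : set_system T) {FF : ProperFilter F}
  (f : T -> R) (a b : R) : f t @[t --> F] --> a -> f t @[t --> F] --> b -> a = b.
Proof. by move=> fa fb; apply: (cvg_unique (@Rhausdorff R) fa fb). Qed.

Lemma vcvg_unique (R : realType) (k : scalars) (V : normedModType (scal R k))
  (T : Type) (F : set_system T) {FF : ProperFilter F}
  (f : T -> V) (a b : V) : f t @[t --> F] --> a -> f t @[t --> F] --> b -> a = b.
Proof. by move=> fa fb; apply: (cvg_unique (@norm_hausdorff _ V) fa fb). Qed.

Lemma cvg_near_eq (T : Type) (U : topologicalType) (F : set_system T) {FF : Filter F}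
  (f g : T -> U) (l : U) :
  (\forall x \near F, f x = g x) -> f x @[x --> F] --> l -> g x @[x --> F] --> l.
Proof.
move=> fg fl A Al; have Af : \forall x \near F, A (f x) by exact: fl A Al.
suff : \forall x \near F, A (g x) by [].
by apply: filterS2 fg Af => x ->.
Qed.

Lemma cvg_cts_comp (T : Type) (U V : topologicalType) (F : set_system T)
  (f : T -> U) (g : U -> V) (l : U) :
  f x @[x --> F] --> l -> {for l, continuous g} -> g (f x) @[x --> F] --> g l.
Proof. by move=> fl gl; exact: cvg_comp fl gl. Qed.

Lemma scal_re_int (R : realType) (k : scalars) (E : set R) (f : R -> scal R k) :
  scal_re (scal_int E f) = \int[@lebesgue_measure R]_(t in E) scal_re (f t).
Proof. by case: k f. Qed.

(** Same principle as [scal_ext]; the components are read off with the factors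
    [1] and [- i], so that no integrability is involved. *)
Lemma scal_int_eqN (R : realType) (k : scalars) (E : set R) (f g : R -> scal R k) :
  (forall c : scal R k, - (\int[@lebesgue_measure R]_(t in E) scal_re (c * f t)) =
     \int[@lebesgue_measure R]_(t in E) scal_re (c * g t)) ->
  - scal_int E f = scal_int E g.
Proof.
have eqI (f1 f2 g1 g2 : R -> R) : f1 =1 f2 -> g1 =1 g2 ->
    - (\int[@lebesgue_measure R]_(t in E) f1 t) = \int[@lebesgue_measure R]_(t in E) g1 t ->
    - (\int[@lebesgue_measure R]_(t in E) f2 t) = \int[@lebesgue_measure R]_(t in E) g2 t.
  by move=> ff gg; rewrite (funext ff) (funext gg).
case: k f g => /= f g h; first by apply: (eqI _ _ _ _ _ _ (h 1)) => t /=; rewrite mul1r.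
congr Complex; first by apply: (eqI _ _ _ _ _ _ (h 1)) => t /=; rewrite mul1r.
have imE (z : R[i]) : complex.Re (Complex 0 (- 1) * z) = complex.Im z.
  by case: z => x y /=; rewrite mul0r mulN1r opprK add0r.
by apply: (eqI _ _ _ _ _ _ (h (Complex 0 (- 1)))) => t; exact: imE.
Qed.

Lemma rev_cts (R : realType) (T : R) : continuous (fun s : R => T - s).
Proof. by move=> s; apply: cvgB; [exact: cvg_cst | exact: cvg_id]. Qed.

Lemma clamp_cts (R : realType) (V : topologicalType) (y : R -> V) (T : R) : 0 <= T ->
  {within `[0, T], continuous y} -> continuous (fun t => y (Num.max 0 (Num.min t T))).
Proof.
move=> T0 yc t; pose c (s : R) := Num.max 0 (Num.min s T).
have cT s : `[0, T]%classic (c s).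
  by rewrite /= in_itv /= /c le_max lexx /= ge_max T0 ge_min lexx orbT.
have cc : c s @[s --> t] --> c t.
  have : {for t, continuous ((fun=> 0 : R) \max ((fun s : R => s) \min (fun=> T)))}.
    apply: (@continuous_max _ _ (fun=> 0 : R)); first exact: cvg_cst.
    by apply: (@continuous_min _ _ (fun s : R => s)); [exact: cvg_id | exact: cvg_cst].
  exact.
move=> Q Qy.
have wQ : within `[0, T] (nbhs (c t)) (y @^-1` Q).
  by move/subspace_continuousP : yc => /(_ (c t) (cT t)); apply.
have : \forall s \near t, `[0, T]%classic (c s) -> Q (y (c s)) by exact: cc wQ.
by apply: filterS => s; apply; exact: cT.
Qed.

(** * The real inner product *)

Section RealInnerProduct.
Variables (R : realType) (k : scalars) (H : hilbertType R k).
Implicit Types x y z : H.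

(** The real part of the scalar product is a real scalar product with the same
    norm over either field, so all estimates live in [R]. Nothing is lost: by
    [rdot_ext] the values of [rdot] on multiples determine [dotp]. *)
Definition rdot x y : R := scal_re (dotp x y).

Lemma rdotC x y : rdot x y = rdot y x.
Proof. by rewrite /rdot dotpC scal_re_conj. Qed.

Lemma rdotDl x y z : rdot (x + y) z = rdot x z + rdot y z.
Proof. by rewrite /rdot dotpDl scal_reD. Qed.

Lemma rdotDr x y z : rdot z (x + y) = rdot z x + rdot z y.
Proof. by rewrite rdotC rdotDl !(rdotC z). Qed.

Lemma rdotrZl (r : R) x y : rdot (scal_of k r *: x) y = r * rdot x y.
Proof. by rewrite /rdot dotpZl scal_re_ofM. Qed.

Lemma rdotrZr (r : R) x y : rdot x (scal_of k r *: y) = r * rdot x y.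
Proof. by rewrite rdotC rdotrZl rdotC. Qed.

Lemma rdotZ (a : scal R k) x y : rdot (a *: x) y = rdot x (scal_conj a *: y).
Proof. by rewrite /rdot dotpZl dotpZr scal_conjK. Qed.

Lemma rdot0l y : rdot 0 y = 0.
Proof. by rewrite /rdot dotp0l scal_re0. Qed.

Lemma rdot0r y : rdot y 0 = 0.
Proof. by rewrite rdotC rdot0l. Qed.

Lemma rdotNl x y : rdot (- x) y = - rdot x y.
Proof. by apply/eqP; rewrite -addr_eq0 -rdotDl addNr rdot0l. Qed.

Lemma rdotNr x y : rdot x (- y) = - rdot x y.
Proof. by rewrite rdotC rdotNl rdotC. Qed.

Lemma rdotBl x y z : rdot (x - y) z = rdot x z - rdot y z.
Proof. by rewrite rdotDl rdotNl. Qed.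

Lemma rdotBr x y z : rdot z (x - y) = rdot z x - rdot z y.
Proof. by rewrite rdotDr rdotNr. Qed.

Lemma rdotxx x : rdot x x = rnorm x ^+ 2.
Proof. by rewrite /rdot dotpxx -rnormE !expr2 -scal_ofM scal_ofK. Qed.

Lemma rdot_norm x y : `|rdot x y| <= rnorm x * rnorm y.
Proof. exact: le_trans (sabs_re _) (dotp_normM _ _). Qed.

Lemma rdot_le x y : rdot x y <= rnorm x * rnorm y.
Proof. exact: le_trans (ler_norm _) (rdot_norm _ _). Qed.

Lemma rdot_ext x x' y y' : (forall a : scal R k, rdot (a *: x) y = rdot (a *: x') y') ->
  dotp x y = dotp x' y'.
Proof. by move=> h; apply: scal_ext => a; have := h a; rewrite /rdot !dotpZl. Qed.

Lemma rdot_inj x y : (forall z, rdot x z = rdot y z) -> x = y.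
Proof.
move=> h; apply/eqP; rewrite -subr_eq0; apply/eqP/rnorm0_eq0/eqP.
by rewrite -sqrf_eq0 -rdotxx rdotBl h subrr.
Qed.

Lemma rnorm_rdot_le x (C : R) : 0 <= C -> (forall z, rdot z x <= C * rnorm z) -> rnorm x <= C.
Proof.
move=> C0 h; have := h x; rewrite rdotxx expr2.
have := rnorm_ge0 x; rewrite le_eqVlt => /predU1P[<- //|x0].
by rewrite ler_pM2r.
Qed.

Lemma cvg_rdot {T : Type} {F : set_system T} {FF : Filter F} (f g : T -> H) x y :
  f t @[t --> F] --> x -> g t @[t --> F] --> y -> rdot (f t) (g t) @[t --> F] --> rdot x y.
Proof.
move=> fx gy.
have h : (rnorm (f t - x) * rnorm (g t) + rnorm x * rnorm (g t - y)) @[t --> F] --> (0 : R).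
  have -> : (0 : R) = 0 * rnorm y + rnorm x * 0 by rewrite mul0r mulr0 addr0.
  apply: cvgD.
    by apply: cvgM; [exact/cvg_rnormP | exact: cvg_rnorm].
  by apply: cvgMl_tmp; exact/cvg_rnormP.
apply/cvgrPdist_le => e e0; move/cvgrPdist_le : h => /(_ e e0); apply: filterS => t.
rewrite sub0r normrN => le_e; apply: le_trans _ le_e; apply: le_trans _ (ler_norm _).
rewrite distrC; have -> : rdot (f t) (g t) - rdot x y = rdot (f t - x) (g t) + rdot x (g t - y) by rewrite rdotBl rdotBr; ring.
by apply: le_trans (ler_normD _ _) _; apply: lerD; apply: rdot_norm.
Qed.

End RealInnerProduct.

(** * Nonnegative forms and the gliding hump *)

(** For [0 < c] this is the value at the minimum [- b / c]; for [c = 0] an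
    affine function bounded below has slope zero. *)
Lemma quad_disc (R : realFieldType) (a b c : R) : 0 <= c ->
  (forall t, 0 <= a + 2 * b * t + c * t ^+ 2) -> b ^+ 2 <= a * c.
Proof.
rewrite le_eqVlt => /predU1P[<-|c0] h.
  have [->|b0] := eqVneq b 0; first by rewrite expr0n mulr0.
  have := h (- (a + 1) / (2 * b)).
  have -> : a + 2 * b * (- (a + 1) / (2 * b)) + 0 * (- (a + 1) / (2 * b)) ^+ 2 = - 1.
    by field.
  by rewrite lerNr oppr0 ler10.
have := h (- b / c).
have -> : a + 2 * b * (- b / c) + c * (- b / c) ^+ 2 = (a * c - b ^+ 2) / c.
  by field; rewrite gt_eqF.
by rewrite pmulr_lge0 ?invr_gt0// subr_ge0.
Qed.

Section Forms.
Variables (R : realType) (k : scalars) (H : hilbertType R k).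
Implicit Types x y z : H.
Local Notation "r *r x" := (scal_of k r *: x) (at level 40).

(** A nonnegative symmetric form that may be degenerate or unbounded with
    respect to the norm. Only real scalars are used, so that both fields are
    covered. *)
Record form_on (D : set H) (q : H -> H -> R) : Prop := FormOn {
  form_dom0 : D 0 ;
  form_domD : forall x y, D x -> D y -> D (x + y) ;
  form_domZ : forall r x, D x -> D (r *r x) ;
  form_C : forall x y, D x -> D y -> q x y = q y x ;
  form_Dl : forall x y z, D x -> D y -> D z -> q (x + y) z = q x z + q y z ;
  form_Zl : forall r x y, D x -> D y -> q (r *r x) y = r * q x y ;
  form_ge0 : forall x, D x -> 0 <= q x x }.

Lemma rdot_form (D : set H) : D 0 -> (forall x y, D x -> D y -> D (x + y)) ->
  (forall r x, D x -> D (r *r x)) -> form_on D (@rdot R k H).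
Proof.
move=> D0 DD DZ; split=> //.
- by move=> x y _ _; exact: rdotC.
- by move=> x y z _ _ _; exact: rdotDl.
- by move=> r x y _ _; exact: rdotrZl.
- by move=> x _; rewrite rdotxx sqr_ge0.
Qed.

Section FormTheory.
Variables (D : set H) (q : H -> H -> R) (qf : form_on D q).

Let D0 := form_dom0 qf.
Let DD := form_domD qf.
Let DZ := form_domZ qf.

Lemma form_domN x : D x -> D (- x).
Proof. by rewrite -scaleN1r -scal_of1 -scal_ofN; exact: DZ. Qed.

Lemma form_domB x y : D x -> D y -> D (x - y).
Proof. by move=> Dx /form_domN; exact: DD. Qed.

Lemma form_Nl x y : D x -> D y -> q (- x) y = - q x y.
Proof. by move=> Dx Dy; rewrite -scaleN1r -scal_of1 -scal_ofN (form_Zl qf)// mulN1r. Qed.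

Lemma form_Bl x y z : D x -> D y -> D z -> q (x - y) z = q x z - q y z.
Proof. by move=> Dx Dy Dz; rewrite (form_Dl qf)// ?form_Nl//; exact: form_domN. Qed.

Lemma form_Dr x y z : D x -> D y -> D z -> q z (x + y) = q z x + q z y.
Proof. by move=> Dx Dy Dz; rewrite !(form_C qf Dz)// ?(form_Dl qf)//; exact: DD. Qed.

Lemma form_Zr r x y : D x -> D y -> q y (r *r x) = r * q y x.
Proof. by move=> Dx Dy; rewrite !(form_C qf Dy)// ?(form_Zl qf)//; exact: DZ. Qed.

Lemma form_Br x y z : D x -> D y -> D z -> q z (x - y) = q z x - q z y.
Proof. by move=> Dx Dy Dz; rewrite !(form_C qf Dz)// ?form_Bl//; exact: form_domB. Qed.

Lemma form_sqr t x y : D x -> D y ->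
  q (x + t *r y) (x + t *r y) = q x x + 2 * q x y * t + q y y * t ^+ 2.
Proof.
move=> Dx Dy; have Dty : D (t *r y) by exact: DZ.
rewrite form_Dr ?(form_Dl qf)//; last exact: DD.
by rewrite !form_Zr// !(form_Zl qf)// (form_C qf Dy Dx); ring.
Qed.

Lemma form_CS x y : D x -> D y -> q x y ^+ 2 <= q x x * q y y.
Proof.
move=> Dx Dy; apply: quad_disc; first exact: (form_ge0 qf).
by move=> t; rewrite -form_sqr//; apply: (form_ge0 qf); apply: DD => //; exact: DZ.
Qed.

(** A minimizing sequence of [q x x - 2 f x] is Cauchy for [q] by the
    parallelogram identity, and the vanishing of the first variation at the
    infimum makes [q (x n)] tend to [f]. As [D] need not be complete for [q],
    the conclusion is about the sequence. The rate [9^-1 ^+ n] is the square of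
    a summable rate. *)
Lemma form_riesz (f : H -> R) (C : R) : 0 <= C ->
  (forall x y, D x -> D y -> f (x + y) = f x + f y) ->
  (forall r x, D x -> f (r *r x) = r * f x) ->
  (forall x, D x -> f x ^+ 2 <= C * q x x) ->
  exists x : nat -> H, [/\ forall n, D (x n),
    forall n, q (x n.+1 - x n) (x n.+1 - x n) <= 9^-1 ^+ n &
    forall y, D y -> q (x n) y @[n --> \oo] --> f y].
Proof.
move=> C0 fD fZ fC; pose J x := q x x - 2 * f x.
(* [2 f x] is at most twice the geometric mean of [C] and [q x x]. *)
have J_lb x : D x -> - C <= J x.
  move=> Dx; suff : 0 <= C + 2 * (- f x) * 1 + q x x * 1 ^+ 2.
    by rewrite /J !mulr1 expr1n => h; lra.
  move: (form_ge0 qf Dx) (fC x Dx); set b := f x; set a := q x x => a0 b2.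
  rewrite expr1n !mulr1 leNgt; apply/negP => lt0.
  have : (C + a) ^+ 2 < (2 * b) ^+ 2.
    by rewrite ltr_pXn2r ?nnegrE ?addr_ge0//; lra.
  by rewrite exprMn; have := sqr_ge0 (C - a); nra.
pose E := [set J x | x in D].
have infE : has_inf E.
  by split; [exists (J 0); exists 0 | exists (- C) => _ [x Dx <-]; exact: J_lb].
have J_ge x : D x -> inf E <= J x.
  by move=> Dx; apply: ge_inf; [exact: infE.2 | exists x].
have eps0 n : 0 < 9^-1 ^+ n / 4 :> R by rewrite divr_gt0 ?exprn_gt0 ?invr_gt0.
have /choice[x hx] n : exists x, D x /\ J x < inf E + 9^-1 ^+ n / 4.
  by have [_ [x Dx <-] lt_x] := inf_adherent (eps0 n) infE; exists x.
have Dx n : D (x n) by case: (hx n).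
exists x; split=> //.
- move=> n; set a := x n.+1; set b := x n.
  have Da : D a by exact: Dx.
  have Db : D b by exact: Dx.
  (* The midpoint cannot do better than the infimum. *)
  have h2 : J (2^-1 *r (a + b)) >= inf E by apply: J_ge; apply: DZ; exact: DD.
  have ha : J a < inf E + 9^-1 ^+ n / 4.
    apply: lt_trans (hx n.+1).2 _; rewrite ltrD2l ltr_pM2r ?invr_gt0// exprS gtr_pMl ?exprn_gt0 ?invr_gt0//.
    by lra.
  have hb : J b < inf E + 9^-1 ^+ n / 4 by exact: (hx n).2.
  have -> : q (a - b) (a - b) = 2 * (J a + J b - 2 * J (2^-1 *r (a + b))).
    have Dab : D (a + b) by exact: DD.
    have Dmb : D (a - b) by exact: form_domB.
    rewrite /J fZ// fD// form_Zr ?(form_Zl qf)//; last exact: DZ.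
    rewrite form_Br// !form_Bl// form_Dr// !(form_Dl qf)// (form_C qf Da Db).
    by field.
  move: h2 ha hb; set e := 9^-1 ^+ n => h2 ha hb; lra.
- move=> y Dy.
  (* Moving along [y] cannot decrease [J] by more than the defect of [x n]. *)
  have key n : (q (x n) y - f y) ^+ 2 <= 9^-1 ^+ n / 4 * q y y.
    apply: quad_disc; first exact: (form_ge0 qf).
    move=> t; have Dty : D (t *r y) by exact: DZ.
    have := J_ge _ (DD (Dx n) Dty); rewrite /J form_sqr// fD// fZ//.
    have := (hx n).2; rewrite /J; lra.
  apply/cvgrPdist_lt => e e0.
  have : (9^-1 ^+ n / 4 * q y y) @[n --> \oo] --> (0 : R).
    have -> : (0 : R) = 0 * (4^-1 * q y y) by rewrite mul0r.
    under eq_fun do rewrite -mulrA.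
    by apply: cvgMr_tmp; apply: cvg_expr; rewrite ger0_norm; lra.
  move=> /cvgrPdist_lt/(_ _ (exprn_gt0 2 e0)); apply: filterS => n.
  rewrite sub0r normrN => /(le_lt_trans (ler_norm _))/(le_lt_trans (key n)).
  rewrite -[X in X < _]real_normK ?num_real// ltr_pXn2r ?nnegrE ?normr_ge0 ?(ltW e0)//.
  by rewrite distrC.
Qed.

(** Gliding hump. The vector [e n] is added with weight [3^-1 ^+ n] and with
    the sign for which [q (x n.+1) (e n)] is the larger of the two, hence at
    least [3^-1 ^+ n]. All the later weights together are half as large, so
    that [e n] remains visible in every later term. *)
Lemma form_hump (e : nat -> H) : (forall n, D (e n)) -> (forall n, q (e n) (e n) = 1) ->
  exists x : nat -> H, [/\ forall n, D (x n),
    forall n, q (x n.+1 - x n) (x n.+1 - x n) <= 9^-1 ^+ n &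
    forall n m, (n < m)%N -> 3^-1 ^+ n / 2 <= `|q (x m) (e n)|].
Proof.
move=> De e1.
pose step n y (b : bool) := y + ((-1) ^+ b * 3^-1 ^+ n) *r e n.
pose x := fix x n := if n is m.+1 then
  step m (x m) (`|q (step m (x m) false) (e m)| < `|q (step m (x m) true) (e m)|) else 0.
have Dstep n y b : D y -> D (step n y b) by move=> Dy; apply: DD => //; exact: DZ.
have Dx n : D (x n) by elim: n => [|n ih] //=; exact: Dstep.
have xS n : exists b, x n.+1 = step n (x n) b by eexists.
have De' n : D (3^-1 ^+ n *r e n) by exact: DZ.
exists x; split=> //.
- move=> n; have [b ->] := xS n; rewrite /step addrC addKr.
  rewrite form_Zr ?(form_Zl qf) ?e1//; last exact: DZ.
  rewrite mulr1 -expr2 exprMn sqrr_sign mul1r -exprM mulnC exprM.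
  by have -> : 3^-1 ^+ 2 = 9^-1 :> R by field.
- (* One of [c + a] and [c - a] is at least [a] in absolute value. *)
  have hit n : 3^-1 ^+ n <= `|q (x n.+1) (e n)|.
    have qs b : q (step n (x n) b) (e n) = q (x n) (e n) + (-1) ^+ b * 3^-1 ^+ n.
      by rewrite (form_Dl qf)// ?(form_Zl qf) ?e1 ?mulr1//; exact: DZ.
    rewrite /= -/(x n); set a := 3^-1 ^+ n.
    have a0 : 0 <= a by rewrite exprn_ge0// invr_ge0.
    rewrite !qs; case: ltP; rewrite /= expr0 expr1 mul1r mulN1r -/a; set c := q _ _;
      have : 2 * a <= `|c + a| + `|c - a| by
        (have -> : 2 * a = (c + a) - (c - a) by ring);
        exact: le_trans (ler_norm _) (ler_normB _ _).
    + by move=> h1 h2; lra.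
    + by move=> h1 h2; lra.
  move=> n m nm.
  (* The second term is what the weights still to come can take away. *)
  suff : 3^-1 ^+ n / 2 + 3^-1 ^+ m.-1 / 2 <= `|q (x m) (e n)|.
    apply: le_trans; rewrite lerDl divr_ge0// exprn_ge0// invr_ge0//.
  rewrite -(subnK nm); elim: (m - n.+1)%N => [|j ih].
    by rewrite add0n -splitr; exact: hit.
  rewrite addSn; have [b xjE] := xS (j + n.+1)%N.
  set i := (j + n.+1)%N in ih xjE *.
  rewrite xjE /step (form_Dl qf)// ?(form_Zl qf)//; last exact: DZ.
  have c1 : `|q (e i) (e n)| <= 1.
    by rewrite -(@expr_le1 _ 2)// real_normK ?num_real//; have := form_CS (De i) (De n); rewrite !e1 mulr1.
  have : `|(-1) ^+ b * 3^-1 ^+ i * q (e i) (e n)| <= 3^-1 ^+ i.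
    by rewrite !normrM normr_sign mul1r ger0_norm ?exprn_ge0 ?invr_ge0// ler_piMr ?exprn_ge0 ?invr_ge0.
  move: ih; rewrite /=; have -> : 3^-1 ^+ i.-1 = 3 * 3^-1 ^+ i :> R.
    by rewrite /i addnS exprS mulrA divff ?mul1r.
  set s := _ * q _ _; set u := q _ _; have := ler_normB (u + s) s; rewrite addrK.
  set p := 3^-1 ^+ i; set r := 3^-1 ^+ n; lra.
Qed.

End FormTheory.

(** The hump left along a vector of norm [4 ^+ n] has size [(4 / 3) ^+ n / 2]. *)
Lemma unbounded_hump (C : R) : exists n, C < (4 / 3) ^+ n / 2.
Proof.
have [n hn] : exists n, 2 * C < n%:R.
  by exists (Num.bound `|2 * C|); apply: le_lt_trans (ler_norm _) (archi_boundP _).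
exists (3 * n)%N; rewrite ltr_pdivlMr// mulrC (lt_le_trans hn)//.
rewrite exprM; apply: le_trans (_ : 2 ^+ n <= _).
  by rewrite -natrX ler_nat ltnW// ltn_expl.
by rewrite lerXn2r ?nnegrE// ?exprn_ge0// !exprS expr0; lra.
Qed.

(** Uniform boundedness principle. Otherwise [E] contains vectors of norm more
    than [4 ^+ n]; the gliding hump along their directions converges to a
    vector on which they are unbounded. *)
Lemma weakly_bounded (E : set H) :
  (forall x, exists C : R, forall y, E y -> `|rdot x y| <= C) ->
  exists C : R, forall y, E y -> rnorm y <= C.
Proof.
move=> Eb; apply: contrapT => nE.
have /choice[f hf] n : exists y, E y /\ 4 ^+ n < rnorm y.
  apply: contrapT => h; apply: nE; exists (4 ^+ n) => y Ey.
  by rewrite leNgt; apply/negP => lt_y; apply: h; exists y.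
have f0 n : 0 < rnorm (f n) by apply: le_lt_trans (hf n).2; rewrite exprn_ge0.
have qf : form_on setT (@rdot R k H) by exact: rdot_form.
have [||x [_ xc xh]] := @form_hump _ _ qf (fun n => (rnorm (f n))^-1 *r f n).
- by [].
- by move=> n; rewrite rdotrZl rdotrZr rdotxx; field; rewrite gt_eqF.
have xg n : rnorm (x n.+1 - x n) <= 1 * 3^-1 ^+ n.
  rewrite mul1r -(ler_pXn2r (n:=2))// ?nnegrE ?rnorm_ge0 ?exprn_ge0 ?invr_ge0//.
  rewrite -rdotxx (le_trans (xc n))// -exprM mulnC exprM.
  by have -> : 3^-1 ^+ 2 = 9^-1 :> R by field.
have [||l xl] := geo_cvg _ _ xg => //; first by apply/andP; split; lra.
have [C hC] := Eb l; have [n hn] := unbounded_hump C.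
have : 3^-1 ^+ n / 2 <= `|rdot l ((rnorm (f n))^-1 *r f n)|.
  have cv : `|rdot (x m) ((rnorm (f n))^-1 *r f n)| @[m --> \oo] -->
            `|rdot l ((rnorm (f n))^-1 *r f n)|.
    by apply: cvg_norm; apply: cvg_rdot => //; exact: cvg_cst.
  apply: (cvgr_to_ge cv); exists n.+1 => // m /= nm; exact: xh.
rewrite rdotrZr normrM ger0_norm ?invr_ge0 ?rnorm_ge0// [X in _ <= X]mulrC ler_pdivlMr//.
have := hC _ (hf n).1; have := (hf n).2; move: hn.
rewrite exprMn => h1 h2 h3 h4.
have : 3^-1 ^+ n / 2 * 4 ^+ n <= C.
  apply: le_trans _ (le_trans h4 h3); rewrite ler_wpM2l ?(ltW h2)//.
by move=> h; move: h1; rewrite ltNge -mulrA mulrC h.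
Qed.

(** This replaces the closed graph theorem for the embedding of [D], with its
    norm, into the completion of [D] for [q]: if it were not bounded, a gliding
    hump along vectors on which [q] is much larger than the norm would be
    Cauchy for [q], and the functional that it defines could not be bounded. *)
Lemma form_bounded (D : set H) (q : H -> H -> R) : form_on D q ->
  (forall x : nat -> H, (forall n, D (x n)) ->
     (forall n, q (x n.+1 - x n) (x n.+1 - x n) <= 9^-1 ^+ n) ->
     exists h : H, forall y, D y -> q (x n) y @[n --> \oo] --> rdot h y) ->
  exists2 C : R, 0 <= C & forall y, D y -> q y y <= C * rnorm y ^+ 2.
Proof.
move=> qf qc; apply: contrapT => nE.
have /choice[f hf] n : exists y, D y /\ 16 ^+ n * rnorm y ^+ 2 < q y y.
  apply: contrapT => h; apply: nE; exists (16 ^+ n); first exact: exprn_ge0.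
  move=> y Ey.
  by rewrite leNgt; apply/negP => lt_y; apply: h; exists y.
have Df n : D (f n) by case: (hf n).
have f0 n : 0 < q (f n) (f n) by apply: le_lt_trans (hf n).2; rewrite mulr_ge0 ?sqr_ge0 ?exprn_ge0.
pose s n := Num.sqrt (q (f n) (f n)).
have s0 n : 0 < s n by rewrite sqrtr_gt0.
have s2 n : s n ^+ 2 = q (f n) (f n) by rewrite sqr_sqrtr// ltW.
have [||x [Dx xc xh]] := @form_hump _ _ qf (fun n => (s n)^-1 *r f n).
- by move=> n; exact: (form_domZ qf).
- move=> n; rewrite (form_Zl qf)// ?(form_Zr qf)//; last exact: (form_domZ qf).
  by rewrite -s2; field; rewrite gt_eqF.
have [h hh] := qc _ Dx xc; have [n hn] := unbounded_hump (rnorm h).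
have : 3^-1 ^+ n / 2 <= `|rdot h ((s n)^-1 *r f n)|.
  have cv : `|q (x m) ((s n)^-1 *r f n)| @[m --> \oo] --> `|rdot h ((s n)^-1 *r f n)|.
    by apply: cvg_norm; apply: hh; exact: (form_domZ qf).
  apply: (cvgr_to_ge cv); exists n.+1 => // m /= nm; exact: xh.
rewrite rdotrZr normrM ger0_norm ?invr_ge0 ?(ltW (s0 n))// [X in _ <= X]mulrC ler_pdivlMr//.
have fs : 4 ^+ n * rnorm (f n) <= s n.
  rewrite -(ler_pXn2r (n:=2))// ?nnegrE ?mulr_ge0 ?rnorm_ge0 ?exprn_ge0 ?(ltW (s0 n))//.
  rewrite exprMn s2 -exprM mulnC exprM (le_trans _ (ltW (hf n).2))// ler_wpM2r ?sqr_ge0//.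
  by have -> : 4 ^+ 2 = 16 :> R by ring.
have := rdot_norm h (f n); move: hn.
rewrite exprMn => h1 h2 h3.
have : 4 ^+ n * (3^-1 ^+ n / 2 * s n) <= rnorm h * s n.
  have p4 : (0 : R) <= 4 ^+ n by exact: exprn_ge0.
  apply: le_trans (ler_wpM2l p4 h3) _; apply: le_trans (ler_wpM2l p4 h2) _.
  by rewrite mulrCA ler_wpM2l ?rnorm_ge0.
by rewrite !mulrA ler_pM2r// => /(lt_le_trans h1); rewrite ltxx.
Qed.

End Forms.

(** * Riesz representation and bounded operators *)

Section Riesz.
Variables (R : realType) (k : scalars) (H : hilbertType R k).
Implicit Types x y z : H.
Local Notation "r *r x" := (scal_of k r *: x) (at level 40).

Lemma sqr_geo (V : normedModType (scal R k)) (C : R) (x : nat -> V) : 0 <= C ->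
  (forall n, rnorm (x n.+1 - x n) ^+ 2 <= C ^+ 2 * 9^-1 ^+ n) ->
  forall n, rnorm (x n.+1 - x n) <= C * 3^-1 ^+ n.
Proof.
move=> C0 h n; rewrite -(ler_pXn2r (n:=2))// ?nnegrE ?rnorm_ge0 ?mulr_ge0 ?exprn_ge0 ?invr_ge0//.
rewrite (le_trans (h n))// exprMn -(exprM _ n 2) mulnC exprM.
by have -> : 3^-1 ^+ 2 = 9^-1 :> R by field.
Qed.

Lemma sqr_geo_cvg (V : completeNormedModType (scal R k)) (C : R) (x : nat -> V) : 0 <= C ->
  (forall n, rnorm (x n.+1 - x n) ^+ 2 <= C ^+ 2 * 9^-1 ^+ n) ->
  exists l : V, x n @[n --> \oo] --> l.
Proof.
by move=> C0 /(sqr_geo C0); apply: geo_cvg => //; apply/andP; split; lra.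
Qed.

Definition rsubspace (D : set H) : Prop :=
  [/\ D 0, forall x y, D x -> D y -> D (x + y) & forall r x, D x -> D (r *r x)].

(** The minimizing sequence of [form_riesz] for [rdot] is Cauchy for the norm,
    so the representing vector is a limit of vectors of [D]; this is what makes
    it the projection of any other representing vector on the closure of [D]. *)
Lemma riesz_on (D : set H) (f : H -> R) (C : R) : rsubspace D -> 0 <= C ->
  (forall x y, D x -> D y -> f (x + y) = f x + f y) ->
  (forall r x, D x -> f (r *r x) = r * f x) ->
  (forall x, D x -> `|f x| <= C * rnorm x) ->
  exists w, (exists2 x : nat -> H, forall n, D (x n) & x n @[n --> \oo] --> w) /\
    forall y, D y -> f y = rdot y w.
Proof.
move=> [D0 DD DZ] C0 fD fZ fC.
have qf := rdot_form D0 DD DZ.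
have [|x [Dx xc xf]] := form_riesz qf (C := C ^+ 2) (sqr_ge0 _) fD fZ.
- move=> x Dx; rewrite rdotxx -exprMn -[leLHS]real_normK ?num_real//.
  by rewrite ler_pXn2r ?nnegrE ?mulr_ge0 ?rnorm_ge0// fC.
- have [n|w xw] := @sqr_geo_cvg _ 1 x ler01; first by rewrite expr1n mul1r -rdotxx.
  exists w; split; first by exists x.
  move=> y Dy; rewrite rdotC.
  exact: rcvg_unique (xf y Dy) (cvg_rdot xw (cvg_cst y)).
Qed.

(** A functional linear over the scalars is determined by its real part. *)
Lemma riesz (f : H -> scal R k) (C : R) :
  (forall x y, f (x + y) = f x + f y) -> (forall a x, f (a *: x) = a * f x) ->
  (forall x, sabs (f x) <= C * rnorm x) ->
  exists w, forall x, f x = dotp x w.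
Proof.
move=> fD fZ fC; have [||||w [_ hw]] := @riesz_on setT (fun x => scal_re (f x)) `|C| _ (normr_ge0 C).
- by split.
- by move=> x y _ _; rewrite fD scal_reD.
- by move=> r x _; rewrite fZ scal_re_ofM.
- move=> x _; apply: le_trans (sabs_re _) _; apply: le_trans (fC x) _.
  by rewrite ler_wpM2r ?rnorm_ge0// ler_norm.
exists w => x; apply: scal_ext => a; rewrite -fZ hw// /rdot dotpZl //.
Qed.

Lemma dotp_injr x y : (forall z, dotp z x = dotp z y) -> x = y.
Proof. by move=> h; apply: rdot_inj => z; rewrite rdotC /rdot h -/(rdot z y) rdotC. Qed.

Definition dense_in (D : set H) : Prop :=
  forall x, exists2 u : nat -> H, forall n, D (u n) & u n @[n --> \oo] --> x.

Lemma perp_dense (D : set H) : rsubspace D ->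
  (forall x, (forall y, D y -> rdot y x = 0) -> x = 0) -> dense_in D.
Proof.
move=> Ds h x.
have [|||w [[u Du uw] hw]] := @riesz_on D (fun y => rdot y x) (rnorm x) Ds (rnorm_ge0 _).
- by move=> y z _ _; rewrite rdotDl.
- by move=> r y _; rewrite rdotrZl.
- by move=> y _; rewrite mulrC; exact: rdot_norm.
exists u => //; suff -> : x = w by [].
apply/eqP; rewrite -subr_eq0; apply/eqP/h => y Dy.
by rewrite rdotBr (hw y Dy) subrr.
Qed.

Lemma dense_ext (D : set H) x y : dense_in D -> (forall z, D z -> rdot z x = rdot z y) -> x = y.
Proof.
move=> Dd h; apply: rdot_inj => z; rewrite !(rdotC _ z).
have [u Du uz] := Dd z; apply: rcvg_unique (cvg_rdot uz (cvg_cst x)) _.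
under eq_fun do rewrite h//.
exact: cvg_rdot uz (cvg_cst y).
Qed.

Lemma dense_bound (D : set H) (C : R) x : dense_in D ->
  (forall z, D z -> rdot z x <= C * rnorm z) -> forall z, rdot z x <= C * rnorm z.
Proof.
move=> Dd h z; have [u Du uz] := Dd z.
apply: (ler_cvg_to (cvg_rdot uz (cvg_cst x))); last first.
  by apply: nearW => n; exact: (h (u n) (Du n)).
by apply: cvgMl_tmp; exact: cvg_rnorm.
Qed.

Lemma dense_rnorm_le (D : set H) (C : R) x : 0 <= C -> dense_in D ->
  (forall z, D z -> rdot z x <= C * rnorm z) -> rnorm x <= C.
Proof. by move=> C0 Dd /(dense_bound Dd); exact: rnorm_rdot_le. Qed.

End Riesz.

Section PlainLinear.
Variables (F : nzRingType) (V W : lmodType F) (L : V -> W).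
Hypothesis Ll : linear L.

Let Lp : {linear V -> W} := HB.pack L (GRing.isLinear.Build _ _ _ _ _ Ll).

Lemma lin_add x y : L (x + y) = L x + L y. Proof. exact: (linearD Lp). Qed.
Lemma lin_opp x : L (- x) = - L x. Proof. exact: (linearN Lp). Qed.
Lemma lin_sub x y : L (x - y) = L x - L y. Proof. exact: (linearB Lp). Qed.
Lemma lin_scale a x : L (a *: x) = a *: L x. Proof. exact: (linearZ_LR Lp). Qed.
Lemma lin_0 : L 0 = 0. Proof. exact: (linear0 Lp). Qed.

End PlainLinear.

Section BoundedOperators.
Variables (R : realType) (k : scalars).

Lemma linear_bound (V W : normedModType (scal R k)) (f : {linear V -> W}) :
  continuous f -> exists2 C : R, 0 < C & forall x, rnorm (f x) <= C * rnorm x.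
Proof.
move=> fc; have /linear_boundedP : bounded_near f (nbhs (0 : V)).
  by apply: continuous_linear_bounded; exact: fc.
move=> /pinfty_ex_gt0[M M0 hM]; exists (scal_re M).
  by rewrite -(scal_of_lt k) scal_of0 scal_reK// ltW.
move=> x; rewrite -(scal_of_le k) scal_ofM !rnormE scal_reK ?(ltW M0)//.
Qed.

Lemma bound_continuous (V W : normedModType (scal R k)) (L : V -> W) (C : R) :
  linear L -> (forall x, rnorm (L x) <= C * rnorm x) -> continuous L.
Proof.
move=> Ll LC x; apply: (cvg_rnorm_le (g := fun y => C * rnorm (y - x))).
  by apply: nearW => y; rewrite -(lin_sub Ll).
have cv : C * rnorm (y - x) @[y --> x] --> C * 0 by apply: cvgMl_tmp; apply/cvg_rnormP; exact: cvg_id.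
by move: cv; rewrite mulr0.
Qed.

Variable H : hilbertType R k.

(** Stated with the adjoint of unbounded operators, which is the form in which
    the extension of the group to the dual of the domain refers to it. *)
Definition opadj (L : H -> H) : H -> H := adjoint (Operator [set: H] L).

Section Adjoint.
Variable L : {linear H -> H}.
Hypothesis L_cont : continuous L.

Lemma dotp_opadj x y : dotp (L x) y = dotp x (opadj L y).
Proof.
rewrite /opadj /=; case: xgetP => [psi _ h|]; first exact: h.
have [C C0 hC] := linear_bound L_cont.
have [||| w hw] := @riesz _ _ _ (fun x => dotp (L x) y) (C * rnorm y).
- by move=> u v; rewrite linearD dotpDl.
- by move=> a u; rewrite linearZ dotpZl.
- move=> u; apply: le_trans (dotp_normM _ _) _.
  by rewrite mulrAC ler_wpM2r ?rnorm_ge0.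
by move=> /(_ w) []; move=> u _; exact: hw.
Qed.

Lemma rdot_opadj x y : rdot (L x) y = rdot x (opadj L y).
Proof. by rewrite /rdot dotp_opadj. Qed.

Lemma opadj_linear : linear (opadj L).
Proof.
move=> a x y; apply: dotp_injr => z; rewrite dotp_antilinear -!dotp_opadj.
by rewrite dotp_antilinear.
Qed.

Lemma opadj_bound (C : R) : 0 <= C -> (forall x, rnorm (L x) <= C * rnorm x) ->
  forall x, rnorm (opadj L x) <= C * rnorm x.
Proof.
move=> C0 h x; apply: rnorm_rdot_le; first by rewrite mulr_ge0 ?rnorm_ge0.
move=> z; rewrite -rdot_opadj; apply: le_trans (rdot_le _ _) _.
by rewrite mulrAC ler_wpM2r ?rnorm_ge0.
Qed.

End Adjoint.

End BoundedOperators.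

(** * Calculus on the real line *)

Section RealCalculus.
Variable R : realType.
Implicit Types (f g : R -> R) (x a b : R).
Notation mu := (@lebesgue_measure R).

Lemma is_deriveP f x d :
  is_derive x 1 f d <-> (h^-1 * (f (x + h) - f x)) @[h --> 0^'] --> d.
Proof.
have E : (fun h : R => h^-1 *: ((f \o shift x) (h *: 1) - f x)) =
         (fun h => h^-1 * (f (x + h) - f x)).
  by apply/funext => h /=; rewrite [h%:A](mulr1) (addrC h).
split=> [[df <-]|fd].
  by move: (df); rewrite /derivable /derive E.
have df : derivable f x 1 by rewrite /derivable E; apply/cvg_ex; exists d.
apply: DeriveDef => //; rewrite /derive E; exact: cvg_lim.
Qed.

Lemma is_derive_cts f x d : is_derive x 1 f d -> {for x, continuous f}.
Proof. by move=> [df _]; exact/differentiable_continuous/derivable1_diffP. Qed.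

Lemma is_derive_unique f x d d' : is_derive x 1 f d -> is_derive x 1 f d' -> d = d'.
Proof. by move=> [_ <-] [_ <-]. Qed.

Lemma rderivM f g x df dg : is_derive x 1 f df -> is_derive x 1 g dg ->
  is_derive x 1 (fun t => f t * g t) (df * g x + f x * dg).
Proof.
move=> hf hg; apply: (@is_derive_eq _ _ _ (fun t => f t * g t) x 1 _ _ (is_deriveM hf hg)).
by rewrite addrC [X in X + _]mulrC.
Qed.

Lemma rderivD f g x df dg : is_derive x 1 f df -> is_derive x 1 g dg ->
  is_derive x 1 (fun t => f t + g t) (df + dg).
Proof. by move=> hf hg; exact: is_deriveD. Qed.

Lemma rderivB f g x df dg : is_derive x 1 f df -> is_derive x 1 g dg ->
  is_derive x 1 (fun t => f t - g t) (df - dg).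
Proof. by move=> hf hg; exact: is_deriveB. Qed.

Lemma rderivN f x df : is_derive x 1 f df -> is_derive x 1 (fun t => - f t) (- df).
Proof. by move=> hf; exact: is_deriveN. Qed.

Lemma rderivC (c x : R) : is_derive x 1 (fun _ : R => c) 0.
Proof. exact: is_derive_cst. Qed.

Lemma rderiv_affine f c (s : R) x df : is_derive (c + s * x) 1 f df ->
  is_derive x 1 (fun t => f (c + s * t)) (s * df).
Proof.
move=> hf; have hg : is_derive x 1 (fun t => c + s * t) s.
  have := rderivD (rderivC c x) (rderivM (rderivC s x) (is_derive_id x (1 : R))).
  by move/is_derive_eq; apply; rewrite mul0r !add0r mulr1.
have := @is_derive1_comp _ f (fun t => c + s * t) x _ _ hf hg.
by move/is_derive_eq; apply; rewrite mulrC.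
Qed.

Lemma rderiv_exp (c x : R) : is_derive x 1 (fun t => expR (c * t)) (c * expR (c * x)).
Proof.
have := @rderiv_affine expR 0 c x (expR (0 + c * x)) (is_derive_expR _).
by rewrite add0r; under eq_fun do rewrite add0r.
Qed.

Lemma expR_scale_cts (c : R) : continuous (fun t => expR (c * t)).
Proof. by move=> t; exact: is_derive_cts (rderiv_exp c t). Qed.

Lemma oppr_cts : continuous (fun t : R => - t).
Proof. by move=> t; apply: cvgN; exact: cvg_id. Qed.

Lemma mvt_bound f df a b (M : R) : a <= b -> (forall x, is_derive x 1 f (df x)) ->
  (forall x, a <= x <= b -> `|df x| <= M) -> `|f b - f a| <= M * (b - a).
Proof.
move=> ab fd fM; have [|c /[!in_itv]/= cab ->] := @MVT_segment _ f df a b ab (fun x _ => fd x).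
  apply: continuous_subspaceT => x; exact: is_derive_cts (fd x).
by rewrite normrM (ger0_norm (_ : 0 <= b - a)) ?subr_ge0// ler_wpM2r ?subr_ge0// fM.
Qed.

Lemma mvt_bound0 f df t (M : R) : (forall x, is_derive x 1 f (df x)) ->
  (forall x, `|x| <= `|t| -> `|df x| <= M) -> `|f t - f 0| <= M * `|t|.
Proof.
move=> fd fM; have [t0|t0] := lerP 0 t.
  rewrite (ger0_norm t0) -[t in M * t]subr0; apply: mvt_bound fd _ => // x /andP[x0 xt].
  by apply: fM; rewrite !ger0_norm.
rewrite distrC (ltr0_norm t0) -[- t]sub0r; apply: mvt_bound fd _ => [|x /andP[x0 xt]]; first exact: ltW.
by apply: fM; rewrite (ltr0_norm t0) (ler0_norm xt) lerN2.
Qed.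

Lemma derive0_eq f a b : (forall x, is_derive x 1 f 0) -> f a = f b.
Proof.
move=> fd; wlog ab : a b / a <= b.
  by move=> h; case: (lerP a b) => [/h//|/ltW/h].
apply/eqP; rewrite eq_sym -subr_eq0 -normr_le0.
have := @mvt_bound f (fun=> 0) a b 0 ab fd; rewrite mul0r; apply.
by move=> x _; rewrite normr0.
Qed.

Lemma cts_integrable f a b : continuous f -> mu.-integrable `[a, b] (EFin \o f).
Proof.
move=> fc; apply: continuous_compact_integrable; first exact: segment_compact.
exact: continuous_subspaceT.
Qed.

(** [G n] is a primitive on the right of [- n%:R]; subtracting its value at 0
    makes it independent of [n], since only the integral between 0 and [x] is
    left. *)
Lemma primitive_exists f : continuous f -> exists P, forall x, is_derive x 1 P (f x).
Proof.
move=> fc.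
pose G n x := (\int[mu]_(t in `[- n%:R, x]) f t) : R.
have dG n x : - n%:R < x -> is_derive x 1 (G n) (f x).
  move=> nx; have [||dG GE] := @continuous_FTC1_closed R f (- n%:R) x (x + 1) _ _ nx (fc x).
  - by rewrite ltrDl.
  - exact: cts_integrable.
  by apply: DeriveDef; [exact: dG | rewrite -derive1E].
pose F x := if 0 <= x then \int[mu]_(t in `]0, x]) f t else - (\int[mu]_(t in `]x, 0]) f t).
have FE n x : - n%:R < x -> G n x - G n 0 = F x.
  move=> nx; have n0 : - n%:R <= 0 :> R by rewrite oppr_le0.
  rewrite /F; case: ifPn => [x0|]; last rewrite -ltNge => /ltW x0.
    by rewrite /G Rintegral_itvB ?bnd_simp//; exact: cts_integrable.
  by rewrite -opprB /G Rintegral_itvB ?bnd_simp ?(ltW nx)//; exact: cts_integrable.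
exists F => x; pose n := Num.bound `|x|.
have nx : - n%:R < x.
  by rewrite ltrNl; apply: le_lt_trans (archi_boundP (normr_ge0 x)); rewrite -normrN ler_norm.
have := rderivB (dG n x nx) (rderivC (G n 0) x); rewrite subr0; apply: near_eq_is_derive.
by have := lt_nbhsr nx; apply: filterS => y; exact: FE.
Qed.

Definition prim f : R -> R := xget (fun=> 0) [set P | forall x, is_derive x 1 P (f x)].

Lemma is_derive_prim f x : continuous f -> is_derive x 1 (prim f) (f x).
Proof.
by move=> /primitive_exists[P hP]; rewrite /prim; case: xgetP => [Q _ h|/(_ P)//]; exact: h.
Qed.

(** Integrals of continuous functions are taken between two arbitrary points by
    means of a primitive, so that additivity in the interval needs no order
    between the end points. *)
Definition itg f a b : R := prim f b - prim f a.

Lemma itgE f P a b : (forall x, is_derive x 1 P (f x)) -> itg f a b = P b - P a.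
Proof.
move=> dP; have dp x : is_derive x 1 (prim f) (f x).
  by rewrite /prim; case: xgetP => [Q _ h|/(_ P)//]; exact: h.
have d0 x : is_derive x 1 (fun t => prim f t - P t) 0.
  by rewrite -(subrr (f x)); exact: rderivB.
have := derive0_eq a b d0; rewrite /itg; lra.
Qed.

Lemma itg_affine f c (s : R) a b : continuous f ->
  s * itg (fun t => f (c + s * t)) a b = itg f (c + s * a) (c + s * b).
Proof.
move=> fc; have [->|s0] := eqVneq s 0; first by rewrite !mul0r /itg subrr.
have h x : is_derive x 1 (fun t => s^-1 * prim f (c + s * t)) (f (c + s * x)).
  have := rderivM (rderivC s^-1 x) (rderiv_affine (is_derive_prim (c + s * x) fc)).
  by move/is_derive_eq; apply; rewrite mul0r add0r mulrA mulVf// mul1r.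
by rewrite (itgE a b h) /itg -mulrBr mulrA divff// mul1r.
Qed.

Lemma itgD f g a b : continuous f -> continuous g ->
  itg (fun t => f t + g t) a b = itg f a b + itg g a b.
Proof.
move=> fc gc; have h x : is_derive x 1 (fun t => prim f t + prim g t) (f x + g x).
  by apply: rderivD; exact: is_derive_prim.
by rewrite (itgE a b h) /itg; ring.
Qed.

Lemma itgZ f (c : R) a b : continuous f -> itg (fun t => c * f t) a b = c * itg f a b.
Proof.
move=> fc; have h x : is_derive x 1 (fun t => c * prim f t) (c * f x).
  by have := rderivM (rderivC c x) (is_derive_prim x fc); rewrite mul0r add0r.
by rewrite (itgE a b h) /itg; ring.
Qed.

Lemma itg_cat f a b c : itg f a b + itg f b c = itg f a c.
Proof. by rewrite /itg; ring. Qed.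

Lemma itg_ge0 f a b : continuous f -> a <= b ->
  (forall x, a <= x <= b -> 0 <= f x) -> 0 <= itg f a b.
Proof.
move=> fc ab f0; have [|c cab h] := @MVT_segment _ (prim f) f a b ab (fun x _ => is_derive_prim x fc).
  apply: continuous_subspaceT => x; exact: is_derive_cts (is_derive_prim x fc).
by rewrite /itg h mulr_ge0 ?subr_ge0// f0//; move: cab; rewrite in_itv.
Qed.

Lemma itg_le f g a b : continuous f -> continuous g -> a <= b ->
  (forall x, a <= x <= b -> f x <= g x) -> itg f a b <= itg g a b.
Proof.
move=> fc gc ab fg; rewrite -subr_ge0 -mulN1r -itgZ// -itgD//; last first.
  by move=> x; apply: cvgM; [exact: cvg_cst | exact: fc].
apply: itg_ge0 => //; last by move=> x /fg; rewrite mulN1r subr_ge0.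
by move=> x; apply: cvgD; [exact: gc|apply: cvgM; [exact: cvg_cst | exact: fc]].
Qed.

(** The integral has derivative [f T], and a function vanishing on a
    neighbourhood of 1 has derivative zero there. *)
Lemma itg_eq0 f : continuous f -> (forall T, 0 <= T -> itg f 0 T = 0) -> f 1 = 0.
Proof.
move=> fc h; apply: is_derive_unique (is_derive_prim 1 fc) _.
have d0 : is_derive (1 : R) 1 (fun=> prim f 0) 0 by exact: rderivC.
suff nh : \forall T \near (1 : R), prim f 0 = prim f T by exact: near_eq_is_derive nh d0.
have : \forall T \near (1 : R), 0 <= T.
  by exists 1; rewrite /= ?ltr01// => T /=; rewrite /ball_ /= ltr_distlC subrr => /andP[/ltW].
move=> nT; near=> T; have T0 : 0 <= T by near: T.
apply/esym; by have := h T T0; rewrite /itg => /eqP; rewrite subr_eq0 => /eqP.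
Unshelve. all: by end_near. Qed.

Lemma integral_itg f a b : continuous f -> a <= b ->
  (\int[mu]_(t in `[a, b]) (f t)%:E)%E = (itg f a b)%:E.
Proof.
move=> fc; rewrite le_eqVlt => /predU1P[->|ab].
  by rewrite set_itv1 integral_set1 /itg subrr.
rewrite (@continuous_FTC2 R f (prim f) a b ab) -?EFinB//.
- exact: continuous_subspaceT.
- split; first by move=> x _; case: (is_derive_prim x fc).
  + exact/cvg_at_right_filter/(is_derive_cts (is_derive_prim a fc)).
  + exact/cvg_at_left_filter/(is_derive_cts (is_derive_prim b fc)).
- by move=> x _; rewrite derive1E; case: (is_derive_prim x fc).
Qed.

Lemma cts_measurable f (D : set R) : measurable D -> continuous f -> measurable_fun D f.
Proof.
move=> mD fc; apply: (@measurable_funS _ _ _ _ setT) => //.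
exact: continuous_measurable_fun.
Qed.

Lemma integral_itg_oo f a b : continuous f -> a <= b ->
  (\int[mu]_(t in `]a, b[) (f t)%:E)%E = (itg f a b)%:E.
Proof.
move=> fc ab; rewrite -integral_itg//; apply/esym/integral_itv_bndoo.
by apply/measurable_EFinP; exact: cts_measurable.
Qed.

Lemma cts_integrable_oo f a b : continuous f -> mu.-integrable `]a, b[ (EFin \o f).
Proof.
move=> fc; apply: (@integrableS _ _ _ mu `[a, b]) => //; last exact: cts_integrable.
exact: subset_itv_oo_cc.
Qed.

Lemma integral_itg_oc (f : R -> R) (a b : R) : continuous f -> a <= b ->
  \int[mu]_(t in `]a, b]) f t = itg f a b.
Proof.
move=> fc ab; rewrite /Rintegral integral_itv_bndoo ?integral_itg_oo//.
by apply/measurable_EFinP; exact: cts_measurable.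
Qed.

End RealCalculus.

(** * Differentiation of vector functions *)

Section VectorDerivative.
Variables (R : realType) (k : scalars) (H : hilbertType R k).
Local Notation "r *r x" := (scal_of k r *: x) (at level 40).
Implicit Types (f g : R -> H) (t : R).

(** The variable is real whereas the scalars of [H] may be complex, hence the
    explicit difference quotient. *)
Definition vderiv f t (d : H) : Prop := h^-1 *r (f (t + h) - f t) @[h --> 0^'] --> d.

Lemma cvg_shift0 (T : topologicalType) (f : R -> T) t (l : T) :
  f s @[s --> t] --> l -> f (t + h) @[h --> 0] --> l.
Proof.
move=> fl; apply: (@cvg_comp _ _ _ (fun h => t + h) f _ (nbhs t)) => //.
have : t + h @[h --> 0] --> t + 0 by apply: cvgD; [exact: cvg_cst|exact: cvg_id].
by rewrite addr0.
Qed.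

Lemma cvg_unshift0 (T : topologicalType) (f : R -> T) t (l : T) :
  f (t + h) @[h --> 0] --> l -> f s @[s --> t] --> l.
Proof.
move=> fl; have -> : f = (fun h => f (t + h)) \o (fun s => s - t).
  by apply/funext => s /=; rewrite addrC subrK.
apply: (@cvg_comp _ _ _ (fun s => s - t) (fun h => f (t + h)) _ (nbhs 0)) => //.
have : s - t @[s --> t] --> t - t by apply: cvgB; [exact: cvg_id|exact: cvg_cst].
by rewrite subrr.
Qed.

Lemma dnbhs0_full (T : topologicalType) (f : R -> T) (l : T) :
  f h @[h --> 0^'] --> l -> f 0 = l -> f h @[h --> 0] --> l.
Proof.
move=> fl f0 A Al; have : \forall h \near (0 : R), h != 0 -> A (f h) by exact: fl A Al.
apply: filterS => h hA /=; have [->|/hA//] := eqVneq h 0.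
by rewrite f0; exact: nbhs_singleton.
Qed.

Lemma full_dnbhs0 (T : topologicalType) (f : R -> T) (l : T) :
  f h @[h --> 0] --> l -> f h @[h --> 0^'] --> l.
Proof.
move=> fl A Al; have : \forall h \near (0 : R), A (f h) by exact: fl A Al.
move=> Af; suff : \forall h \near (0 : R), h != 0 -> A (f h) by [].
by apply: filterS Af. Qed.

Lemma vderiv_cts f t d : vderiv f t d -> f s @[s --> t] --> f t.
Proof.
move=> fd; apply: cvg_unshift0; apply: dnbhs0_full; last by rewrite addr0.
have h0 : (fun h : R => h) h @[h --> 0^'] --> (0 : R) by apply: full_dnbhs0; exact: cvg_id.
have cv : h *r (h^-1 *r (f (t + h) - f t)) + f t @[h --> 0^'] --> scal_of k 0 *: d + f t.
  by apply: cvgD; [exact: cvg_rscale | exact: cvg_cst].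
move: cv; rewrite scal_of0 scale0r add0r => cv; refine (cvg_near_eq _ cv); near=> h.
have h1 : h != 0 by near: h; exact: nbhs_dnbhs_neq.
by rewrite scalerA -scal_ofM divff// scal_of1 scale1r subrK.
Unshelve. all: by end_near. Qed.

Lemma vderiv_rdot f g t df dg : vderiv f t df -> vderiv g t dg ->
  is_derive t 1 (fun s => rdot (f s) (g s)) (rdot df (g t) + rdot (f t) dg).
Proof.
move=> fd gd; apply/is_deriveP.
have gc : g (t + h) @[h --> 0^'] --> g t by apply: full_dnbhs0; apply: cvg_shift0; exact: vderiv_cts gd.
have cv : rdot (h^-1 *r (f (t + h) - f t)) (g (t + h)) + rdot (f t) (h^-1 *r (g (t + h) - g t))
    @[h --> 0^'] --> rdot df (g t) + rdot (f t) dg.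
  by apply: cvgD; apply: cvg_rdot => //; exact: cvg_cst.
refine (cvg_near_eq _ cv); apply: nearW => h.
by rewrite rdotrZl rdotrZr rdotBl rdotBr; ring.
Qed.

Lemma vderiv_cst (x : H) t : vderiv (fun _ => x) t 0.
Proof.
rewrite /vderiv; under eq_fun do rewrite subrr scaler0; exact: cvg_cst.
Qed.

Lemma vderiv_opp f t d : vderiv f (- t) d -> vderiv (fun s => f (- s)) t (- d).
Proof.
move=> fd; rewrite /vderiv.
have E : (fun h => h^-1 *r (f (- (t + h)) - f (- t))) =
   (fun h => - (h^-1 *r (f (- t + h) - f (- t)))) \o (fun h => - h).
  apply/funext => h /=; rewrite opprD invrN scal_ofN scaleNr opprK //.
rewrite E; apply: (@cvg_comp _ _ _ _ _ _ (0^')); last exact: cvgN.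
move=> A [e e0 hA]; exists e => // h /= he h0; apply: hA; last by rewrite oppr_eq0.
by move: he; rewrite /ball_ /= !sub0r !normrN.
Qed.

Lemma vderiv_lin f t d (L : H -> H) : linear L ->
  (exists C, forall x, rnorm (L x) <= C * rnorm x) ->
  vderiv f t d -> vderiv (fun s => L (f s)) t (L d).
Proof.
move=> Ll [C LC] fd; apply: (cvg_rnorm_le (g := fun h => C * rnorm (h^-1 *r (f (t + h) - f t) - d))).
  apply: nearW => h; apply: le_trans (LC _); rewrite le_eqVlt; apply/orP; left; apply/eqP; congr rnorm.
  by rewrite (lin_sub Ll) (lin_scale Ll) (lin_sub Ll).
have cv : C * rnorm (h^-1 *r (f (t + h) - f t) - d) @[h --> 0^'] --> C * 0.
  by apply: cvgMl_tmp; apply/cvg_rnormP.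
by rewrite mulr0 in cv.
Qed.

End VectorDerivative.

(** * The operator of a bounded coercive form *)

Section FormOperator.
Variables (R : realType) (k : scalars) (H : hilbertType R k).
Implicit Types (x y z phi psi w : H) (r : R).
Local Notation "r *r x" := (scal_of k r *: x) (at level 40).
Variables (D : set H) (q : H -> H -> R).
Hypotheses (qf : form_on D q) (D_dense : dense_in D).
Hypothesis D_scale : forall (a : scal R k) phi, D phi -> D (a *: phi).
Hypothesis q_scale : forall (a : scal R k) phi psi, D phi -> D psi ->
  q (a *: phi) psi = q phi (scal_conj a *: psi).
Variables (C c : R).
Hypotheses (C0 : 0 <= C) (qC : forall phi, D phi -> q phi phi <= C * rnorm phi ^+ 2).
Hypotheses (c0 : 0 <= c) (qc : forall phi, D phi -> rnorm phi ^+ 2 <= c * q phi phi).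

Lemma form_norm_le phi psi : D phi -> D psi -> `|q phi psi| <= C * rnorm phi * rnorm psi.
Proof.
move=> Dphi Dpsi.
rewrite -(ler_pXn2r (n:=2))// ?nnegrE ?mulr_ge0 ?rnorm_ge0// real_normK ?num_real//.
apply: le_trans (form_CS qf Dphi Dpsi) _.
have -> : (C * rnorm phi * rnorm psi) ^+ 2 = (C * rnorm phi ^+ 2) * (C * rnorm psi ^+ 2) by ring.
by apply: ler_pM; [exact: (form_ge0 qf)|exact: (form_ge0 qf)|exact: qC|exact: qC].
Qed.

(** The representation theorem yields [L0 phi] for [phi] in [D], with [L0]
    bounded since [q] is. As [q] is symmetric, the transpose of [L0], which is
    defined on all of [H], extends [L0]. *)
Lemma form_operator : exists L : H -> H, [/\ linear L,
  forall x, rnorm (L x) <= C * rnorm x &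
  forall phi psi, D phi -> D psi -> rdot (L phi) psi = q phi psi].
Proof.
have Dsub : rsubspace D.
  by split; [exact: (form_dom0 qf) | exact: (form_domD qf) | exact: (form_domZ qf)].
have /choice[L0 hL0] phi : exists w, D phi -> forall psi, D psi -> rdot w psi = q phi psi.
  have [Dphi|nD] := pselect (D phi); last by exists 0.
  have [||||w [_ hw]] := @riesz_on _ _ _ D (fun psi => q phi psi) (C * rnorm phi) Dsub.
  - by rewrite mulr_ge0 ?rnorm_ge0.
  - by move=> x y Dx Dy; rewrite (form_Dr qf).
  - by move=> r x Dx; rewrite (form_Zr qf).
  - by move=> x Dx; exact: form_norm_le.
  by exists w => _ psi Dpsi; rewrite hw// rdotC.
have L0_le phi : D phi -> rnorm (L0 phi) <= C * rnorm phi.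
  move=> Dphi; apply: (dense_rnorm_le _ D_dense); first by rewrite mulr_ge0 ?rnorm_ge0.
  move=> z Dz; rewrite rdotC hL0//; apply: le_trans (ler_norm _) _; exact: form_norm_le.
have L0D x y : D x -> D y -> L0 (x + y) = L0 x + L0 y.
  move=> Dx Dy; apply: (dense_ext D_dense) => z Dz.
  have Dxy : D (x + y) by exact: (form_domD qf).
  by rewrite !(rdotC z) rdotDl !hL0// (form_Dl qf).
have L0Z a x : D x -> L0 (a *: x) = a *: L0 x.
  move=> Dx; apply: (dense_ext D_dense) => z Dz.
  rewrite !(rdotC z) rdotZ !hL0// ?q_scale//; exact: D_scale.
have /choice[L hL] x : exists w, forall psi, D psi -> rdot w psi = rdot x (L0 psi).
  have [||||w [_ hw]] := @riesz_on _ _ _ D (fun psi => rdot x (L0 psi)) (C * rnorm x) Dsub.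
  - by rewrite mulr_ge0 ?rnorm_ge0.
  - by move=> y z Dy Dz; rewrite L0D// rdotDr.
  - by move=> r y Dy; rewrite L0Z// rdotrZr.
  - move=> y Dy; apply: le_trans (rdot_norm _ _) _.
    by rewrite mulrAC mulrC ler_wpM2r ?rnorm_ge0 ?L0_le.
  by exists w => psi Dpsi; rewrite rdotC -hw.
have L_lin : linear L.
  move=> a x y; apply: (dense_ext D_dense) => z Dz.
  by rewrite !(rdotC z) rdotDl rdotZ !hL// ?rdotDl ?rdotZ ?L0Z//; exact: D_scale.
have L_le x : rnorm (L x) <= C * rnorm x.
  apply: (dense_rnorm_le _ D_dense); first by rewrite mulr_ge0 ?rnorm_ge0.
  move=> z Dz; rewrite rdotC hL//; apply: le_trans (rdot_le _ _) _.
  by rewrite mulrAC [leRHS]mulrC ler_wpM2l ?rnorm_ge0 ?L0_le.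
have L_D phi : D phi -> L phi = L0 phi.
  move=> Dphi; apply: (dense_ext D_dense) => z Dz.
  by rewrite !(rdotC z) hL// rdotC !hL0// (form_C qf).
by exists L; split=> // phi psi Dphi Dpsi; rewrite L_D// hL0.
Qed.

Section Inverse.
Variables (L : H -> H) (L_lin : linear L) (L_le : forall x, rnorm (L x) <= C * rnorm x).
Hypothesis LD : forall phi psi, D phi -> D psi -> rdot (L phi) psi = q phi psi.

Let L_cvg (v : nat -> H) x : v n @[n --> \oo] --> x -> L (v n) @[n --> \oo] --> L x.
Proof. by move=> vx; apply: cvg_cts_comp; [exact: vx | exact: bound_continuous L_lin L_le _]. Qed.

(** On [D] this is [q x x <= |L x| |x|] combined with coercivity; it extends by
    density. *)
Lemma form_operator_coercive x : rnorm x <= c * rnorm (L x).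
Proof.
have h : rnorm x ^+ 2 <= c * rdot (L x) x.
  have [v Dv vx] := D_dense x.
  have sq : rnorm (v n) ^+ 2 @[n --> \oo] --> rnorm x ^+ 2.
    by rewrite expr2; under eq_fun do rewrite expr2; apply: cvgM; exact: cvg_rnorm.
  apply: (ler_cvg_to sq (cvgMl_tmp (a := c) (cvg_rdot (L_cvg vx) vx))).
  by apply: nearW => n; rewrite LD// qc.
have := rnorm_ge0 x; rewrite le_eqVlt => /predU1P[<-|x0]; first by rewrite mulr_ge0 ?rnorm_ge0.
rewrite -(ler_pM2r x0) -expr2 (le_trans h)// -mulrA ler_wpM2l//; exact: rdot_le.
Qed.

(** The functional [rdot y] is bounded for [q] by coercivity, so [form_riesz]
    applies; its sequence is Cauchy for [q], hence for the norm. The sequence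
    itself is kept: its increments for [q] are what bounds the corresponding
    controls. *)
Lemma form_operator_onto y : exists (v : nat -> H) x, [/\ forall n, D (v n),
  forall n, q (v n.+1 - v n) (v n.+1 - v n) <= 9^-1 ^+ n,
  v n @[n --> \oo] --> x & L x = y].
Proof.
have [||||v [Dv vq vy]] := @form_riesz _ _ _ D q qf (fun z => rdot y z) (rnorm y ^+ 2 * c).
- by rewrite mulr_ge0 ?sqr_ge0.
- by move=> x z _ _; rewrite rdotDr.
- by move=> r x _; rewrite rdotrZr.
- move=> x Dx; rewrite -mulrA; apply: (@le_trans _ _ (rnorm y ^+ 2 * rnorm x ^+ 2)).
    by rewrite -exprMn -real_normK ?num_real// ler_pXn2r ?nnegrE ?mulr_ge0 ?rnorm_ge0// rdot_norm.
  by rewrite ler_wpM2l ?sqr_ge0// qc.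
have [|x vx] := @sqr_geo_cvg _ _ _ (Num.sqrt c) v (sqrtr_ge0 c).
  move=> n; rewrite sqr_sqrtr//; apply: le_trans (qc (form_domB qf (Dv _) (Dv _))) _.
  by rewrite ler_wpM2l.
exists v, x; split=> //; apply: (dense_ext D_dense) => z Dz; rewrite !(rdotC z).
apply: rcvg_unique (cvg_rdot (L_cvg vx) (cvg_cst z)) _.
by under eq_fun do rewrite LD//; exact: vy.
Qed.

End Inverse.

End FormOperator.

(** * Strong measurability and square integrable functions *)

(** Cousin's lemma: a property of intervals that is additive and holds for all
    small intervals around each point holds for the whole interval. The
    supremum of the [x] such that [P a x] is attained and cannot be less than
    [b]. *)
Lemma interval_ind (R : realType) (P : R -> R -> Prop) (a b : R) : a <= b ->
  (forall x y z, P x y -> P y z -> P x z) ->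
  (forall t, a <= t <= b -> exists2 d : R, 0 < d &
     forall x y, a <= x -> x <= t -> t <= y -> y <= b -> y - x < d -> P x y) ->
  P a b.
Proof.
move=> ab Ptrans Ploc.
pose E := [set x | a <= x <= b /\ P a x].
have aE : E a.
  split; first by rewrite lexx.
  have [|d d0 hd] := Ploc a; first by rewrite lexx.
  by apply: hd => //; rewrite subrr.
have supE : has_sup E by split; [exists a | exists b => x [/andP[]]].
pose c := sup E.
have ac : a <= c by apply: ub_le_sup => //; exact: supE.2.
have cb : c <= b by apply: ge_sup; [exact: supE.1 | move=> x [/andP[]]].
have [|d d0 hd] := Ploc c; first by rewrite ac.
have [x Ex cx] : exists2 x, E x & c - d / 2 < x.
  by apply: sup_adherent => //; rewrite divr_gt0.
have xc : x <= c by apply: ub_le_sup => //; exact: supE.2.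
have [/andP[ax xb] Px] := Ex.
pose y := Num.min b (c + d / 4).
have cy : c <= y by rewrite le_min cb lerDl divr_ge0// ltW.
have yb : y <= b by rewrite ge_min lexx.
have yc : y <= c + d / 4 by rewrite ge_min lexx orbT.
have Py : P a y by apply: Ptrans Px _; apply: hd => //; lra.
have : E y by split=> //; rewrite yb (le_trans ac).
move=> /(ub_le_sup supE.2); rewrite -/c => yc'.
have yE : y = c by apply/eqP; rewrite eq_le yc' cy.
suff -> : b = y by [].
by move: yE; rewrite /y; case: (lerP b (c + d / 4)) => // _; lra.
Qed.

Section StrongMeasurability.
Variables (R : realType) (k : scalars) (V : normedModType (scal R k)).
Notation mu := (@lebesgue_measure R).
Implicit Types (s f : R -> V) (D E : set R).

Lemma simple_fun_cst (c : V) : simple_fun (fun=> c).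
Proof.
split; first by apply: (sub_finite_set (B := [set c])) => // _ [t _ <-].
move=> v; have [->|cv] := pselect (c = v).
  by rewrite (_ : _ @^-1` _ = setT)//; apply/seteqP; split.
by rewrite (_ : _ @^-1` _ = set0)//; apply/seteqP; split.
Qed.

Lemma simple_fun_if (E : set R) s1 s2 : measurable E -> simple_fun s1 -> simple_fun s2 ->
  simple_fun (fun t => if t \in E then s1 t else s2 t).
Proof.
move=> mE [f1 m1] [f2 m2]; split.
  apply: (sub_finite_set (B := range s1 `|` range s2)); last by rewrite finite_setU.
  by move=> _ [t _ <-]; case: ifP => _; [left; exists t | right; exists t].
move=> v; rewrite (_ : _ @^-1` _ = (E `&` s1 @^-1` [set v]) `|` (~` E `&` s2 @^-1` [set v])).
  by apply: measurableU; apply: measurableI => //; exact: measurableC.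
apply/seteqP; split=> t /=.
  by case: ifPn => [/set_mem Et|/negP Et] h; [left|right; split=> //] => // /mem_set.
by case=> -[Et h]; [rewrite mem_set|rewrite memNset].
Qed.

Lemma simple_comp_measurable (F : V -> R -> R) s D : measurable D -> simple_fun s ->
  (forall c, measurable_fun D (F c)) -> measurable_fun D (fun t => F (s t) t).
Proof.
move=> mD [fs ms] mF _ Y mY.
rewrite (_ : _ `&` _ = \bigcup_(c in range s) (s @^-1` [set c] `&` (D `&` F c @^-1` Y))).
  by apply: fin_bigcup_measurable => // c _; apply: measurableI => //; exact: mF.
apply/seteqP; split=> t /=; first by move=> [Dt Yt]; exists (s t) => //; exists t.
by move=> [_ _ [/= <- [Dt Yt]]].
Qed.

(** Composition with a function of two variables reduces by a pointwise limit
    to simple functions, for which it is a finite gluing. *)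
Lemma strong_comp_measurable (F : V -> R -> R) f D : measurable D -> strongly_measurable D f ->
  (forall c, measurable_fun D (F c)) ->
  (forall t, D t -> {for f t, continuous (F ^~ t)}) ->
  measurable_fun D (fun t => F (f t) t).
Proof.
move=> mD [s [ss sf]] mF cF.
apply: (@measurable_fun_cvg _ _ _ _ (fun n t => F (s n t) t)).
  by move=> n; exact: simple_comp_measurable.
by move=> t Dt; apply: (@cvg_cts_comp _ _ _ _ (s ^~ t) (F ^~ t)); [exact: sf | exact: cF].
Qed.

Lemma strongly_measurableS D E f : E `<=` D -> strongly_measurable D f -> strongly_measurable E f.
Proof. by move=> ED [s [ss sf]]; exists s; split=> // t /ED/sf. Qed.

(** By continuity a constant works near each point, and approximations on
    adjacent intervals can be glued, so that [interval_ind] applies. *)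
Lemma simple_approx (f : R -> V) (a b e : R) : a <= b -> 0 < e -> continuous f ->
  exists2 s, simple_fun s & forall t, a <= t <= b -> rnorm (s t - f t) <= e.
Proof.
move=> ab e0 fc.
pose P x y := exists2 s, simple_fun s & forall t, x <= t <= y -> rnorm (s t - f t) <= e.
have : P a b; last by [].
apply: interval_ind => //.
- move=> x y z [s1 ss1 h1] [s2 ss2 h2].
  exists (fun t => if t \in [set` `]-oo, y]] then s1 t else s2 t).
    exact: simple_fun_if.
  move=> t /andP[xt tz]; rewrite mem_setE in_itv /=; have [ty|ty] := lerP t y; first by apply: h1; rewrite xt.
  by apply: h2; rewrite tz ltW.
- move=> t _; have /cvg_rnormP/cvgrPdist_le/(_ _ e0)/nbhs_ballP[d /= d0 hd] := fc t.
  exists d => // x y _ xt ty _ yx; exists (fun=> f t); first exact: simple_fun_cst.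
  move=> r /andP[xr ry]; have := hd r; rewrite sub0r normrN ger0_norm ?rnorm_ge0// rnormB; apply.
  by rewrite /ball /= ltr_norml; apply/andP; split; lra.
Qed.

(** The [n]-th function is approximated up to [n.+1%:R^-1] on the interval of
    radius [n] by a simple function. On the exceptional set [N] the value 0 is
    simple. *)
Lemma strongly_measurable_lim D N (v : nat -> R -> V) f : measurable N ->
  (forall n, continuous (v n)) ->
  (forall t, D t -> ~ N t -> v n t @[n --> \oo] --> f t) ->
  (forall t, N t -> f t = 0) -> strongly_measurable D f.
Proof.
move=> mN vc vf f0.
have /choice[s hs] n : exists s, simple_fun s /\
    forall t, - n%:R <= t <= n%:R -> rnorm (s t - v n t) <= n.+1%:R^-1.
  have [||s ss hs] := @simple_approx (v n) (- n%:R) n%:R n.+1%:R^-1 _ _ (vc n).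
  - by rewrite lerNl (le_trans (_ : _ <= 0)) ?oppr_le0// ?ler0n//.
  - by rewrite invr_gt0.
  by exists s.
exists (fun n t => if t \in N then 0 else s n t); split.
  by move=> n; apply: simple_fun_if => //; [exact: simple_fun_cst | exact: (hs n).1].
move=> t Dt; have [Nt|Nt] := pselect (N t).
  by rewrite mem_set// f0//; exact: cvg_cst.
rewrite memNset//.
apply: (cvg_rnorm_le (g := fun n => n.+1%:R^-1 + rnorm (v n t - f t))).
  exists (Num.bound `|t|) => // n /= tn; apply: le_trans (rnorm_triB _ (v n t) _) _.
  rewrite lerD2r; apply: (hs n).2; rewrite -ler_norml.
  by apply: ltW; apply: lt_le_trans (archi_boundP (normr_ge0 t)) _; rewrite ler_nat.
suff : n.+1%:R^-1 + rnorm (v n t - f t) @[n --> \oo] --> (0 + 0 : R) by rewrite addr0.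
apply: cvgD; first exact: cvg_harmonic.
by apply/cvg_rnormP; exact: vf.
Qed.

Lemma cts_strongly_measurable D f : continuous f -> strongly_measurable D f.
Proof.
move=> fc; apply: (@strongly_measurable_lim D set0 (fun=> f)) => //.
by move=> t _ _; exact: cvg_cst.
Qed.

End StrongMeasurability.

Lemma le_integral_ge0 (R : realType) (D : set R) (f g : R -> \bar R) : measurable D ->
  measurable_fun D f -> measurable_fun D g ->
  (forall t, D t -> (0 <= f t)%E) -> (forall t, D t -> (f t <= g t)%E) ->
  (\int[@lebesgue_measure R]_(t in D) f t <= \int[@lebesgue_measure R]_(t in D) g t)%E.
Proof.
by move=> mD mf mg f0 fg; apply: ge0_le_integral.
Qed.

Section L2Functions.
Variables (R : realType) (k : scalars) (U : hilbertType R k).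
Notation mu := (@lebesgue_measure R).
Implicit Types (u v w : R -> U) (D E : set R).

Lemma rnorm_sqr_cts v : continuous v -> continuous (fun t => rnorm (v t) ^+ 2).
Proof.
move=> vc t.
have : rnorm (v s) * rnorm (v s) @[s --> t] --> rnorm (v t) * rnorm (v t).
  by apply: cvgM; apply: cvg_rnorm; exact: vc.
by [].
Qed.

Lemma strong_measurable_dist D u v : measurable D -> strongly_measurable D u -> continuous v ->
  measurable_fun D (fun t => rnorm (u t - v t) ^+ 2).
Proof.
move=> mD mu_ vc; apply: (@strong_comp_measurable _ _ _ (fun x t => rnorm (x - v t) ^+ 2)) => //.
  move=> c; apply: cts_measurable => //; apply: (@rnorm_sqr_cts (fun t => c - v t)).
  by move=> t; apply: cvgB; [exact: cvg_cst | exact: vc].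
move=> t _; apply: (@cvg_cts_comp _ _ _ _ (fun x => rnorm (x - v t)) (fun r => r ^+ 2)).
  by apply: cvg_rnorm; apply: cvgB; [exact: cvg_id | exact: cvg_cst].
exact: exprn_continuous.
Qed.

Lemma strong_measurable_rdot D u w : measurable D -> strongly_measurable D u ->
  strongly_measurable D w -> measurable_fun D (fun t => rdot (u t) (w t)).
Proof.
move=> mD mu_ mw; apply: (@strong_comp_measurable _ _ _ (fun x t => rdot x (w t))) => //.
  move=> c; apply: (@strong_comp_measurable _ _ _ (fun x t => rdot c x)) => //.
  by move=> t _; apply: cvg_rdot; [exact: cvg_cst | exact: cvg_id].
by move=> t _; apply: cvg_rdot; [exact: cvg_id | exact: cvg_cst].
Qed.

Lemma strong_measurable_sqr D u : measurable D -> strongly_measurable D u ->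
  measurable_fun D (fun t => rnorm (u t) ^+ 2).
Proof.
move=> mD mu_; have := strong_measurable_rdot mD mu_ mu_.
by under eq_fun do rewrite rdotxx.
Qed.

(** Completeness of the space of square integrable functions along a fast
    sequence. The series [g] of the squared increments with weights [4 ^+ n]
    has a finite integral. Where [g] is finite the increments are dominated by
    a geometric sequence, so the sequence converges at a distance controlled by
    [g]; the set where [g] is infinite is negligible. *)
Lemma L2_limit D (v : nat -> R -> U) (C : R) : measurable D -> 0 <= C ->
  (forall n, continuous (v n)) ->
  (forall n, \int[mu]_(t in D) (rnorm (v n.+1 t - v n t) ^+ 2)%:E <= (C * 9^-1 ^+ n)%:E)%E ->
  exists2 u, strongly_measurable D u &
    forall n, (\int[mu]_(t in D) (rnorm (u t - v n t) ^+ 2)%:E <= (8 * C * 4^-1 ^+ n)%:E)%E.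
Proof.
move=> mD C0 vc vC.
pose a n t := (4 ^+ n * rnorm (v n.+1 t - v n t) ^+ 2)%:E : \bar R.
have a0 n t : (0 <= a n t)%E by rewrite /a lee_fin mulr_ge0 ?sqr_ge0 ?exprn_ge0//.
have ac n : continuous (fun t => rnorm (v n.+1 t - v n t) ^+ 2).
  apply: (@rnorm_sqr_cts (fun t => v n.+1 t - v n t)).
  by move=> t; apply: cvgB; exact: vc.
have am n : measurable_fun setT (a n).
  apply/measurable_EFinP; apply: measurable_funM; first exact: measurable_cst.
  exact: cts_measurable.
pose g t := (\sum_(n <oo) a n t)%E.
have g0 t : (0 <= g t)%E by apply: nneseries_ge0.
have gm : measurable_fun setT g by apply: (@ge0_emeasurable_sum _ _ _ setT a xpredT) => [n t _ _|n _]; [exact: a0 | exact: am].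
have gD : (\int[mu]_(t in D) g t <= (2 * C)%:E)%E.
  rewrite (integral_nneseries mu mD (fun n => measurable_funTS (am n)) (fun n x _ => a0 n x)).
  apply: lime_le; first by apply: is_cvg_nneseries => n _ _; apply: integral_ge0 => t _; exact: a0.
  apply: nearW => n.
  apply: (@le_trans _ _ (\sum_(0 <= i < n) (C * (4 / 9) ^+ i)%:E)%E).
    apply: lee_sum => i _; rewrite /a; under eq_integral do rewrite EFinM.
    have am' : measurable_fun D (fun t => (rnorm (v i.+1 t - v i t) ^+ 2)%:E).
      by apply/measurable_EFinP; exact: cts_measurable.
    rewrite (ge0_integralZl mu mD am') => [|t _|]; rewrite ?lee_fin ?sqr_ge0 ?exprn_ge0//.
    apply: le_trans (lee_wpmul2l _ (vC i)) _; first by rewrite lee_fin exprn_ge0.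
    by rewrite -EFinM lee_fin mulrCA -exprMn.
  rewrite sumEFin lee_fin.
  have -> : \sum_(0 <= i < n) C * (4 / 9) ^+ i = C * (9 / 5) * (1 - (4 / 9) ^+ n).
    elim: n => [|n ih]; first by rewrite big_nil expr0 subrr mulr0.
    by rewrite big_nat_recr//= ih exprS; field.
  have e0 : 0 <= (4 / 9) ^+ n :> R by rewrite exprn_ge0// divr_ge0.
  apply: (@le_trans _ _ (C * (9 / 5))).
    by rewrite ler_piMr ?mulr_ge0 ?divr_ge0// gerBl.
  by rewrite mulrC ler_wpM2r//; lra.
have g_fin t : g t != +oo%E -> exists2 r : R, 0 <= r & g t = r%:E.
  by move: (g0 t); case: (g t) => // r r0 _; exists r.
have inc t r : 0 <= r -> g t = r%:E ->
    forall n, rnorm (v n.+1 t - v n t) <= Num.sqrt r * 2^-1 ^+ n.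
  move=> r0 gt n; have : (a n t <= g t)%E.
    apply: le_trans (_ : (\sum_(0 <= i < n.+1) a i t <= _)%E); last first.
      by apply: nneseries_lim_ge.
    by rewrite big_nat_recr//= leeDr// sume_ge0.
  rewrite gt lee_fin => h.
  rewrite -(ler_pXn2r (n:=2))// ?nnegrE ?rnorm_ge0 ?mulr_ge0 ?sqrtr_ge0 ?exprn_ge0 ?invr_ge0//.
  rewrite exprMn sqr_sqrtr// -exprM mulnC exprM.
  have -> : 2^-1 ^+ 2 = 4^-1 :> R by field.
  by rewrite exprVn ler_pdivlMr ?exprn_gt0// mulrC.
pose u t := if g t == +oo%E then 0 else xget 0 [set l | v n t @[n --> \oo] --> l].
have ul t : g t != +oo%E -> v n t @[n --> \oo] --> u t.
  move=> gt; rewrite /u (negbTE gt); have [r r0 gtr] := g_fin t gt.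
  have [||l vl] := geo_cvg _ _ (inc t r r0 gtr); first exact: sqrtr_ge0.
    by apply/andP; split; lra.
  by case: xgetP => [//|/(_ l)].
have um : strongly_measurable D u.
  apply: (@strongly_measurable_lim _ _ _ _ [set t | (+oo <= g t)%E] v) => //.
  - by have := emeasurable_fun_c_infty measurableT gm +oo%E; rewrite setTI.
  - by move=> t _ /= gt; apply: ul; apply/eqP => ge; apply: gt; rewrite ge.
  - by move=> t /=; rewrite leye_eq /u => ->.
have key t n : ((rnorm (u t - v n t) ^+ 2)%:E <= (4 * 4^-1 ^+ n)%:E * g t)%E.
  have [ge|gt] := eqVneq (g t) +oo%E.
    by rewrite ge gt0_muley ?leey// lte_fin mulr_gt0 ?exprn_gt0 ?invr_gt0.
  have [r r0 gtr] := g_fin t gt; rewrite gtr -EFinM lee_fin.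
  have -> : 4 * 4^-1 ^+ n * r = (Num.sqrt r / (1 - 2^-1) * 2^-1 ^+ n) ^+ 2.
    rewrite !exprMn sqr_sqrtr// -(exprM _ n) mulnC exprM.
    have -> : 2^-1 ^+ 2 = 4^-1 :> R by field.
    by set e := _ ^+ n; field.
  rewrite ler_pXn2r ?nnegrE ?rnorm_ge0//; last first.
    by rewrite !mulr_ge0 ?sqrtr_ge0 ?invr_ge0 ?exprn_ge0// ?invr_ge0//; lra.
  have cv : rnorm (v m t - v n t) @[m --> \oo] --> rnorm (u t - v n t).
    by apply: cvg_rnorm; apply: cvgB; [exact: ul | exact: cvg_cst].
  apply: (cvgr_to_le cv); exists n => // m /= nm.
  have r01 : (0 <= 2^-1 :> R) && (2^-1 < 1 :> R) by (apply/andP; split; lra).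
  by apply: (@geo_dist _ _ _ (v ^~ t) _ _ _ r01 (inc t r r0 gtr) _ _ nm); exact: sqrtr_ge0.
exists u => // n; apply: (@le_trans _ _ (\int[mu]_(t in D) ((4 * 4^-1 ^+ n)%:E * g t))%E).
  apply: le_integral_ge0 => //.
  - by apply/measurable_EFinP; exact: strong_measurable_dist.
  - by apply: measurable_funeM; exact: measurable_funTS.
  - by move=> t _; rewrite lee_fin sqr_ge0.
rewrite (ge0_integralZl mu mD (measurable_funTS gm)) => [|t _|].
- apply: le_trans (lee_wpmul2l _ gD) _; first by rewrite lee_fin mulr_ge0 ?exprn_ge0 ?invr_ge0//.
  by rewrite -EFinM lee_fin; set e := _ ^+ n; rewrite le_eqVlt; apply/orP; left; apply/eqP; ring.
- exact: g0.
- by rewrite lee_fin mulr_ge0 ?exprn_ge0 ?invr_ge0.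
Qed.

End L2Functions.

Section L2Products.
Variables (R : realType) (k : scalars) (U : hilbertType R k).
Notation mu := (@lebesgue_measure R).
Implicit Types (u v w : R -> U) (T : R).

Lemma rnormD_sqr (x y : U) : rnorm (x + y) ^+ 2 <= 2 * rnorm x ^+ 2 + 2 * rnorm y ^+ 2.
Proof.
rewrite -!rdotxx rdotDl !rdotDr (rdotC y x).
have : 0 <= rdot (x - y) (x - y) by rewrite rdotxx sqr_ge0.
by rewrite rdotBl !rdotBr (rdotC y x); lra.
Qed.

Lemma rdot_sqr_bound (x y : U) : `|rdot x y| <= rnorm x ^+ 2 + rnorm y ^+ 2.
Proof.
apply: le_trans (rdot_norm _ _) _.
have := sqr_ge0 (rnorm x - rnorm y).
have := mulr_ge0 (rnorm_ge0 x) (rnorm_ge0 y).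
rewrite sqrrB -mulr_natl; lra.
Qed.

(** The integral of the squared norm of [u + s w] is a nonnegative polynomial
    in the real number [s]. *)
Lemma int_CS (D : set R) u w : measurable D ->
  mu.-integrable D (EFin \o (fun t => rnorm (u t) ^+ 2)) ->
  mu.-integrable D (EFin \o (fun t => rdot (u t) (w t))) ->
  mu.-integrable D (EFin \o (fun t => rnorm (w t) ^+ 2)) ->
  (\int[mu]_(t in D) rdot (u t) (w t)) ^+ 2 <=
  (\int[mu]_(t in D) (rnorm (u t) ^+ 2)) * \int[mu]_(t in D) (rnorm (w t) ^+ 2).
Proof.
move=> mD iu iuw iw; apply: quad_disc.
  by apply: Rintegral_ge0 => t _; exact: sqr_ge0.
move=> s.
have i2 : mu.-integrable D (EFin \o (fun t => 2 * s * rdot (u t) (w t))).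
  by have := integrableZl (mu := mu) mD (2 * s) iuw; apply: eq_integrable => // t _ /=; rewrite EFinM.
have i3 : mu.-integrable D (EFin \o (fun t => s ^+ 2 * rnorm (w t) ^+ 2)).
  by have := integrableZl (mu := mu) mD (s ^+ 2) iw; apply: eq_integrable => // t _ /=; rewrite EFinM.
have i12 : mu.-integrable D (EFin \o (fun t => rnorm (u t) ^+ 2 + 2 * s * rdot (u t) (w t))).
  by have := integrableD (mu := mu) mD iu i2; apply: eq_integrable.
have : 0 <= \int[mu]_(t in D) (rnorm (u t) ^+ 2 + 2 * s * rdot (u t) (w t) + s ^+ 2 * rnorm (w t) ^+ 2).
  apply: Rintegral_ge0 => t _.
  have : 0 <= rdot (u t + scal_of k s *: w t) (u t + scal_of k s *: w t) by rewrite rdotxx sqr_ge0.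
  by rewrite rdotDl !rdotDr !rdotrZl !rdotrZr (rdotC (w t)) -!rdotxx; lra.
rewrite RintegralD// RintegralD// !RintegralZl//.
by move=> h; apply: le_trans h _; rewrite le_eqVlt; apply/orP; left; apply/eqP; ring.
Qed.

Section Interval.
Variable T : R.
Notation D := [set` `]0, T[].

Lemma L2_sqr_integrable u : in_L2 T u -> mu.-integrable D (EFin \o (fun t => rnorm (u t) ^+ 2)).
Proof.
move=> [um uT]; apply/integrableP; split.
  by apply/measurable_EFinP; exact: strong_measurable_sqr.
by under eq_integral do rewrite /= ger0_norm ?sqr_ge0//.
Qed.

Lemma L2_rdot_integrable u w : in_L2 T u -> in_L2 T w ->
  mu.-integrable D (EFin \o (fun t => rdot (u t) (w t))).
Proof.
move=> uL wL; have := integrableD (mu := mu) (measurable_itv _) (L2_sqr_integrable uL) (L2_sqr_integrable wL).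
apply: le_integrable => //.
  by apply/measurable_EFinP; apply: strong_measurable_rdot => //; [case: uL | case: wL].
move=> t _ /=; rewrite lee_fin [leRHS]ger0_norm ?addr_ge0 ?sqr_ge0//; exact: rdot_sqr_bound.
Qed.

Lemma cts_in_L2 v : continuous v -> in_L2 T v.
Proof.
move=> vc; split; first exact: cts_strongly_measurable.
by apply: integrable_lty => //; apply: cts_integrable_oo; exact: rnorm_sqr_cts.
Qed.

Lemma L2_of_dist u v : strongly_measurable D u -> continuous v ->
  (\int[mu]_(t in D) (rnorm (u t - v t) ^+ 2)%:E < +oo)%E -> in_L2 T u.
Proof.
move=> um vc uv; split=> //.
have mD : measurable D by [].
have md := strong_measurable_dist mD um vc.
have [vm vL] := cts_in_L2 vc.
have mv := strong_measurable_sqr mD vm.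
apply: (@le_lt_trans _ _ (\int[mu]_(t in D) ((2 * rnorm (u t - v t) ^+ 2)%:E + (2 * rnorm (v t) ^+ 2)%:E))%E).
  apply: le_integral_ge0 => //.
  - by apply/measurable_EFinP; exact: strong_measurable_sqr.
  - by apply: emeasurable_funD; apply/measurable_EFinP; apply: measurable_funM.
  - by move=> t _; rewrite lee_fin sqr_ge0.
  - by move=> t _; rewrite -EFinD lee_fin -[X in rnorm X](subrK (v t)); exact: rnormD_sqr.
rewrite ge0_integralD//; last 4 first.
- by move=> t _; rewrite lee_fin mulr_ge0 ?sqr_ge0.
- by apply/measurable_EFinP; apply: measurable_funM.
- by move=> t _; rewrite lee_fin mulr_ge0 ?sqr_ge0.
- by apply/measurable_EFinP; apply: measurable_funM.
under eq_integral do rewrite EFinM.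
under [X in (_ + X)%E]eq_integral do rewrite EFinM.
rewrite !ge0_integralZl//; try by [move=> t _; rewrite lee_fin sqr_ge0 | apply/measurable_EFinP].
by rewrite lte_add_pinfty// lte_mul_pinfty// ?lee_fin.
Qed.

Lemma L2_rdot_cvg u (v : nat -> R -> U) w : in_L2 T u -> (forall n, continuous (v n)) ->
  in_L2 T w ->
  (\int[mu]_(t in D) (rnorm (u t - v n t) ^+ 2)%:E)%E @[n --> \oo] --> 0%E ->
  \int[mu]_(t in D) rdot (v n t) (w t) @[n --> \oo] --> \int[mu]_(t in D) rdot (u t) (w t).
Proof.
move=> uL vc wL uv.
have mD : measurable D by [].
have iw := L2_sqr_integrable wL.
pose W := \int[mu]_(t in D) (rnorm (w t) ^+ 2).
have W0 : 0 <= W by apply: Rintegral_ge0 => t _; exact: sqr_ge0.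
apply/cvgrPdist_le => e e0.
have e1 : 0 < e ^+ 2 / (W + 1) by rewrite divr_gt0 ?exprn_gt0//; lra.
have := uv; move=> /fine_cvgP[uv1 /cvgrPdist_le/(_ _ e1) uv2].
apply: filterS2 uv1 uv2 => n fin_n.
rewrite sub0r normrN => le_n.
have vL := cts_in_L2 (vc n).
have iuw := L2_rdot_integrable uL wL.
have ivw := L2_rdot_integrable vL wL.
rewrite -RintegralB//; under eq_Rintegral do rewrite -rdotBl.
have id : mu.-integrable D (EFin \o (fun t => rnorm (u t - v n t) ^+ 2)).
  apply/integrableP; split.
    by apply/measurable_EFinP; apply: strong_measurable_dist => //; case: uL.
  under eq_integral do rewrite /= ger0_norm ?sqr_ge0//.
  by rewrite -ge0_fin_numE//; apply: integral_ge0 => t _; rewrite lee_fin sqr_ge0.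
have idw : mu.-integrable D (EFin \o (fun t => rdot (u t - v n t) (w t))).
  by have := integrableB (mu := mu) mD iuw ivw; apply: eq_integrable => // t _ /=; rewrite rdotBl.
have := int_CS mD id idw iw; rewrite -/W => cs.
rewrite -(ler_pXn2r (n:=2))// ?nnegrE ?(ltW e0)// real_normK ?num_real//.
apply: le_trans cs _.
have : (\int[mu]_(t in D) (rnorm (u t - v n t) ^+ 2)) <= e ^+ 2 / (W + 1).
  by apply: le_trans le_n; exact: ler_norm.
move=> /(ler_wpM2r W0) /le_trans; apply.
have -> : e ^+ 2 / (W + 1) * W = e ^+ 2 * (W / (W + 1)) by field; lra.
rewrite ler_piMr ?sqr_ge0// ler_pdivrMr; lra.
Qed.

End Interval.

End L2Products.

Lemma le_subset_Rintegral (R : realType) (E F : set R) (f : R -> R) : measurable E -> measurable F ->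
  E `<=` F -> (@lebesgue_measure R).-integrable F (EFin \o f) -> (forall t, 0 <= f t) ->
  \int[@lebesgue_measure R]_(t in E) f t <= \int[@lebesgue_measure R]_(t in F) f t.
Proof.
move=> mE mF EF fi f0; rewrite /Rintegral; apply: fine_le.
- by apply: integrable_fin_num => //; apply: integrableS fi.
- exact: integrable_fin_num.
- apply: ge0_subset_integral => //; first by case/integrableP : fi.
  by move=> t _; rewrite lee_fin.
Qed.

(** * Functionals of a Bochner integral *)

Section BochnerFunctional.
Variables (R : realType) (k : scalars) (V : normedModType (scal R k)).
Notation mu := (@lebesgue_measure R).
Variables (l : V -> R) (C : R).
Hypothesis lD : forall x y, l (x + y) = l x + l y.
Hypothesis lZ : forall r x, l (scal_of k r *: x) = r * l x.
Hypothesis lC : forall x, `|l x| <= C * rnorm x.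

Let l0 : l 0 = 0.
Proof. by have := lZ 0 0; rewrite scaler0 mul0r. Qed.

Let lB x y : l (x - y) = l x - l y.
Proof. by rewrite lD -[- y]scaleN1r -scal_of1 -scal_ofN lZ mulN1r. Qed.

Let l_cts : continuous l.
Proof.
move=> x; apply/cvgrPdist_le => e e0.
have cv : C * rnorm (y - x) @[y --> x] --> C * 0.
  by apply: cvgMl_tmp; apply/cvg_rnormP; exact: cvg_id.
move/cvgrPdist_le : cv => /(_ _ e0); apply: filterS => y.
rewrite mulr0 sub0r normrN => /(le_trans (ler_norm _)) h.
by apply: le_trans h; rewrite distrC -lB; exact: lC.
Qed.

Variable T : R.
Notation D := [set` `]0, T[].

Let mD : measurable D. Proof. by []. Qed.

Lemma integral_step (r : seq V) (a : V -> R) (E : V -> set R) : (forall v, measurable (E v)) ->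
  mu.-integrable D (EFin \o (fun t => \sum_(v <- r) a v * \1_(E v) t)) /\
  \int[mu]_(t in D) (\sum_(v <- r) a v * \1_(E v) t) =
    \sum_(v <- r) a v * fine (mu (D `&` E v)).
Proof.
move=> mE; elim: r => [|v r [ir Ir]].
  have -> : (fun t => \sum_(v <- [::]) a v * \1_(E v) t) = fun=> 0.
    by apply/funext => t; rewrite big_nil.
  rewrite big_nil; split; first by apply: cts_integrable_oo => t; exact: cvg_cst.
  by rewrite Rintegral_cst// mul0r.
have i1 : mu.-integrable D (EFin \o (\1_(E v) : R -> R)).
  apply: (@le_integrable _ _ _ mu D _ _ (EFin \o (fun=> 1))) => //.
  - by apply/measurable_EFinP; apply: measurable_indic; exact: mE.
  - by move=> t _ /=; rewrite lee_fin normr1 ger0_norm ?indicE// lern1 leq_b1.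
  - by apply: cts_integrable_oo => t; exact: cvg_cst.
have iv : mu.-integrable D (EFin \o (fun t => a v * \1_(E v) t)).
  by have := integrableZl (mu := mu) mD (a v) i1; apply: eq_integrable => // t _ /=; rewrite EFinM.
split.
  have := integrableD (mu := mu) mD iv ir; apply: eq_integrable => // t _ /=.
  by rewrite big_cons EFinD.
under eq_Rintegral do rewrite big_cons.
rewrite RintegralD// Ir RintegralZl// big_cons; congr (_ * _ + _).
by rewrite /Rintegral integral_indic ?[E v `&` _]setIC//; exact: mE.
Qed.

Lemma integral_simple s : simple_fun s ->
  mu.-integrable D (EFin \o (fun t => l (s t))) /\
  \int[mu]_(t in D) l (s t) = l (simple_integral D s).
Proof.
move=> [fs ms]; pose r : seq V := finmap.enum_fset (fset_set (range s)).
have sE t : l (s t) = \sum_(v <- r) l v * \1_(s @^-1` [set v]) t.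
  have str : s t \in r by rewrite /r in_fset_set// inE; exists t.
  rewrite (bigD1_seq (s t) str (finmap.fset_uniq _)) /= big1 ?addr0.
    by rewrite indicE mem_set// mulr1.
  by move=> v vt; rewrite indicE memNset ?mulr0//= => /esym/eqP; rewrite (negbTE vt).
have [i1 i2] := integral_step r l ms.
have -> : (fun t => l (s t)) = fun t => \sum_(v <- r) l v * \1_(s @^-1` [set v]) t.
  by apply/funext => t.
split=> //.
rewrite i2 /simple_integral fsbig_finite// -/r.
elim: (r : seq V) => [|v q ih]; first by rewrite !big_nil l0.
by rewrite !big_cons lD lZ ih mulrC.
Qed.

(** A bounded functional commutes with the integral of simple functions, hence
    with its limit. *)
Lemma bochner_functional (f : R -> V) (v : V) : is_bochner_integral D f v ->
  mu.-integrable D (EFin \o (fun t => l (f t))) /\ \int[mu]_(t in D) l (f t) = l v.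
Proof.
move=> [s [ss sf si sv]].
have fm : strongly_measurable D f by exists s.
have md n : measurable_fun D (fun t => rnorm (f t - s n t)).
  apply: (@strong_comp_measurable _ _ _ (fun x t => rnorm (x - s n t))) => //.
    move=> c; apply: (@simple_comp_measurable _ _ _ (fun x _ => rnorm (c - x))) => //.
  by move=> t _; apply: cvg_rnorm; apply: cvgB; [exact: cvg_id | exact: cvg_cst].
have lm : measurable_fun D (fun t => l (f t)).
  by apply: (@strong_comp_measurable _ _ _ (fun x _ => l x)) => // t _; exact: l_cts.
move: si => /fine_cvgP[[N _ fin_n] si].
have idn n : (N <= n)%N -> mu.-integrable D (EFin \o (fun t => rnorm (f t - s n t))).
  move=> Nn; apply/integrableP; split; first by apply/measurable_EFinP; exact: md.
  under eq_integral do rewrite /= ger0_norm ?rnorm_ge0//.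
  rewrite -ge0_fin_numE; first exact: (fin_n n Nn).
  by apply: integral_ge0 => t _; rewrite lee_fin rnorm_ge0.
have isn n := (integral_simple (ss n)).1.
have il : mu.-integrable D (EFin \o (fun t => l (f t))).
  have iC : mu.-integrable D (EFin \o (fun t => `|C| * rnorm (f t - s N t) + `|l (s N t)|)).
    have i1 := integrableZl (mu := mu) mD `|C| (idn N (leqnn N)).
    have i2 := integrable_abse (isn N).
    by have := integrableD (mu := mu) mD i1 i2; apply: eq_integrable => // t _ /=; rewrite EFinD EFinM.
  apply: le_integrable iC => //; first exact/measurable_EFinP.
  move=> t _ /=; rewrite lee_fin [leRHS]ger0_norm; last by rewrite addr_ge0// mulr_ge0 ?rnorm_ge0.
  rewrite -[f t in leLHS](subrK (s N t)) lD; apply: le_trans (ler_normD _ _) _.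
  rewrite lerD2r; apply: le_trans (lC _) _.
  by rewrite ler_wpM2r ?rnorm_ge0// ler_norm.
split=> //.
apply: (@rcvg_unique _ _ \oo _ (fun n => l (simple_integral D (s n)))); last first.
  by apply: cvg_cts_comp; [exact: sv | exact: l_cts].
have sC : `|C| * fine (\int[mu]_(t in D) (rnorm (f t - s n t))%:E) @[n --> \oo] --> `|C| * 0.
  by apply: cvgMl_tmp; exact: si.
apply/cvgrPdist_le => e e0; move/cvgrPdist_le : sC => /(_ _ e0).
have NN : \forall n \near \oo, (N <= n)%N by exists N.
apply: filterS2 NN => n Nn; rewrite mulr0 sub0r normrN => /(le_trans (ler_norm _)).
apply: le_trans; have [_ <-] := integral_simple (ss n).
rewrite -RintegralB//; under eq_Rintegral do rewrite -lB.
have id1 : mu.-integrable D (EFin \o (fun t => l (f t - s n t))).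
  by have := integrableB (mu := mu) mD il (isn n); apply: eq_integrable => // t _ /=; rewrite lB.
apply: le_trans (le_normr_Rintegral _ _) _ => //.
rewrite -/(Rintegral mu D (fun t => rnorm (f t - s n t))) -RintegralZl//; last exact: idn.
apply: le_Rintegral => //.
- by have := integrable_abse id1.
- by have := integrableZl (mu := mu) mD `|C| (idn n Nn); apply: eq_integrable => // t _ /=; rewrite EFinM.
- by move=> t _; apply: le_trans (lC _) _; rewrite ler_wpM2r ?rnorm_ge0// ler_norm.
Qed.

End BochnerFunctional.

(** * Smooth plateaus *)

Section SmoothStep.
Variable R : realType.
Implicit Types (f g : R -> R) (x : R).

(** Repeated differentiability in a recursive form suited to inductions on [n]
    with [f] varying, which is how products and inverses are handled. *)
Fixpoint diffn (n : nat) f : Prop :=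
  if n is m.+1 then (forall x, derivable f x 1) /\ diffn m (derive1 f) else True.

Definition has_deriv f (f' : R -> R) : Prop := forall x, is_derive x 1 f (f' x).

Lemma diffn_intro n f f' : has_deriv f f' -> diffn n f' -> diffn n.+1 f.
Proof.
move=> df; have -> : f' = derive1 f by apply/funext => x; rewrite derive1E; case: (df x).
by move=> h; split=> // x; case: (df x).
Qed.

Lemma diffn_elim n f : diffn n.+1 f -> exists2 f', has_deriv f f' & diffn n f'.
Proof.
move=> [df h]; exists (derive1 f) => // x; apply: DeriveDef => //.
by rewrite derive1E.
Qed.

Lemma diffn_weak n f : diffn n.+1 f -> diffn n f.
Proof. by elim: n f => [//|n ih] f [df /ih h]; split. Qed.

Lemma diffn_derive1n f : (forall n, diffn n f) -> forall n x, derivable (derive1n n f) x 1.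
Proof.
move=> h n; elim: n f h => [|n ih] f h x; first by case: (h 1%N).
rewrite derive1Sn; apply: ih => m; by case: (h m.+1).
Qed.

Lemma diffnC n (c : R) : diffn n (fun=> c).
Proof. by elim: n c => [//|n ih] c; apply: (diffn_intro (f' := fun=> 0)) => //= x; exact: rderivC. Qed.

Lemma diffnD n f g : diffn n f -> diffn n g -> diffn n (fun x => f x + g x).
Proof.
elim: n f g => [//|n ih] f g /diffn_elim[f' df hf] /diffn_elim[g' dg hg].
by apply: (diffn_intro (f' := fun x => f' x + g' x)) => [x|]; [exact: rderivD | exact: ih].
Qed.

Lemma diffnM n f g : diffn n f -> diffn n g -> diffn n (fun x => f x * g x).
Proof.
elim: n f g => [//|n ih] f g hf hg.
have [f' df hf'] := diffn_elim hf; have [g' dg hg'] := diffn_elim hg.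
apply: (diffn_intro (f' := fun x => f' x * g x + f x * g' x)) => [x|]; first exact: rderivM.
by apply: diffnD; apply: ih => //; exact: diffn_weak.
Qed.

Lemma diffn_affine n f (c s : R) : diffn n f -> diffn n (fun x => f (c + s * x)).
Proof.
elim: n f => [//|n ih] f /diffn_elim[f' df hf].
apply: (diffn_intro (f' := fun x => s * f' (c + s * x))) => [x|]; first exact: rderiv_affine.
by apply: diffnM; [exact: diffnC | exact: ih].
Qed.

Lemma rderivV f x df : f x != 0 -> is_derive x 1 f df ->
  is_derive x 1 (fun t => (f t)^-1) (- df * ((f x)^-1 * (f x)^-1)).
Proof.
move=> fx hf; have := is_deriveV fx hf; move/is_derive_eq; apply.
by rewrite /GRing.scale /= expr2 invfM; ring.
Qed.

Lemma diffnV n f : (forall x, f x != 0) -> diffn n f -> diffn n (fun x => (f x)^-1).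
Proof.
move=> f0; elim: n => [//|n ih] hf; have [f' df hf'] := diffn_elim hf.
apply: (diffn_intro (f' := fun x => - f' x * ((f x)^-1 * (f x)^-1))) => [x|].
  exact: rderivV.
have hi := ih (diffn_weak hf); apply: diffnM; last exact: diffnM.
have -> : (fun x => - f' x) = (fun x => (- 1) * f' x) by apply/funext => x; rewrite mulN1r.
by apply: diffnM => //; exact: diffnC.
Qed.

Lemma rderivX m x : is_derive x 1 (fun t : R => t ^+ m) (m%:R * x ^+ m.-1).
Proof.
elim: m => [|m ih].
  have -> : (fun t : R => t ^+ 0) = fun=> 1 by apply/funext => t; rewrite expr0.
  by rewrite mul0r; exact: rderivC.
have E : (fun t : R => t ^+ m.+1) = fun t => t * t ^+ m by apply/funext => t; rewrite exprS.
rewrite E; have := rderivM (is_derive_id x (1 : R)) ih; move/is_derive_eq; apply.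
case: m {ih E} => [|m]; first by rewrite !expr0 mul0r mulr0 addr0 mul1r.
by rewrite /= exprS -[m.+2%:R]natr1; ring.
Qed.

(** The function [x ^- m * exp (- 1 / x)] extended by 0. The derivative of
    [flat m] is a combination of [flat m.+1] and [flat m.+2], so all are smooth
    at once. *)
Definition flat (m : nat) x : R := if 0 < x then x ^- m * expR (- x^-1) else 0.

Lemma flat_ge0 m x : 0 <= flat m x.
Proof.
rewrite /flat; case: ifP => // x0.
by rewrite mulr_ge0 ?expR_ge0// invr_ge0 exprn_ge0// ltW.
Qed.

Lemma flat_le0 m x : x <= 0 -> flat m x = 0.
Proof. by move=> x0; rewrite /flat ltNge x0. Qed.

Lemma flat_gt0 m x : 0 < x -> 0 < flat m x.
Proof. by move=> x0; rewrite /flat x0 mulr_gt0 ?expR_gt0// invr_gt0 exprn_gt0. Qed.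

(** A power of [y / n <= exp (y / n)], with [y] the inverse of [x]; it gives
    the derivative of [flat m] at 0. *)
Lemma flat_bound m x : 0 < x -> flat m.+1 x <= m.+2%:R ^+ m.+2 * x.
Proof.
move=> x0; rewrite /flat x0 expRN.
have : (x^-1 / m.+2%:R) ^+ m.+2 <= expR x^-1.
  have -> : expR x^-1 = expR (x^-1 / m.+2%:R) ^+ m.+2.
    by rewrite -expRM_natl mulrC divfK// pnatr_eq0.
  rewrite ler_pXn2r ?nnegrE ?expR_ge0 ?divr_ge0 ?invr_ge0 ?(ltW x0)//.
  by apply: le_trans _ (expR_ge1Dx _); rewrite lerDr ler01.
move=> h; rewrite ler_pdivrMr ?expR_gt0//.
have P0 : 0 <= m.+2%:R ^+ m.+2 * x :> R by rewrite mulr_ge0 ?exprn_ge0// ltW.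
apply: le_trans _ (ler_wpM2l P0 h).
rewrite exprMn !exprVn [x ^+ m.+2]exprS le_eqVlt; apply/orP; left; apply/eqP.
by field; rewrite !expf_neq0 ?pnatr_eq0 ?gt_eqF.
Qed.

Lemma flat_derive m x : is_derive x 1 (flat m) (flat m.+2 x - m%:R * flat m.+1 x).
Proof.
have [x0|x0|->] := ltgtP x 0.
- rewrite !flat_le0 ?(ltW x0)// mulr0 subrr.
  have d0 : is_derive x 1 (fun=> 0) (0 : R) by exact: rderivC.
  apply: near_eq_is_derive d0.
  near=> y; rewrite flat_le0//; near: y.
  have : \forall y \near x, y < 0 by apply: lt_nbhsl.
  by apply: filterS => y /ltW.
- have dE : is_derive x 1 (fun t => t ^- m * expR (- t^-1))
      (flat m.+2 x - m%:R * flat m.+1 x).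
    have xn0 : x != 0 by rewrite gt_eqF.
    have di := @rderivV id x 1 xn0 (is_derive_id x (1 : R)).
    have dp := rderivX m x.
    have dpi := @rderivV (fun t => t ^+ m) x _ (expf_neq0 m xn0) dp.
    have de := @is_derive1_comp _ expR (fun t => - t^-1) x _ _ (is_derive_expR (- x^-1)) (rderivN di).
    have := rderivM dpi de; move/is_derive_eq; apply.
    rewrite /flat x0 /GRing.scale /=.
    case: m {dp dpi} => [|m]; first by rewrite !expr0; field.
    by rewrite /= !exprS; field; rewrite expf_neq0.
  apply: near_eq_is_derive dE; near=> y; rewrite /flat ifT//; near: y.
  exact: lt_nbhsr.
- rewrite !flat_le0 ?lexx// mulr0 subrr; apply/is_deriveP.
  pose K : R := m.+2%:R ^+ m.+2.
  have K0 : 0 <= K by exact: exprn_ge0.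
  have cv : K * `|h| @[h --> (0 : R)^'] --> K * `|(0 : R)|.
    by apply: cvgMl_tmp; apply: cvg_norm; apply: full_dnbhs0; exact: cvg_id.
  apply/cvgrPdist_le => e e0; move/cvgrPdist_le : cv => /(_ _ e0); apply: filterS => h.
  rewrite normr0 mulr0 !sub0r !normrN => /(le_trans (ler_norm _)); apply: le_trans.
  rewrite add0r [flat m 0]flat_le0// subr0; have [h0|h0] := lerP h 0.
    by rewrite flat_le0// mulr0 normr0 mulr_ge0.
  rewrite (gtr0_norm h0); apply: le_trans _ (flat_bound m h0).
  rewrite ger0_norm ?mulr_ge0 ?flat_ge0 ?invr_ge0 ?(ltW h0)//.
  by rewrite /flat h0 exprS invfM -mulrA.
Unshelve. all: by end_near. Qed.

Lemma flat_smooth n m : diffn n (flat m).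
Proof.
elim: n m => [//|n ih] m.
apply: (diffn_intro (f' := fun x => flat m.+2 x + (- m%:R) * flat m.+1 x)) => [x|].
  by rewrite mulNr; exact: flat_derive.
by apply: diffnD => //; apply: diffnM => //; exact: diffnC.
Qed.

Definition step x : R := flat 0 x / (flat 0 x + flat 0 (1 - x)).

Let den x := flat 0 x + flat 0 (1 - x).

Let den_gt0 x : 0 < den x.
Proof.
have [x0|x0] := ltrP 0 x; first by rewrite ltr_pwDl ?flat_gt0 ?flat_ge0.
by rewrite ltr_wpDl ?flat_ge0// flat_gt0//; lra.
Qed.

Lemma step_le0 x : x <= 0 -> step x = 0.
Proof. by move=> x0; rewrite /step flat_le0// mul0r. Qed.

Lemma step_ge1 x : 1 <= x -> step x = 1.
Proof.
move=> x1; rewrite /step (@flat_le0 _ (1 - x)) ?subr_le0// addr0 divff// gt_eqF// flat_gt0//.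
exact: lt_le_trans x1.
Qed.

Lemma step_itv x : 0 <= step x <= 1.
Proof.
rewrite /step divr_ge0 ?flat_ge0 ?(ltW (den_gt0 x))//=.
by rewrite ler_pdivrMr ?den_gt0// mul1r lerDl flat_ge0.
Qed.

Lemma step_smooth n : diffn n step.
Proof.
apply: diffnM; first exact: flat_smooth.
apply: (@diffnV n den); first by move=> x; rewrite gt_eqF.
apply: diffnD; first exact: flat_smooth.
have -> : (fun x => flat 0 (1 - x)) = fun x => flat 0 (1 + (- 1) * x).
  by apply/funext => x; rewrite mulN1r.
by apply: diffn_affine; exact: flat_smooth.
Qed.

(** With [f = flat 0], the numerator of the derivative is [f' x * f (1 - x) + f
    x * f' (1 - x)], where [f' = flat 2] is nonnegative. *)
Lemma step_derive : exists2 f', has_deriv step f' & continuous f' /\ forall x, 0 <= f' x.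
Proof.
have [f' df /diffn_elim[f'' ddf _]] := diffn_elim (step_smooth 2).
exists f' => //; split; first by move=> x; exact: is_derive_cts (ddf x).
move=> x.
have d1 : is_derive x 1 (flat 0) (flat 2 x) by have := flat_derive 0 x; rewrite mul0r subr0.
have d2 : is_derive x 1 (fun x => flat 0 (1 - x)) (- flat 2 (1 - x)).
  have := @rderiv_affine _ (flat 0) 1 (- 1) x (flat 2 (1 + -1 * x)).
  have -> : (fun x => flat 0 (1 + -1 * x)) = fun x => flat 0 (1 - x).
    by apply/funext => y; rewrite mulN1r.
  rewrite !mulN1r; apply.
  by have := flat_derive 0 (1 - x); rewrite mul0r subr0.
have dd := rderivD d1 d2.
have dn0 : den x != 0 by rewrite gt_eqF.
have ds := rderivM d1 (rderivV dn0 dd).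
rewrite (is_derive_unique (df x) ds).
have -> : flat 2 x * (den x)^-1 + flat 0 x * (- (flat 2 x - flat 2 (1 - x)) * ((den x)^-1 * (den x)^-1)) =
   (flat 2 x * flat 0 (1 - x) + flat 0 x * flat 2 (1 - x)) / (den x) ^+ 2.
  by move: dn0; rewrite /den => dn0; field.
by rewrite divr_ge0 ?exprn_ge0 ?(ltW (den_gt0 x))// addr_ge0// mulr_ge0 ?flat_ge0.
Qed.

(** A difference of two steps, with slopes concentrated on [a, a + e] and [b, b
    + e]: it tends to the indicator function of ]a, b], and its derivative to
    the difference of the Dirac masses at [a] and [b]. *)
Definition plateau (a b e x : R) : R := step (e^-1 * (x - a)) - step (e^-1 * (x - b)).

Lemma plateau_test (T a b e : R) : 0 < e -> 0 < a -> a <= b -> b + e < T ->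
  test_function T (plateau a b e).
Proof.
move=> e0 a0 ab bT.
have sup x : plateau a b e x != 0 -> a <= x <= b + e.
  apply: contraR; rewrite negb_and -!ltNge => /orP[xa|xb]; rewrite /plateau.
    by rewrite !step_le0 ?subrr// pmulr_rle0 ?invr_gt0// subr_le0 ltW// (lt_le_trans xa).
  rewrite !step_ge1 ?subrr// mulrC ler_pdivlMr// mul1r lerBrDr.
    by rewrite addrC ltW.
  by rewrite addrC (le_trans _ (ltW xb))// lerD2r.
have cl : closure [set x | plateau a b e x != 0] `<=` `[a, (b + e)].
  have -> : `[a, (b + e)]%classic = closure `[a, (b + e)].
    by apply/closure_id; exact: interval_closed.
  by apply: closureS => x /= /sup; rewrite in_itv.
split.
- apply: diffn_derive1n => n.
  have -> : plateau a b e = fun x => step (- e^-1 * a + e^-1 * x) + (- 1) * step (- e^-1 * b + e^-1 * x).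
    apply/funext => x; rewrite /plateau mulN1r; congr (step _ - step _); ring.
  apply: diffnD; first by apply: diffn_affine; exact: step_smooth.
  apply: diffnM; first exact: diffnC.
  by apply: diffn_affine; exact: step_smooth.
- apply: (subclosed_compact _ (@segment_compact _ a (b + e))) => //.
  exact: closed_closure.
- apply: subset_trans cl _ => x /=; rewrite !in_itv/= => /andP[ax xb].
  by rewrite (lt_le_trans a0 ax) (le_lt_trans xb bT).
Qed.

End SmoothStep.

Section TestFunctions.
Variables (R : realType) (T : R) (theta : R -> R).
Hypothesis th : test_function T theta.

Lemma test_derive (x : R) : is_derive x 1 theta (derive1 theta x).
Proof.
have [/(_ 0%N x) d _ _] := th; rewrite derive1E; exact: derivableP.
Qed.

Lemma test_cts : continuous theta.
Proof. by move=> x; exact: is_derive_cts (test_derive x). Qed.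

Lemma test_derive_cts : continuous (derive1 theta).
Proof.
have [d _ _] := th; move=> x; have dx : derivable (derive1 theta) x 1 by exact: (d 1%N x).
by apply: (@is_derive_cts _ _ x ('D_1 (derive1 theta) x)); exact: derivableP.
Qed.

Lemma test_out (x : R) : ~~ (0 < x < T) -> theta x = 0.
Proof.
have [_ _ sub] := th; move=> nx; apply: contraNeq nx => tx.
by have /sub : closure [set x | theta x != 0] x by exact: subset_closure.
Qed.

End TestFunctions.

(** * Distributional primitives *)

Section DuBoisReymond.
Variable R : realType.
Notation mu := (@lebesgue_measure R).
Implicit Types (f g : R -> R) (a b e x T : R).

Section Average.
Variables (st : R -> R) (dst : has_deriv (@step R) st) (st_cts : continuous st)
  (st_ge0 : forall x, 0 <= st x).

Let st_out x : x < 0 \/ 1 < x -> st x = 0.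
Proof.
move=> x01; pose c : R := if x < 0 then 0 else 1.
have dc : is_derive x 1 (fun=> c) (0 : R) by exact: rderivC.
suff nh : \forall y \near x, c = step y.
  exact: is_derive_unique (dst x) (near_eq_is_derive nh dc).
case: x01 => x0.
  have : \forall y \near x, y < 0 by exact: lt_nbhsl.
  by apply: filterS => y y0; rewrite /c x0 step_le0// ltW.
have : \forall y \near x, 1 < y by exact: lt_nbhsr.
by apply: filterS => y y1; rewrite /c ltNge (le_trans ler01 (ltW x0))/= step_ge1// ltW.
Qed.

(** The derivative of the rescaled step: an approximate identity at [a]. *)
Definition rho a e x := e^-1 * st (e^-1 * (x - a)).

Lemma rho_derive a e x : is_derive x 1 (fun x => step (e^-1 * (x - a))) (rho a e x).
Proof.
have := @rderiv_affine _ (@step R) (- e^-1 * a) e^-1 x _ (dst _).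
have E y : - e^-1 * a + e^-1 * y = e^-1 * (y - a) by ring.
by rewrite E; under eq_fun do rewrite E.
Qed.

Lemma rho_cts a e : continuous (rho a e).
Proof.
move=> x; apply: cvgMl_tmp; apply: cvg_cts_comp; last exact: st_cts.
by apply: cvgMl_tmp; apply: cvgB; [exact: cvg_id | exact: cvg_cst].
Qed.

Lemma rho_ge0 a e x : 0 < e -> 0 <= rho a e x.
Proof. by move=> e0; rewrite mulr_ge0// invr_ge0 ltW. Qed.

Lemma rho_out a e x : 0 < e -> ~ (a <= x <= a + e) -> rho a e x = 0.
Proof.
move=> e0 /negP; rewrite negb_and -!ltNge => h; rewrite /rho st_out ?mulr0//.
case/orP: h => h; [left|right].
  by rewrite pmulr_rlt0 ?invr_gt0// subr_lt0.
by rewrite mulrC ltr_pdivlMr// mul1r ltrBrDr addrC.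
Qed.

Lemma rho_mass a e T : 0 < e -> 0 < a -> a + e < T -> itg (rho a e) 0 T = 1.
Proof.
move=> e0 a0 aT; rewrite (itgE 0 T (rho_derive a e)).
rewrite step_ge1; last by rewrite mulrC ler_pdivlMr// mul1r lerBrDr addrC ltW.
by rewrite step_le0 ?subr0// sub0r pmulr_rle0 ?invr_gt0// oppr_le0 ltW.
Qed.

Lemma rho_average f a e T (eta : R) : continuous f -> 0 < e -> 0 < a -> a + e < T ->
  (forall x, a <= x <= a + e -> `|f x - f a| <= eta) ->
  `|itg (fun x => rho a e x * f x) 0 T - f a| <= eta.
Proof.
move=> fc e0 a0 aT h.
have T0 : 0 <= T by lra.
have rc := @rho_cts a e.
have rfc : continuous (fun x => rho a e x * f x) by move=> x; apply: cvgM; [exact: rc | exact: fc].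
have cc (c : R) : continuous (fun x => c * rho a e x) by move=> x; apply: cvgMl_tmp; exact: rc.
have -> : itg (fun x => rho a e x * f x) 0 T - f a =
    itg (fun x => rho a e x * f x + (- f a) * rho a e x) 0 T.
  by rewrite itgD// itgZ// rho_mass// mulr1.
have bnd x : `|rho a e x * f x + - f a * rho a e x| <= eta * rho a e x.
  have -> : rho a e x * f x + - f a * rho a e x = rho a e x * (f x - f a) by ring.
  rewrite normrM ger0_norm ?rho_ge0//.
  have [/h hx|/rho_out ->//] := pselect (a <= x <= a + e); last by rewrite mul0r mulr0.
  by rewrite mulrC ler_wpM2r ?rho_ge0.
have bc : continuous (fun x => rho a e x * f x + - f a * rho a e x).
  by move=> x; apply: cvgD; [exact: rfc | exact: cc].
rewrite -[eta]mulr1 -(rho_mass e0 a0 aT) -itgZ// ler_norml; apply/andP; split.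
  rewrite -mulN1r -!itgZ//.
  apply: itg_le => //; first by move=> x; apply: cvgMl_tmp; exact: cc.
  by move=> x _; rewrite mulN1r lerNl; apply: le_trans (bnd x); rewrite -normrN ler_norm.
by apply: itg_le => // x _; apply: le_trans (bnd x); exact: ler_norm.
Qed.

Lemma rho_average_cvg f a T (e : nat -> R) : continuous f -> 0 < a ->
  (forall n, 0 < e n) -> (forall n, a + e n < T) -> e n @[n --> \oo] --> (0 : R) ->
  itg (fun x => rho a (e n) x * f x) 0 T @[n --> \oo] --> f a.
Proof.
move=> fc a0 e0 eT e_0; apply/cvgrPdist_le => eta eta0.
have /cvgrPdist_le/(_ _ eta0)/nbhs_ballP[d /= d0 hd] := fc a.
move/cvgrPdist_lt : e_0 => /(_ _ d0); apply: filterS => n.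
rewrite sub0r normrN gtr0_norm// => end_; rewrite distrC; apply: rho_average => //.
move=> x /andP[ax xa]; rewrite distrC; apply: hd; rewrite /ball /=.
by rewrite distrC ger0_norm ?subr_ge0// ltrBlDr addrC (le_lt_trans xa)// ltrD2l.
Qed.

End Average.

Lemma plateau_cvg a b x (e : nat -> R) : (forall n, 0 < e n) -> e n @[n --> \oo] --> (0 : R) ->
  a <= b ->
  plateau a b (e n) x @[n --> \oo] --> (if x \in `]a, b] then 1 else 0 : R).
Proof.
move=> e0 e_0 ab.
have st (c : R) : step ((e n)^-1 * (x - c)) @[n --> \oo] --> (if c < x then 1 else 0 : R).
  have [cx|xc] := ltrP c x.
    have d0 : 0 < x - c by rewrite subr_gt0.
    move/cvgrPdist_lt : e_0 => /(_ _ d0) h.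
    have h1 : \forall n \near \oo, (1 : R) = step ((e n)^-1 * (x - c)).
      apply: filterS h => n; rewrite sub0r normrN gtr0_norm// => ed.
      by rewrite step_ge1// mulrC ler_pdivlMr// mul1r ltW.
    exact: cvg_near_eq h1 (cvg_cst _).
  rewrite (_ : (fun n => _) = fun=> 0); first exact: cvg_cst.
  by apply/funext => n; rewrite step_le0// pmulr_rle0 ?invr_gt0// subr_le0.
have cv : plateau a b (e n) x @[n --> \oo] --> (if a < x then 1 else 0 : R) - (if b < x then 1 else 0 : R).
  by apply: cvgB; exact: st.
move: cv; rewrite in_itv /=.
have [ax|xa] := ltrP a x; have [bx|xb] := ltrP b x => /=.
- by rewrite subrr.
- by rewrite subr0.
- by have := le_lt_trans ab bx; rewrite ltNge xa.
- by rewrite subrr.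
Qed.

(** Testing with plateaus of vanishing slope width, the left side tends to [f b
    - f a], and the right side to the integral of [g] over ]a, b] by dominated
    convergence. *)
Lemma du_bois_reymond f g T : continuous f -> mu.-integrable `]0, T[ (EFin \o g) ->
  (forall theta, test_function T theta ->
     - (\int[mu]_(t in `]0, T[) (derive1 theta t * f t)) =
     \int[mu]_(t in `]0, T[) (theta t * g t)) ->
  forall a b, 0 < a -> a <= b -> b < T -> f b - f a = \int[mu]_(t in `]a, b]) g t.
Proof.
move=> fc gi h a b a0 ab bT.
have T0 : 0 <= T by lra.
have [st dst [st_cts st_ge0]] := step_derive R.
have mD : measurable [set` `]0, T[] by [].
have mg : measurable_fun [set` `]0, T[] g by apply/measurable_EFinP; case/integrableP : gi.
(* The factor keeps the slopes inside ]0, T[. *)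
pose e n : R := (T - b) / 2 * n.+1%:R^-1.
have Tb : 0 < (T - b) / 2 by rewrite divr_gt0// subr_gt0.
have e0 n : 0 < e n by rewrite mulr_gt0 ?invr_gt0.
have e_le n : e n <= (T - b) / 2 by rewrite ger_pMr// invf_le1// ler1n.
have e_0 : e n @[n --> \oo] --> (0 : R).
  suff : e n @[n --> \oo] --> (T - b) / 2 * 0 by rewrite mulr0.
  by apply: cvgMl_tmp; exact: cvg_harmonic.
have bT' n : b + e n < T by have := e_le n; lra.
have aT' n : a + e n < T by have := e_le n; lra.
pose th n := plateau a b (e n).
have dth n x : derive1 (th n) x = rho st a (e n) x - rho st b (e n) x.
  rewrite derive1E; have := rderivB (rho_derive dst a (e n) x) (rho_derive dst b (e n) x).
  by case.
have lhs : - (\int[mu]_(t in `]0, T[) (derive1 (th n) t * f t)) @[n --> \oo] --> - (f a - f b).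
  apply: cvgN.
  rewrite (_ : (fun n => _) = fun n => itg (fun x => rho st a (e n) x * f x) 0 T -
      itg (fun x => rho st b (e n) x * f x) 0 T).
    apply: cvgB; apply: rho_average_cvg => //; exact: lt_le_trans ab.
  apply/funext => n.
  have rfc c : continuous (fun x => rho st c (e n) x * f x).
    by move=> x; apply: cvgM; [exact: rho_cts | exact: fc].
  rewrite -mulN1r -itgZ// -itgD//; last by move=> x; apply: cvgMl_tmp; exact: rfc.
  rewrite /Rintegral -[RHS]/(fine (itg _ 0 T)%:E) -integral_itg_oo//; last first.
    by move=> x; apply: cvgD; [exact: rfc|apply: cvgMl_tmp; exact: rfc].
  by congr fine; apply: eq_integral => x _; rewrite dth; congr EFin; ring.
have thc n : continuous (th n).
  move=> x; exact: is_derive_cts (rderivB (rho_derive dst a (e n) x) (rho_derive dst b (e n) x)).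
have rhs : \int[mu]_(t in `]0, T[) (th n t * g t) @[n --> \oo] -->
    \int[mu]_(t in `]0, T[) ((g \_ `]a, b]) t).
  have gr : mu.-integrable [set` `]0, T[] (fun t => (2 * `|g t|)%:E).
    have := integrableZl (mu := mu) mD 2 (integrable_abse gi).
    by apply: eq_integrable => // t _ /=; rewrite EFinM.
  have [|||||int_r _ cv] := @dominated_convergence _ _ R mu _ mD (fun n t => (th n t * g t)%:E)
     (fun t => ((g \_ `]a, b]) t)%:E) (fun t => (2 * `|g t|)%:E).
  - by move=> n; apply/measurable_EFinP; apply: measurable_funM => //; exact: cts_measurable.
  - apply/measurable_EFinP; apply/measurable_restrict => //.
    by apply: measurable_funS mg => // t [].
  - apply: aeW => t _; apply: cvg_EFin; first exact: nearW.
    have cv : th n t * g t @[n --> \oo] --> (if t \in `]a, b] then 1 else 0 : R) * g t.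
      by apply: cvgMr_tmp; exact: plateau_cvg.
    move: cv; rewrite patchE mem_setE; case: ifP => _; rewrite ?mul1r ?mul0r//.
  - exact: gr.
  - apply: aeW => t n _ /=; rewrite lee_fin normrM ler_wpM2r//.
    have /andP[p1 p2] := step_itv ((e n)^-1 * (t - a)).
    have /andP[p3 p4] := step_itv ((e n)^-1 * (t - b)).
    by rewrite /th /plateau ler_norml; apply/andP; split; lra.
  apply: fine_cvg; rewrite fineK//; exact: integrable_fin_num.
have : f b - f a = \int[mu]_(t in `]0, T[) ((g \_ `]a, b]) t).
  rewrite -opprB; apply: rcvg_unique lhs _.
  rewrite (_ : (fun n => _) = fun n => \int[mu]_(t in `]0, T[) (th n t * g t)); first exact: rhs.
  by apply/funext => n; rewrite h//; exact: plateau_test.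
move=> ->; rewrite -Rintegral_mkcondr; congr (Rintegral _ _ _).
apply/setIidr => t /=; rewrite !in_itv /= => /andP[ta tb].
by rewrite (lt_trans a0 ta) (le_lt_trans tb bT).
Qed.

End DuBoisReymond.

(** * The group and its adjoint *)

Section ControlSystem.
Variables (R : realType) (k : scalars) (H U : hilbertType R k).
Variables (S : R -> {linear H -> H}) (S_group : c0_group S).
Local Notation "r *r x" := (scal_of k r *: x) (at level 40).
Notation mu := (@lebesgue_measure R).

Section Group.
Implicit Types (x y : H) (s t : R).

Lemma group_cont t : continuous (S t). Proof. by case: S_group => + _ _ _; apply. Qed.
Lemma group0 x : S 0 x = x. Proof. by case: S_group => _ + _ _; apply. Qed.
Lemma groupD s t x : S (s + t) x = S s (S t x). Proof. by case: S_group => _ _ + _; apply. Qed.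
Lemma groupNK t x : S (- t) (S t x) = x. Proof. by rewrite -groupD addNr group0. Qed.

Lemma group_cvg0 x : S t x @[t --> 0] --> x.
Proof.
by apply: dnbhs0_full; [case: S_group => _ _ _; exact | exact: group0].
Qed.

Lemma group_cvg x t : S s x @[s --> t] --> S t x.
Proof.
apply: cvg_unshift0.
under eq_fun do rewrite groupD.
by apply: (@cvg_comp _ _ _ (fun h => S h x) (S t) _ (nbhs x)); [exact: group_cvg0 | exact: group_cont].
Qed.

Definition gadj t : H -> H := opadj (S t).

Lemma dotp_gadj t x y : dotp (S t x) y = dotp x (gadj t y).
Proof. exact/dotp_opadj/group_cont. Qed.

Lemma rdot_gadj t x y : rdot (S t x) y = rdot x (gadj t y).
Proof. exact/rdot_opadj/group_cont. Qed.

Lemma gadj_linear t : linear (gadj t).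
Proof. exact/opadj_linear/group_cont. Qed.

Lemma gadj0 x : gadj 0 x = x.
Proof. by apply: dotp_injr => z; rewrite -dotp_gadj group0. Qed.

Lemma gadjD s t x : gadj (s + t) x = gadj s (gadj t x).
Proof. by apply: dotp_injr => z; rewrite -!dotp_gadj addrC groupD. Qed.

Lemma gadjK t x : gadj t (gadj (- t) x) = x.
Proof. by rewrite -gadjD addrN gadj0. Qed.

(** Otherwise [S (t n)] would be unbounded along some sequence [t n] tending to
    0, whereas [S (t n) z] converges for every [z]. The uniform boundedness
    principle is applied to the images of the unit ball under the adjoints. *)
Lemma group_near_bound : exists2 d : R, 0 < d & exists2 M : R, 1 <= M &
  forall t, `|t| <= d -> forall x, rnorm (S t x) <= M * rnorm x.
Proof.
apply: contrapT => nb.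
have /choice[f hf] n : exists p : R * H, `|p.1| <= n.+1%:R^-1 /\
    n.+1%:R * rnorm p.2 < rnorm (S p.1 p.2).
  apply: contrapT => h; apply: nb; exists (n.+1%:R^-1); first by rewrite invr_gt0.
  exists n.+1%:R; first by rewrite ler1n.
  move=> t tn x; rewrite leNgt; apply/negP => lt_x; apply: h; exists (t, x) => //.
pose t n := (f n).1; pose x n := (f n).2.
have t0 : t n @[n --> \oo] --> (0 : R).
  apply/cvgrPdist_le => e e0.
  have := @near_infty_natSinv_lt R (PosNum e0); apply: filterS => n /ltW/= ne.
  by rewrite sub0r normrN; apply: le_trans ne; exact: (hf n).1.
pose E : set H := [set z | exists n y, rnorm y <= 1 /\ z = gadj (t n) y].
have [|C hC] := @weakly_bounded _ _ _ E.
  move=> z.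
  have cz : rnorm (S (t n) z) @[n --> \oo] --> rnorm z.
    apply: cvg_rnorm; apply: (@cvg_comp _ _ _ t (fun s => S s z) _ (nbhs 0)) => //.
    exact: group_cvg0.
  have [M hM] : exists M, forall n, rnorm (S (t n) z) <= M.
    have : cvgn (fun n => rnorm (S (t n) z)) by apply/cvg_ex; exists (rnorm z).
    move=> /cvg_seq_bounded/pinfty_ex_gt0[M M0 /= hM].
    by exists M => n; apply: le_trans (ler_norm _) (hM n Logic.I).
  exists M => _ [n [y [y1 ->]]]; rewrite -rdot_gadj.
  apply: le_trans (rdot_norm _ _) _; apply: le_trans (hM n).
  by rewrite ler_piMr// rnorm_ge0.
have [n hn] : exists n, C < n.+1%:R.
  exists (Num.bound `|C|); apply: le_lt_trans (ler_norm _) _.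
  by apply: lt_trans (archi_boundP (normr_ge0 C)) _; rewrite ltr_nat.
have C0 : 0 <= C.
  apply: le_trans (hC 0 _); first exact: rnorm_ge0.
  by exists 0%N, 0; rewrite rnorm0 ler01 (lin_0 (gadj_linear _)).
have : rnorm (S (t n) (x n)) <= C * rnorm (x n).
  apply: rnorm_rdot_le; first by rewrite mulr_ge0 ?rnorm_ge0.
  move=> z; rewrite rdotC rdot_gadj.
  have [rz0|z0] := eqVneq (rnorm z) 0.
    by rewrite (rnorm0_eq0 rz0) (lin_0 (gadj_linear _)) rdot0r rnorm0 mulr0.
  have zp : 0 < rnorm z by rewrite lt_neqAle eq_sym z0 rnorm_ge0.
  have -> : gadj (t n) z = rnorm z *r gadj (t n) ((rnorm z)^-1 *r z).
    by rewrite (lin_scale (gadj_linear _)) scalerA -scal_ofM divff// scal_of1 scale1r.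
  rewrite rdotrZr mulrC ler_wpM2r ?rnorm_ge0//.
  apply: le_trans (rdot_le _ _) _; rewrite mulrC ler_wpM2r ?rnorm_ge0//.
  apply: hC; exists n, ((rnorm z)^-1 *r z); split=> //.
  by rewrite rnormrZ ger0_norm ?invr_ge0 ?rnorm_ge0// mulVf.
move=> /(lt_le_trans (hf n).2); have := rnorm_ge0 (x n).
rewrite le_eqVlt => /predU1P[<-|x0]; first by rewrite !mulr0 ltxx.
by rewrite ltr_pM2r// => /(lt_trans hn); rewrite ltxx.
Qed.

(** The time is cut into steps of length at most [d]. *)
Lemma group_bound : exists2 M : R, 1 <= M & exists2 a : R, 0 <= a &
  forall t x, rnorm (S t x) <= M * expR (a * `|t|) * rnorm x.
Proof.
have [d d0 [M M1 hM]] := group_near_bound.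
have M0 : 0 < M by exact: lt_le_trans M1.
exists M => //; exists (ln M / d); first by rewrite divr_ge0 ?ln_ge0// ltW.
move=> t x; pose n := Num.truncn (`|t| / d).
have td0 : 0 <= `|t| / d by rewrite divr_ge0// ltW.
have /andP[n1 n2] : n%:R <= `|t| / d < n.+1%:R by exact: truncn_itv.
pose s := t / n.+1%:R.
have sd : `|s| <= d.
  rewrite /s normrM normfV (ger0_norm (ler0n _ _)) ler_pdivrMr ?ltr0n// mulrC.
  by rewrite -ler_pdivrMr// ltW.
have Sm m : rnorm (S (m%:R * s) x) <= M ^+ m * rnorm x.
  elim: m => [|m ih]; first by rewrite mul0r group0 expr0 mul1r.
  rewrite -natr1 mulrDl mul1r addrC groupD exprS -mulrA.
  by apply: le_trans (hM _ sd _) _; rewrite ler_wpM2l// ltW.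
have -> : t = n.+1%:R * s by rewrite /s mulrC divfK// pnatr_eq0.
apply: le_trans (Sm _) _; rewrite ler_wpM2r ?rnorm_ge0// exprS ler_wpM2l ?(ltW M0)//.
have -> : n.+1%:R * s = t by rewrite /s mulrC divfK// pnatr_eq0.
rewrite -[X in X ^+ _]lnK ?posrE// -expRM_natl ler_expR mulrC -mulrA ler_wpM2l ?ln_ge0//.
by rewrite mulrC.
Qed.

Lemma gadj_bound (M a : R) : 0 <= M ->
  (forall t x, rnorm (S t x) <= M * expR (a * `|t|) * rnorm x) ->
  forall t x, rnorm (gadj t x) <= M * expR (a * `|t|) * rnorm x.
Proof.
move=> M0 h t; apply: opadj_bound (h t); first exact: group_cont.
by rewrite mulr_ge0// expR_ge0.
Qed.

Lemma gadj_loc_bound (T : R) : exists2 M : R, 0 <= M &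
  forall t, `|t| <= T -> forall x, rnorm (gadj t x) <= M * rnorm x.
Proof.
have [M M1 [a a0 hM]] := group_bound.
have M0 : 0 <= M by rewrite (le_trans _ M1).
exists (M * expR (a * T)); first by rewrite mulr_ge0 ?expR_ge0.
move=> t tT x; apply: le_trans (gadj_bound M0 hM t x) _.
by rewrite ler_wpM2r ?rnorm_ge0// ler_wpM2l// ler_expR ler_wpM2l.
Qed.

Lemma gadj_continuous t : exists C : R, forall x, rnorm (gadj t x) <= C * rnorm x.
Proof. by have [M _ h] := gadj_loc_bound `|t|; exists M; exact: h. Qed.

End Group.

(** * The generator and its adjoint *)

Variables (A : operator H) (A_gen : is_generator S A).
Local Notation As := (adjoint A).
Local Notation D := (dom As).

Section Generator.
Implicit Types (x y phi psi : H) (s t : R).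

Let rate x t : H := t^-1 *r (S t x - x).

Lemma gen_rate x : dom A x -> rate x t @[t --> 0^'] --> A x.
Proof. by case: A_gen => _; apply. Qed.

Lemma gen_dom x y : rate x t @[t --> 0^'] --> y -> dom A x /\ A x = y.
Proof.
move=> xy; have Ax : dom A x by apply/(A_gen.1 x); exists y.
by split=> //; exact: vcvg_unique (gen_rate Ax) xy.
Qed.

Lemma gen_group t x : dom A x -> dom A (S t x) /\ A (S t x) = S t (A x).
Proof.
move=> Ax; apply: gen_dom.
have -> : rate (S t x) = fun h => S t (rate x h).
  apply/funext => h; rewrite /rate linearZ_LR (linearB (S t)) -!groupD (addrC h) //.
by apply: cvg_cts_comp; [exact: gen_rate | exact: group_cont].
Qed.

Lemma group_vderiv t x : dom A x -> vderiv (fun s => S s x) t (S t (A x)).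
Proof.
move=> Ax; have -> : S t (A x) = A (S t x) by case: (gen_group t Ax).
have [AS _] := gen_group t Ax; have := gen_rate AS; rewrite /vderiv /rate.
by under eq_fun do rewrite -groupD (addrC _ t).
Qed.

Lemma gen_subspace : rsubspace (dom A).
Proof.
split.
- apply: (gen_dom (y := 0) _).1; rewrite /rate.
  by under eq_fun do rewrite linear0 subrr scaler0; exact: cvg_cst.
- move=> x y Ax Ay; apply: (gen_dom (y := A x + A y) _).1.
  have -> : rate (x + y) = fun t => rate x t + rate y t.
    by apply/funext => t; rewrite /rate -scalerDr (linearD (S t)) opprD addrACA.
  by apply: cvgD; exact: gen_rate.
- move=> r x Ax; apply: (gen_dom (y := r *r A x) _).1.
  have -> : rate (r *r x) = fun t => r *r rate x t.
    by apply/funext => t; rewrite /rate linearZ_LR -scalerBr !scalerA mulrC.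
  by apply: cvgZ => //; [exact: cvg_cst | exact: gen_rate].
Qed.

Lemma orbit_cts x phi : continuous (fun s => rdot (S s x) phi).
Proof. by move=> t; apply: cvg_rdot; [exact: group_cvg | exact: cvg_cst]. Qed.

Lemma average_bound (T : R) : 0 <= T -> exists2 C : R, 0 <= C &
  forall x phi, `|itg (fun s => rdot (S s x) phi) 0 T| <= C * rnorm x * rnorm phi.
Proof.
move=> T0; have [M M0 hM] := gadj_loc_bound T.
have cz x phi : continuous (fun s => rdot (S s x) phi) by exact: orbit_cts.
exists (M * T); first by rewrite mulr_ge0.
move=> x phi; rewrite /itg.
have := @mvt_bound R (prim (fun s => rdot (S s x) phi)) _ 0 T (M * rnorm x * rnorm phi)
    T0 (fun s => is_derive_prim s (cz x phi)).
rewrite subr0 => h; have -> : M * T * rnorm x * rnorm phi = M * rnorm x * rnorm phi * T by ring.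
apply: h => s /andP[s0 sT]; rewrite -mulrA.
rewrite rdot_gadj//; apply: le_trans (rdot_norm _ _) _; rewrite mulrCA ler_wpM2l ?rnorm_ge0// hM//.
by rewrite ger0_norm.
Qed.

(** The time average of an orbit, as the vector that represents the average of
    the scalar products. *)
Lemma orbit_average x (T : R) : 0 <= T ->
  exists z, forall phi, rdot z phi = itg (fun s => rdot (S s x) phi) 0 T.
Proof.
move=> T0; have [C C0 hC] := average_bound T0.
have cz phi : continuous (fun s => rdot (S s x) phi) by exact: orbit_cts.
have [|||||z [_ hz]] := @riesz_on _ _ _ setT (fun phi => itg (fun s => rdot (S s x) phi) 0 T)
   (C * rnorm x).
- by split.
- by rewrite !mulr_ge0 ?rnorm_ge0.
- move=> u v _ _; rewrite -itgD//; congr itg; apply/funext => s; exact: rdotDr.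
- by move=> r u _; rewrite -itgZ//; congr itg; apply/funext => s; exact: rdotrZr.
- by move=> phi _; exact: hC.
by exists z => phi; rewrite rdotC -hz.
Qed.

Lemma orbit_average_adj phi (T : R) : 0 <= T ->
  exists z, forall x, rdot x z = itg (fun s => rdot (S s x) phi) 0 T.
Proof.
move=> T0; have [C C0 hC] := average_bound T0.
have cz x : continuous (fun s => rdot (S s x) phi) by exact: orbit_cts.
have [|||||z [_ hz]] := @riesz_on _ _ _ setT (fun x => itg (fun s => rdot (S s x) phi) 0 T)
   (C * rnorm phi).
- by split.
- by rewrite !mulr_ge0 ?rnorm_ge0.
- move=> u v _ _; rewrite -itgD//; congr itg; apply/funext => s.
  by rewrite linearD rdotDl.
- move=> r u _; rewrite -itgZ//; congr itg; apply/funext => s.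
  by rewrite linearZ_LR rdotrZl.
- by move=> x _; rewrite mulrAC; exact: hC.
by exists z => x; rewrite -hz.
Qed.

(** The difference quotient of the average only involves the orbit near 0 and
    near [T], and it tends to [S T x - x]. *)
Lemma average_gen x z (T : R) : 0 <= T ->
  (forall phi, rdot z phi = itg (fun s => rdot (S s x) phi) 0 T) -> dom A z.
Proof.
move=> T0 hz; apply: (gen_dom (y := S T x - x) _).1.
pose w t := rnorm (S (T + t) x - S T x) + rnorm (S t x - x).
have wc : w t @[t --> 0] --> (0 : R).
  suff : w t @[t --> 0] --> 0 + (0 : R) by rewrite addr0.
  apply: cvgD; apply/cvg_rnormP; last exact: group_cvg0.
  by apply: (@cvg_shift0 R H (fun s => S s x)); exact: group_cvg.
apply/cvg_rnormP/cvgrPdist_le => e e0.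
have [d d0 hd] : exists2 d : R, 0 < d & forall t, `|t| <= d -> w t <= e.
  move/cvgrPdist_le : wc => /(_ _ e0)/nbhs_ballP[d /= d0 hd].
  exists (d / 2); first by rewrite divr_gt0.
  move=> t td; apply: le_trans (ler_norm _) _; rewrite -normrN -sub0r; apply: hd.
  by rewrite /ball /= sub0r normrN (le_lt_trans td)// ltr_pdivrMr// ltr_pMr// ltr1n.
have : \forall t \near (0 : R), t != 0 -> `|0 - rnorm (rate z t - (S T x - x))| <= e; last by [].
near=> t => t0; rewrite sub0r normrN ger0_norm ?rnorm_ge0//.
have td : `|t| <= d by near: t; exact: (@nbhs0_le R R d d0).
apply: rnorm_rdot_le; first exact: ltW.
move=> phi; pose g s := rdot (S s x) phi; have gc : continuous g by exact: orbit_cts.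
pose P := prim g; have dP s := is_derive_prim s gc.
have dS : itg (fun s => rdot (S s x) (gadj t phi)) 0 T = P (T + t) - P t.
  rewrite (_ : (fun s => _) = fun s => g (t + 1 * s)); last first.
    by apply/funext => s; rewrite mul1r -rdot_gadj// -groupD.
  by rewrite -[LHS]mul1r itg_affine// mulr0 mul1r addr0 addrC.
pose F s := P (T + 1 * s) - P s - (g T - g 0) * s.
have dF s : is_derive s 1 F (g (T + s) - g s - (g T - g 0)).
  have := rderivB (rderivB (rderiv_affine (c := T) (s := 1) (dP (T + 1 * s))) (dP s))
    (rderivM (rderivC (g T - g 0) s) (is_derive_id s (1 : R))).
  by rewrite !mul1r mul0r add0r mulr1.
have -> : rdot phi (rate z t - (S T x - x)) = t^-1 * (F t - F 0).
  rewrite rdotC rdotBl rdotrZl rdotBl rdot_gadj// !hz dS /itg -/P /F !mul1r.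
  by rewrite rdotBl -/(g T) -[X in rdot X phi]group0 -/(g 0) addr0; field.
apply: le_trans (ler_norm _) _; rewrite normrM normfV mulrC ler_pdivrMr ?normr_gt0//.
apply: le_trans (mvt_bound0 dF _) (lexx _) => s st.
apply: le_trans (_ : rnorm phi * w s <= _); last first.
  by rewrite mulrC ler_wpM2r ?rnorm_ge0// hd// (le_trans st).
have -> : g (T + s) - g s - (g T - g 0) =
    rdot (S (T + s) x - S T x) phi - rdot (S s x - x) phi.
  by rewrite !rdotBl /g group0; ring.
apply: le_trans (ler_normB _ _) _; rewrite /w mulrDr !(mulrC (rnorm phi)).
by apply: lerD; exact: rdot_norm.
Unshelve. all: by end_near. Qed.

(** A vector orthogonal to the domain is orthogonal to all the averages of an
    orbit, hence to the orbit itself. *)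
Lemma gen_dense : dense_in (dom A).
Proof.
apply: (perp_dense gen_subspace) => y hy.
apply: rdot_inj => x; rewrite rdot0l rdotC.
have -> : rdot x y = rdot (S 1 (S (- 1) x)) y by rewrite -groupD subrr group0.
apply: (@itg_eq0 _ (fun s => rdot (S s (S (- 1) x)) y)); first exact: orbit_cts.
move=> T T0; have [z hz] := orbit_average (S (- 1) x) T0.
by rewrite -hz hy//; exact: average_gen hz.
Qed.

End Generator.

Section AdjointGenerator.
Implicit Types (x y phi psi : H) (s t : R).

Let denseA := gen_dense.

Lemma gen_scale (a : scal R k) x : dom A x -> dom A (a *: x) /\ A (a *: x) = a *: A x.
Proof.
move=> Ax; apply: gen_dom.
have -> : (fun t => t^-1 *r (S t (a *: x) - a *: x)) = fun t => a *: (t^-1 *r (S t x - x)).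
  by apply/funext => t; rewrite linearZ_LR -scalerBr !scalerA mulrC.
by apply: cvgZ => //; [exact: cvg_cst | exact: gen_rate].
Qed.

(** The domain of [A] is stable under all scalars, so real parts are enough. *)
Lemma adjoint_at_re phi psi :
  (forall x, dom A x -> rdot (A x) phi = rdot x psi) -> adjoint_at A phi psi.
Proof.
move=> h x Ax; apply: rdot_ext => a; have [Aax <-] := gen_scale a Ax.
exact: h.
Qed.

Lemma adjointP phi : D phi -> adjoint_at A phi (As phi).
Proof. by move=> [psi hpsi] /=; case: xgetP => [|/(_ psi)]. Qed.

Lemma rdot_adjoint x phi : dom A x -> D phi -> rdot (A x) phi = rdot x (As phi).
Proof. by move=> Ax /adjointP h; rewrite /rdot h. Qed.

Lemma adjoint_eq phi psi : adjoint_at A phi psi -> D phi /\ As phi = psi.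
Proof.
move=> h; have Dphi : D phi by exists psi.
split=> //; apply: dense_ext denseA _ => x Ax.
by rewrite -rdot_adjoint// /rdot h.
Qed.

Lemma adjoint_lin (a : scal R k) phi psi : D phi -> D psi ->
  D (a *: phi + psi) /\ As (a *: phi + psi) = a *: As phi + As psi.
Proof.
move=> Dphi Dpsi; apply: adjoint_eq => x Ax.
by rewrite !dotp_antilinear (adjointP Dphi)// (adjointP Dpsi).
Qed.

Lemma adjoint_0 : D 0 /\ As 0 = 0.
Proof. by apply: adjoint_eq => x _; rewrite !dotp0r. Qed.

Lemma adjoint_domD phi psi : D phi -> D psi -> D (phi + psi).
Proof. by move=> Dphi Dpsi; rewrite -[phi]scale1r; apply: (adjoint_lin _ _ _).1. Qed.

Lemma adjoint_domZ (a : scal R k) phi : D phi -> D (a *: phi).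
Proof.
by move=> Dphi; rewrite -[a *: phi]addr0; apply: (adjoint_lin _ _ _).1 => //; exact: adjoint_0.1.
Qed.

Lemma adjoint_rsubspace : rsubspace D.
Proof.
split; first exact: adjoint_0.1.
- by move=> x y; exact: adjoint_domD.
- by move=> r x; exact: adjoint_domZ.
Qed.

Lemma gadj_adjoint t phi : D phi -> D (gadj t phi) /\ As (gadj t phi) = gadj t (As phi).
Proof.
move=> Dphi; apply: adjoint_eq => x Ax; have [ASx ASE] := gen_group t Ax.
by rewrite -!dotp_gadj// -ASE (adjointP Dphi).
Qed.

Lemma gadj_dom t phi : D phi -> D (gadj t phi).
Proof. by move=> Dphi; exact: (gadj_adjoint t Dphi).1. Qed.

Lemma orbit_derive x phi t : dom A x -> D phi ->
  is_derive t 1 (fun s => rdot (S s x) phi) (rdot (S t x) (As phi)).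
Proof.
move=> Ax Dphi; have [ASx ASE] := gen_group t Ax.
have := vderiv_rdot (group_vderiv (t := t) Ax) (@vderiv_cst _ _ _ phi t).
by rewrite rdot0r addr0 -ASE rdot_adjoint.
Qed.

(** As for [gen_dense], with averages of the adjoint orbits; these averages are
    only defined weakly, and membership in the domain of the adjoint is checked
    by integrating the derivative of [rdot (S s u) phi]. *)
Lemma adjoint_dense : dense_in D.
Proof.
apply: (perp_dense adjoint_rsubspace) => y hy.
apply: rdot_inj => x; rewrite rdot0l.
have -> : rdot y x = rdot (S 1 y) (gadj (- 1) x) by rewrite -rdot_gadj// groupNK.
apply: (@itg_eq0 _ (fun s => rdot (S s y) (gadj (- 1) x))); first exact: orbit_cts.
move=> T T0; set phi := gadj _ x.
have [z hz] := orbit_average_adj phi T0; rewrite -hz rdotC; apply: hy.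
apply: (adjoint_eq (psi := gadj T phi - phi) _).1; apply: adjoint_at_re => u Au.
rewrite hz rdotBr -rdot_gadj//.
have dS s : is_derive s 1 (fun s => rdot (S s u) phi) (rdot (S s (A u)) phi).
  have := vderiv_rdot (group_vderiv (t := s) Au) (@vderiv_cst _ _ _ phi s).
  by rewrite rdot0r addr0.
by rewrite (itgE 0 T dS) group0.
Qed.

(** The strong continuity of the adjoint group will follow from this estimate,
    so the mean value theorem is applied to scalar products with the domain of
    [A], whose orbits are differentiable. *)
Lemma gadj_mvt phi t (z : H) (M : R) : 0 <= M -> D phi ->
  (forall s, `|s| <= `|t| -> rnorm (gadj s (As phi) - z) <= M) ->
  rnorm (gadj t phi - phi - t *r z) <= M * `|t|.
Proof.
move=> M0 Dphi hM; apply: (dense_rnorm_le _ denseA); first by rewrite mulr_ge0.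
move=> x Ax; pose F s := rdot (S s x) phi - rdot x z * s.
have dF s : is_derive s 1 F (rdot x (gadj s (As phi) - z)).
  have := rderivB (orbit_derive s Ax Dphi)
    (rderivM (rderivC (rdot x z) s) (is_derive_id s (1 : R))).
  by rewrite mul0r add0r mulr1 rdotBr -rdot_gadj.
have -> : rdot x (gadj t phi - phi - t *r z) = F t - F 0.
  by rewrite /F !rdotBr rdotrZr -rdot_gadj// group0; ring.
apply: le_trans (ler_norm _) _; rewrite mulrAC; apply: mvt_bound0 dF _ => s st.
by apply: le_trans (rdot_norm _ _) _; rewrite mulrC ler_wpM2r ?rnorm_ge0// hM.
Qed.

(** On the domain of the adjoint this is the mean value inequality; elsewhere
    it follows by density, since the adjoints are uniformly bounded for small
    times. *)
Lemma gadj_cvg0 x : gadj t x @[t --> 0] --> x.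
Proof.
have [M M0 hM] := gadj_loc_bound 1.
have near1 : \forall t \near (0 : R), `|t| <= 1 by exact: (@nbhs0_le R R 1 ltr01).
have cD phi : D phi -> gadj t phi @[t --> 0] --> phi.
  move=> Dphi; apply: (cvg_rnorm_le (g := fun t => M * rnorm (As phi) * `|t|)).
    apply: filterS near1 => t t1.
    have := @gadj_mvt phi t 0 (M * rnorm (As phi)); rewrite scaler0 subr0; apply=> //.
      by rewrite mulr_ge0 ?rnorm_ge0.
    by move=> s st; rewrite subr0; apply: hM; exact: le_trans t1.
  have cv : M * rnorm (As phi) * `|t| @[t --> (0 : R)] --> M * rnorm (As phi) * `|(0 : R)|.
    by apply: cvgMl_tmp; apply: cvg_norm; exact: cvg_id.
  by move: cv; rewrite normr0 mulr0.
apply/cvg_rnormP/cvgrPdist_lt => e e0.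
have [u Du ux] := adjoint_dense x.
have Mp : 0 < M + 2 by lra.
have e1 : 0 < e / (M + 2) by rewrite divr_gt0.
move/cvg_rnormP/cvgrPdist_lt : ux => /(_ _ e1)[N _ /(_ N (leqnn N)) /=].
rewrite sub0r normrN ger0_norm ?rnorm_ge0//; set v := u N => vx.
have := cD v (Du N) => /cvg_rnormP/cvgrPdist_lt/(_ _ e1).
apply: filterS2 near1 => t t1; rewrite !sub0r !normrN !ger0_norm ?rnorm_ge0// => tv.
have -> : gadj t x - x = gadj t (x - v) + ((gadj t v - v) + (v - x)).
  by rewrite (lin_sub (gadj_linear t)) !addrA !subrK.
apply: le_lt_trans (rnormD _ _) _; apply: le_lt_trans (lerD (hM t t1 _) (rnormD _ _)) _.
have -> : e = M * (e / (M + 2)) + (e / (M + 2) + e / (M + 2)) by field; rewrite gt_eqF.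
apply: ler_ltD; first by rewrite ler_wpM2l// rnormB ltW.
exact: ltrD.
Qed.

Lemma gadj_cvg x t : gadj s x @[s --> t] --> gadj t x.
Proof.
apply: cvg_unshift0; under eq_fun do rewrite gadjD.
have [C hC] := gadj_continuous t.
by apply: cvg_cts_comp; [exact: gadj_cvg0 | exact: bound_continuous (gadj_linear t) hC _].
Qed.

Lemma gadj_vderiv phi t : D phi -> vderiv (fun s => gadj s phi) t (gadj t (As phi)).
Proof.
move=> Dphi.
have v0 : vderiv (fun s => gadj s phi) 0 (As phi).
  apply/cvg_rnormP/cvgrPdist_le => e e0.
  have gc : gadj s (As phi) @[s --> (0 : R)] --> As phi by exact: gadj_cvg0.
  have /cvg_rnormP/cvgrPdist_le/(_ _ e0)/nbhs_ballP[d /= d0 hd] := gc.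
  suff : \forall h \near (0 : R), h != 0 ->
    `|0 - rnorm (h^-1 *r (gadj (0 + h) phi - gadj 0 phi) - As phi)| <= e by [].
  have hd2 : 0 < d / 2 by rewrite divr_gt0.
  apply: filterS (@nbhs0_le R R _ hd2) => h hle h0.
  rewrite sub0r normrN ger0_norm ?rnorm_ge0// add0r gadj0.
  have := @gadj_mvt phi h (As phi) e (ltW e0) Dphi.
  have -> : gadj h phi - phi - h *r As phi = h *r (h^-1 *r (gadj h phi - phi) - As phi).
    by rewrite scalerBr scalerA -scal_ofM divff// scal_of1 scale1r.
  rewrite rnormrZ mulrC ler_pM2r ?normr_gt0//; apply=> s sh.
  have := hd s; rewrite sub0r normrN ger0_norm ?rnorm_ge0//; apply.
  by rewrite /ball /= sub0r normrN (le_lt_trans sh)// (le_lt_trans hle)// ltr_pdivrMr// ltr_pMr// ltr1n.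
have := vderiv_lin (gadj_linear t) (gadj_continuous t) v0.
rewrite /vderiv; under eq_fun do rewrite -!gadjD add0r addr0.
by [].
Qed.

End AdjointGenerator.

(** * Observation of the adjoint orbits *)

Variables (B : {linear U -> antidual As}) (B_cont : continuous B).
Local Notation Bs := (control_adjoint B).

Section Observation.
Implicit Types (phi psi : H) (s t : R).

Lemma antidual_rnorm (f : antidual As) phi : D phi ->
  sabs (f phi) <= rnorm f * (rnorm phi + rnorm (As phi)).
Proof.
move=> Dphi; have [f0 /(_ _ Dphi) hf] := antidual_opnormP f.
have -> : rnorm f = antidual_opnorm f by rewrite /rnorm /Num.norm /= scal_ofK.
apply: le_trans hf _; rewrite ler_wpM2l// /graph_norm.
rewrite -[leRHS]ger0_norm ?addr_ge0 ?rnorm_ge0// -sqrtr_sqr ler_wsqrtr//.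
by rewrite sqrrD lerD2r lerDl mulrn_wge0// mulr_ge0 ?rnorm_ge0.
Qed.

Lemma control_bound : exists2 C : R, 0 < C & forall v phi, D phi ->
  sabs (B v phi) <= C * rnorm v * (rnorm phi + rnorm (As phi)).
Proof.
have [C C0 hC] := linear_bound B_cont; exists C => // v phi Dphi.
apply: le_trans (antidual_rnorm _ Dphi) _.
by rewrite ler_wpM2r ?addr_ge0 ?rnorm_ge0.
Qed.

(** The representing vector exists by the Riesz theorem. *)
Lemma control_adjointP v phi : D phi -> B v phi = dotp v (Bs phi).
Proof.
move=> Dphi; rewrite /control_adjoint; case: xgetP => [w _ |]; first exact.
have [C C0 hC] := control_bound.
have [|||w hw] := @riesz _ _ _ (fun v => B v phi) (C * (rnorm phi + rnorm (As phi))).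
- by move=> x y; rewrite linearD.
- by move=> a x; rewrite linearZ_LR.
- by move=> x; rewrite mulrAC; exact: hC.
by move=> /(_ w).
Qed.

Lemma control_adjoint_lin (a : scal R k) phi psi : D phi -> D psi ->
  Bs (a *: phi + psi) = a *: Bs phi + Bs psi.
Proof.
move=> Dphi Dpsi; apply: dotp_injr => v.
have [_ fl _] := antidual_in (B v).
rewrite dotp_antilinear -!control_adjointP//; last exact: (adjoint_lin _ _ _).1.
exact: fl.
Qed.

Lemma control_adjointD phi psi : D phi -> D psi -> Bs (phi + psi) = Bs phi + Bs psi.
Proof.
by move=> Dphi Dpsi; rewrite -[in LHS](scale1r phi) control_adjoint_lin// scale1r.
Qed.

Lemma control_adjoint0 : Bs 0 = 0.
Proof.
have [D0 _ _] := adjoint_rsubspace.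
have := control_adjointD D0 D0; rewrite addr0 => /eqP.
by rewrite -subr_eq0 opprD addNKr oppr_eq0 => /eqP.
Qed.

Lemma control_adjointZ (a : scal R k) phi : D phi -> Bs (a *: phi) = a *: Bs phi.
Proof.
move=> Dphi; rewrite -[in LHS](addr0 (a *: phi)) control_adjoint_lin//.
  by rewrite control_adjoint0 addr0.
by have [D0 _ _] := adjoint_rsubspace.
Qed.

Lemma control_adjoint_bound : exists2 C : R, 0 < C & forall phi, D phi ->
  rnorm (Bs phi) <= C * (rnorm phi + rnorm (As phi)).
Proof.
have [C C0 hC] := control_bound; exists C => // phi Dphi.
apply: rnorm_rdot_le; first by rewrite mulr_ge0 ?addr_ge0 ?rnorm_ge0 ?ltW.
move=> v; rewrite /rdot -control_adjointP//.
apply: le_trans (ler_norm _) _; apply: le_trans (sabs_re _) _.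
by rewrite mulrAC; exact: hC.
Qed.

(** The output of the dual system, the adjoint orbit being observed by [B^*]. *)
Definition obs phi s : U := Bs (gadj s phi).

Lemma obs_D phi psi s : D phi -> D psi -> obs (phi + psi) s = obs phi s + obs psi s.
Proof.
move=> Dphi Dpsi; rewrite /obs (lin_add (gadj_linear s)) control_adjointD//.
  exact: (gadj_dom s Dphi).
exact: (gadj_dom s Dpsi).
Qed.

Lemma obs_Z (a : scal R k) phi s : D phi -> obs (a *: phi) s = a *: obs phi s.
Proof.
move=> Dphi; rewrite /obs (lin_scale (gadj_linear s)) control_adjointZ//.
exact: (gadj_dom s Dphi).
Qed.

Lemma obs_B phi psi s : D phi -> D psi -> obs (phi - psi) s = obs phi s - obs psi s.
Proof.
move=> Dphi Dpsi; rewrite obs_D//; last first.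
  by rewrite -scaleN1r; exact: adjoint_domZ.
by rewrite -[in LHS](scaleN1r psi) obs_Z// scaleN1r.
Qed.

Lemma obs_gadj phi t s : obs (gadj t phi) s = obs phi (s + t).
Proof. by rewrite /obs gadjD. Qed.

Lemma obs_cts phi : D phi -> continuous (obs phi).
Proof.
move=> Dphi s; have [C C0 hC] := control_adjoint_bound.
apply: (cvg_rnorm_le (g := fun t => C * (rnorm (gadj t phi - gadj s phi) +
    rnorm (gadj t (As phi) - gadj s (As phi))))).
  apply: nearW => t; have [Dt At] := gadj_adjoint t Dphi.
  have [Ds Ass] := gadj_adjoint s Dphi.
  have [Dd Ad] := adjoint_lin (- 1) Ds Dt.
  move: Dd Ad; rewrite scaleN1r addrC => Dd Ad.
  have -> : obs phi t - obs phi s = Bs (gadj t phi - gadj s phi).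
    rewrite /obs control_adjointD//; last by rewrite -scaleN1r; exact: adjoint_domZ.
    by rewrite -[in RHS](scaleN1r (gadj s phi)) control_adjointZ// scaleN1r.
  by apply: le_trans (hC _ Dd) _; rewrite Ad Ass At scaleN1r [in X in _ * (_ + X)]addrC.
have cv : C * (rnorm (gadj t phi - gadj s phi) + rnorm (gadj t (As phi) - gadj s (As phi)))
    @[t --> s] --> C * (0 + (0 : R)).
  by apply: cvgMl_tmp; apply: cvgD; apply/cvg_rnormP; exact: gadj_cvg.
by move: cv; rewrite addr0 mulr0.
Qed.

Lemma obs_rdot_cts phi psi (f g : R -> R) : D phi -> D psi -> continuous f -> continuous g ->
  continuous (fun s => rdot (obs phi (f s)) (obs psi (g s))).
Proof.
move=> Dphi Dpsi fc gc s; apply: cvg_rdot.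
  by apply: cvg_cts_comp; [exact: fc | exact: obs_cts].
by apply: cvg_cts_comp; [exact: gc | exact: obs_cts].
Qed.

(** The weight [w] and the time change [g] cover the two cases met below: the
    observation of the backward orbit from [T] and the discounted one for
    negative times. *)
Definition obsform (w g : R -> R) (a b : R) phi psi : R :=
  itg (fun s => w s * rdot (obs phi (g s)) (obs psi (g s))) a b.

Section ObsForm.
Variables (w g : R -> R) (wc : continuous w) (gc : continuous g).

Lemma obsform_cts phi psi : D phi -> D psi ->
  continuous (fun s => w s * rdot (obs phi (g s)) (obs psi (g s))).
Proof. by move=> Dphi Dpsi s; apply: cvgM; [exact: wc | exact: obs_rdot_cts]. Qed.

Lemma obsform_form (a b : R) : a <= b -> (forall s, 0 <= w s) -> form_on D (obsform w g a b).
Proof.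
move=> ab w0; have [D0 DD DZ] := adjoint_rsubspace.
split=> //.
- by move=> x y _ _; rewrite /obsform; congr itg; apply/funext => s; rewrite rdotC.
- move=> x y z Dx Dy Dz; rewrite /obsform -itgD//; try exact: obsform_cts.
  by congr itg; apply/funext => s; rewrite obs_D// rdotDl mulrDr.
- move=> r x y Dx Dy; rewrite /obsform -itgZ//; last exact: obsform_cts.
  by congr itg; apply/funext => s; rewrite obs_Z// rdotrZl mulrCA.
- move=> x Dx; apply: itg_ge0 => //; first exact: obsform_cts.
  by move=> s _; rewrite mulr_ge0// rdotxx sqr_ge0.
Qed.

End ObsForm.

End Observation.

(** * Admissibility *)

Hypothesis adm : admissible B S.
Local Notation revform T := (obsform (fun=> 1) (fun s => T - s) 0 T).

Section Admissibility.
Implicit Types (phi psi : H) (s t : R).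

(** The transpose of the restriction of the adjoint group is continuous for the
    graph norm because the group commutes with the adjoint generator. *)
Lemma extended_groupP t (f : antidual As) phi : D phi ->
  extended_group S t f phi = f (gadj t phi).
Proof.
move=> Dphi; rewrite /extended_group; case: xgetP => [g _ /(_ _ Dphi)//|noex].
pose g : H -> (scal R k)^o := fun psi => if `[< D psi >] then f (gadj t psi) else 0.
have gin : g \in antidual_pred As.
  have [f0 fl _] := antidual_in f.
  have [M M0 hM] := gadj_loc_bound `|t|.
  apply/asboolP; split.
  - by move=> psi Dpsi; rewrite /g asboolF.
  - move=> a x y Dx Dy; rewrite /g !asboolT//; last exact: (adjoint_lin _ Dx Dy).1.
    rewrite (gadj_linear t) fl//; first exact: (gadj_dom t Dx).
    exact: (gadj_dom t Dy).
  - have [C0 hC] := antidual_opnormP f; exists (antidual_opnorm f * (2 * M)).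
    split; first by rewrite !mulr_ge0.
    move=> psi Dpsi; rewrite /g asboolT//.
    have [Dg Ag] := gadj_adjoint t Dpsi.
    apply: le_trans (hC _ Dg) _; rewrite -mulrA ler_wpM2l//.
    rewrite /graph_norm -[leRHS]ger0_norm; last by rewrite !mulr_ge0 ?sqrtr_ge0.
    rewrite -sqrtr_sqr ler_wsqrtr// exprMn sqr_sqrtr ?addr_ge0 ?sqr_ge0//.
    have h x : rnorm (gadj t x) ^+ 2 <= M ^+ 2 * rnorm x ^+ 2.
      by rewrite -exprMn ler_pXn2r ?nnegrE ?mulr_ge0 ?rnorm_ge0// hM.
    have p (x : H) : 0 <= M ^+ 2 * rnorm x ^+ 2 by rewrite mulr_ge0 ?sqr_ge0.
    by rewrite Ag; have := h psi; have := h (As psi); have := p psi; have := p (As psi); lra.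
by exfalso; apply: (noex (Antidual gin)) => psi Dpsi /=; rewrite /g asboolT.
Qed.

(** The final value of the mild solution from 0, tested against the domain of
    the adjoint. *)
Lemma admissible_dual (T : R) (u : R -> U) : 0 < T -> in_L2 T u ->
  exists h : H, forall phi, D phi ->
    rdot h phi = \int[mu]_(t in `]0, T[) rdot (u t) (obs phi (T - t)).
Proof.
move=> T0 uL; have [y [_ hy]] := @adm T u T0 uL.
exists (y T) => phi Dphi.
have TT : T \in `[0, T] by rewrite in_itv /= lexx ltW.
pose l (f : antidual As) : R := scal_re (f phi).
have [|||_] := @bochner_functional _ _ _ l (rnorm phi + rnorm (As phi)) _ _ _ T _ _ (hy T TT).
- by move=> f g; rewrite /l -scal_reD.
- by move=> r f; rewrite /l -scal_re_ofM.
- move=> f; apply: le_trans (sabs_re _) _; rewrite mulrC; exact: antidual_rnorm.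
rewrite {2}/l /= /pivot_fun asboolT// -/(rdot (y T) phi) => <-.
apply: eq_Rintegral => t _; rewrite /l extended_groupP//.
by rewrite control_adjointP//; exact: (gadj_dom _ Dphi).
Qed.

Lemma obsform_integral (T : R) phi psi : 0 <= T -> D phi -> D psi ->
  obsform (fun=> 1) (fun s => T - s) 0 T phi psi =
  \int[mu]_(t in `]0, T[) rdot (obs phi (T - t)) (obs psi (T - t)).
Proof.
move=> T0 Dphi Dpsi; rewrite /obsform /Rintegral.
have E : (fun s => 1 * rdot (obs phi (T - s)) (obs psi (T - s))) =
   fun s => rdot (obs phi (T - s)) (obs psi (T - s)).
  by apply/funext => s; rewrite mul1r.
rewrite E integral_itg_oo//; apply: obs_rdot_cts => // s;
  by apply: cvgB; [exact: cvg_cst | exact: cvg_id].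
Qed.

Lemma obs_rev_cts (T : R) phi : D phi -> continuous (fun t => obs phi (T - t)).
Proof.
move=> Dphi t; apply: cvg_cts_comp; first exact: rev_cts.
exact: obs_cts.
Qed.

(** Admissibility provides, for each control, a vector that represents the
    pairing of the control with the observations. Observations that are Cauchy
    in mean square converge to such a control, so [form_bounded] turns this
    qualitative statement into an inequality. *)
Lemma admissible_bound (T : R) : 0 < T -> exists2 C : R, 0 <= C &
  forall phi, D phi ->
    obsform (fun=> 1) (fun s => T - s) 0 T phi phi <= C * rnorm phi ^+ 2.
Proof.
move=> T0.
have qf := obsform_form (@cst_continuous _ _ (1 : R)) (@rev_cts R T) (ltW T0) (fun=> ler01).
apply: (form_bounded qf) => x Dx xq.
pose v n t := obs (x n) (T - t).
have vc n : continuous (v n) by exact: obs_rev_cts.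
have [|u um uv] := @L2_limit _ _ _ [set` `]0, T[] v 1 (measurable_itv _) ler01 vc.
  move=> n; have Dd : D (x n.+1 - x n) by exact: (form_domB qf).
  rewrite mul1r; have := xq n; rewrite /obsform -lee_fin -integral_itg_oo; [|idtac|exact: ltW]; last first.
    by apply: obsform_cts => //; [exact: cst_continuous | exact: rev_cts].
  move=> h; apply: le_trans _ h; rewrite le_eqVlt; apply/orP; left; apply/eqP.
  apply: eq_integral => t _.
  by rewrite mul1r rdotxx /v obs_B.
have uL : in_L2 T u.
  by apply: L2_of_dist um (vc 0%N) _; apply: le_lt_trans (uv 0%N) _; rewrite ltey.
have [h hh] := admissible_dual T0 uL.
exists h => y Dy; rewrite hh//.
rewrite (_ : (fun n => _) = fun n => \int[mu]_(t in `]0, T[) rdot (v n t) (obs y (T - t))).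
  apply: L2_rdot_cvg => //; first by apply: cts_in_L2; exact: obs_rev_cts.
  apply: (squeeze_cvge (f := fun=> 0%E) (h := fun n => (8 * 1 * 4^-1 ^+ n)%:E)).
  - by apply: nearW => n; rewrite uv integral_ge0// => t _; rewrite lee_fin sqr_ge0.
  - exact: cvg_cst.
  - have : 8 * 1 * 4^-1 ^+ n @[n --> \oo] --> 8 * 1 * (0 : R).
      by apply: cvgMl_tmp; apply: cvg_expr; rewrite ger0_norm ?invr_ge0// invf_lt1// ltr1n.
    by rewrite mulr0 => h0; apply/cvg_EFin => //; exact: nearW.
by apply/funext => n; rewrite obsform_integral// ltW.
Qed.

End Admissibility.

(** * Observability *)

Section Controllability.
Implicit Types (phi psi : H) (s t : R).

Lemma gadj_rev_vderiv (T : R) phi t : D phi ->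
  vderiv (fun s => gadj (T - s) phi) t (- gadj (T - t) (As phi)).
Proof.
move=> Dphi; apply: (@vderiv_opp _ _ _ (fun w => gadj (T + w) phi) t).
have := @gadj_vderiv phi (T - t) Dphi.
by rewrite /vderiv; under eq_fun do rewrite -addrA.
Qed.

Section Trajectory.
Variables (T : R) (T0 : 0 < T) (u : R -> U) (y0 : H) (y : R -> H).
Hypothesis uL : in_L2 T u.
Hypothesis yw : weak_solution B T u y0 y.

Let yh t := y (Num.max 0 (Num.min t T)).

Let yh_cts : continuous yh.
Proof. by apply: clamp_cts; [exact: ltW | case: yw]. Qed.

Let yhE t : 0 <= t <= T -> yh t = y t.
Proof. by move=> /andP[t0 tT]; rewrite /yh min_l// max_r. Qed.

Let ui (w : U) : mu.-integrable `]0, T[ (EFin \o (fun t => rdot (u t) w)).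
Proof.
apply: L2_rdot_integrable => //; apply: cts_in_L2; exact: cst_continuous.
Qed.

Let oc_sub (a b : R) : 0 < a -> b < T -> `]a, b] `<=` (`]0, T[ : set R).
Proof.
move=> a0 bT t /=; rewrite !in_itv/= => /andP[ta tb].
by rewrite (lt_trans a0 ta) (le_lt_trans tb bT).
Qed.

(** The weak formulation tested against a fixed vector, integrated in time. *)
Lemma weak_solution_increment phi (a b : R) : D phi -> 0 < a -> a <= b -> b < T ->
  rdot (yh b) phi - rdot (yh a) phi =
  \int[mu]_(t in `]a, b]) (rdot (yh t) (As phi) + rdot (u t) (Bs phi)).
Proof.
move=> Dphi a0 ab bT; have yc (c : H) : continuous (fun t => rdot (yh t) c).
  by move=> t; apply: cvg_rdot; [exact: yh_cts | exact: cvg_cst].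
apply: (@du_bois_reymond R (fun t => rdot (yh t) phi) _ T) => //.
  have := integrableD (mu := mu) (measurable_itv _) (cts_integrable_oo 0 T (yc (As phi))) (ui (Bs phi)).
  by apply: eq_integrable.
move=> theta th; have [_ _ /(_ phi Dphi theta th)] := yw.
move=> /(congr1 (@scal_re R k)); rewrite scal_reN !scal_re_int => e.
have E (f f' : R -> R) : (forall t, 0 < t < T -> f t = f' t) ->
    \int[mu]_(t in `]0, T[) f t = \int[mu]_(t in `]0, T[) f' t.
  by move=> ff; apply: eq_Rintegral => t; rewrite inE /= in_itv /= => /ff.
rewrite (E _ (fun t => scal_re (scal_of k (derive1 theta t) * dotp (y t) phi))).
  rewrite e; apply: E => t /andP[t0 tT].
  by rewrite scal_re_ofM scal_reD yhE// !ltW.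
by move=> t /andP[t0 tT]; rewrite scal_re_ofM yhE// !ltW.
Qed.

Let urn : mu.-integrable `]0, T[ (EFin \o (fun t => rnorm (u t))).
Proof.
have i1 : mu.-integrable `]0, T[ (EFin \o (fun t => 1 + rnorm (u t) ^+ 2)).
  have c1 : continuous (fun _ : R => 1 : R) by exact: cst_continuous.
  have := integrableD (mu := mu) (measurable_itv _) (cts_integrable_oo 0 T c1) (L2_sqr_integrable uL).
  by apply: eq_integrable.
apply: le_integrable i1 => //.
  apply/measurable_EFinP; apply: (@strong_comp_measurable _ _ _ (fun x _ => rnorm x)) => //.
    by case: uL.
  by move=> t _; apply: cvg_rnorm; exact: cvg_id.
move=> t _ /=; rewrite lee_fin !ger0_norm ?rnorm_ge0 ?addr_ge0 ?sqr_ge0//.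
by have := sqr_ge0 (rnorm (u t) - 1); have := sqr_ge0 (rnorm (u t)); rewrite sqrrB1 -mulr_natl; lra.
Qed.

(** The pairing of a trajectory with a solution of the backward adjoint
    equation only varies through the control. The trajectory is merely
    continuous, so the product rule is replaced by a comparison of the
    increments over short intervals, with an error small relatively to the
    length and to the mass of the control; the errors add up by [interval_ind]. *)
Lemma weak_solution_dual phi (a b : R) : D phi -> 0 < a -> a <= b -> b < T ->
  rdot (yh b) (gadj (T - b) phi) - rdot (yh a) (gadj (T - a) phi) =
  \int[mu]_(t in `]a, b]) rdot (u t) (obs phi (T - t)).
Proof.
move=> Dphi a0 ab bT.
pose al := yh; pose be t := gadj (T - t) (As phi); pose ga t := obs phi (T - t).
pose ps t := gadj (T - t) phi.
have be_cts : continuous be.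
  move=> t; apply: (@cvg_cts_comp _ _ _ _ (fun t => T - t) (fun s => gadj s (As phi))).
    exact: rev_cts.
  exact: gadj_cvg.
have ga_cts : continuous ga by exact: obs_rev_cts.
have Dps t : D (ps t) by exact: (gadj_dom _ Dphi).
have Aps t : As (ps t) = be t by exact: (gadj_adjoint _ Dphi).2.
have ugi : mu.-integrable `]0, T[ (EFin \o (fun t => rdot (u t) (ga t))).
  by apply: L2_rdot_integrable => //; exact: cts_in_L2.
pose I f (x z : R) := \int[mu]_(t in `]x, z]) f t.
pose De x z := rdot (al z) (ps z) - rdot (al x) (ps x) - I (fun t => rdot (u t) (ga t)) x z.
have iS (f : R -> R) (x z : R) : 0 < x -> z < T -> mu.-integrable `]0, T[ (EFin \o f) ->
    mu.-integrable `]x, z] (EFin \o f).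
  by move=> x0 zT; apply: integrableS => //; exact: oc_sub.
have Icat f (x z w : R) : 0 < x -> w < T -> x <= z -> z <= w ->
    mu.-integrable `]0, T[ (EFin \o f) -> I f x w = I f x z + I f z w.
  move=> x0 wT xz zw fi; rewrite /I -(@Rintegral_itvB _ f (BRight x) (BRight w) z) ?bnd_simp//.
    by rewrite addrC subrK.
  exact: iS.
suff De0 (ep : R) : 0 < ep -> `|De a b| <= ep * ((b - a) + I (fun t => rnorm (u t)) a b).
  have I0 : 0 <= I (fun t => rnorm (u t)) a b by apply: Rintegral_ge0 => t _; exact: rnorm_ge0.
  suff : De a b = 0 by move=> /eqP; rewrite /De subr_eq0 => /eqP.
  apply/eqP; rewrite -normr_le0; apply/ler_addgt0Pl => ep ep0; rewrite addr0.
  pose m := (b - a) + I (fun t => rnorm (u t)) a b + 1.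
  have m0 : 0 < m by rewrite /m; lra.
  apply: le_trans (De0 (ep / m) (divr_gt0 ep0 m0)) _.
  by rewrite mulrAC ler_pdivrMr// ler_wpM2l ?(ltW ep0)// /m; lra.
move=> ep0.
pose P x z := [/\ a <= x, x <= z, z <= b &
   `|De x z| <= ep * ((z - x) + I (fun t => rnorm (u t)) x z)].
have : P a b; last by case.
apply: interval_ind => //.
- move=> x z w [ax xz zb h1] [az zw wb h2].
  have x0 : 0 < x by exact: lt_le_trans ax.
  have z0 : 0 < z by exact: lt_le_trans az.
  have wT : w < T by exact: le_lt_trans bT.
  split=> //; first exact: le_trans zw.
  have -> : De x w = De x z + De z w.
    by rewrite /De (@Icat _ x z w)//; ring.
  rewrite (@Icat _ x z w)//; apply: le_trans (ler_normD _ _) _.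
  by apply: le_trans (lerD h1 h2) _; rewrite -mulrDr ler_wpM2l ?(ltW ep0)//; lra.
- move=> t /andP[at_ tb].
  pose N := rnorm (al t) + rnorm (be t) + 1.
  have N0 : 0 < N by rewrite ltr_wpDl// addr_ge0 ?rnorm_ge0.
  (* [eta] bounds the oscillation of the three functions near [t]; on products it
     leaves [ep / 2], since [eta <= 1]. *)
  pose eta := Num.min 1 (Num.min (ep / 2) (ep / 2 / N)).
  have eta0 : 0 < eta by rewrite !lt_min ltr01 !divr_gt0.
  have eta1 : eta <= 1 by rewrite ge_min lexx.
  have eta2 : eta <= ep / 2 by rewrite !ge_min lexx orbT.
  have eta3 : eta * N <= ep / 2 by rewrite -ler_pdivlMr// !ge_min lexx !orbT.
  have nearv (V : normedModType (scal R k)) (f : R -> V) : continuous f ->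
      exists2 d : R, 0 < d & forall s, `|s - t| < d -> rnorm (f s - f t) <= eta.
    move=> fc; have /cvg_rnormP/cvgrPdist_le/(_ _ eta0)/nbhs_ballP[d /= d0 hd] := fc t.
    exists d => // s st; have := hd s; rewrite sub0r normrN ger0_norm ?rnorm_ge0//; apply.
    by rewrite /ball /= distrC.
  have [d1 d10 h1] := nearv _ al yh_cts.
  have [d2 d20 h2] := nearv _ be be_cts.
  have [d3 d30 h3] := nearv _ ga ga_cts.
  exists (Num.min d1 (Num.min d2 d3)); first by rewrite !lt_min d10 d20.
  move=> x z ax xt tz zb; rewrite !lt_min => /and3P[xz1 xz2 xz3].
  have xz : x <= z by exact: le_trans tz.
  have x0 : 0 < x by exact: lt_le_trans ax.
  have zT : z < T by exact: le_lt_trans bT.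
  split=> //.
  have close s : x <= s <= z -> [/\ rnorm (al s - al t) <= eta,
      rnorm (be s - be t) <= eta & rnorm (ga s - ga t) <= eta].
    move=> /andP[xs sz]; have hs d : z - x < d -> `|s - t| < d.
      by move=> zx; rewrite ltr_norml; apply/andP; split; lra.
    by split; [apply: h1|apply: h2|apply: h3]; apply: hs.
  have ab2 s r : x <= s <= z -> x <= r <= z ->
      `|rdot (al s) (be r) - rdot (al t) (be t)| <= ep / 2.
    move=> /close[cs _ _] /close[_ cr _].
    have -> : rdot (al s) (be r) - rdot (al t) (be t) =
        rdot (al s - al t) (be r) + rdot (al t) (be r - be t).
      by rewrite rdotBl rdotBr; ring.
    apply: le_trans (ler_normD _ _) _; apply: le_trans (lerD (rdot_norm _ _) (rdot_norm _ _)) _.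
    have br : rnorm (be r) <= rnorm (be t) + eta.
      by rewrite -[be r](subrK (be t)); apply: le_trans (rnormD _ _) _; rewrite addrC lerD2l.
    apply: le_trans eta3; rewrite /N.
    have r1 := rnorm_ge0 (al t); have r2 := rnorm_ge0 (be t); have r3 := rnorm_ge0 (al s - al t).
    have r4 := rnorm_ge0 (be r).
    apply: (@le_trans _ _ (eta * (rnorm (be t) + eta) + rnorm (al t) * eta)); last by nra.
    by apply: lerD; [exact: ler_pM | rewrite ler_wpM2l].
  have yc (c : H) : continuous (fun r => rdot (al r) c).
    by move=> r; apply: cvg_rdot; [exact: yh_cts | exact: cvg_cst].
  have bc (c : H) : continuous (fun r => rdot c (be r)).
    by move=> r; apply: cvg_rdot; [exact: cvg_cst | exact: be_cts].
  have i1 : mu.-integrable `]x, z] (EFin \o (fun r => rdot (al r) (be x))).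
    by apply: iS => //; exact: cts_integrable_oo.
  have i2 : mu.-integrable `]x, z] (EFin \o (fun r => rdot (u r) (ga x))) by apply: iS.
  have i3 : mu.-integrable `]x, z] (EFin \o (fun r => rdot (al z) (be r))).
    by apply: iS => //; exact: cts_integrable_oo.
  have i4 : mu.-integrable `]x, z] (EFin \o (fun r => rdot (u r) (ga r))) by apply: iS.
  have i5 : mu.-integrable `]x, z] (EFin \o (fun r => rnorm (u r))) by apply: iS.
  have mI : measurable [set` `]x, z]] by [].
  have e1 : rdot (al z) (ps x) - rdot (al x) (ps x) =
      I (fun r => rdot (al r) (be x)) x z + I (fun r => rdot (u r) (ga x)) x z.
    by rewrite /al weak_solution_increment// Aps RintegralD.
  have e2 : rdot (al z) (ps z) - rdot (al z) (ps x) = - I (fun r => rdot (al z) (be r)) x z.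
    rewrite /I integral_itg_oc//.
    have dps (r : R) : is_derive r 1 (fun r => - rdot (al z) (ps r)) (rdot (al z) (be r)).
      have := rderivN (vderiv_rdot (@vderiv_cst _ _ _ (al z) r) (@gadj_rev_vderiv T phi r Dphi)).
      by rewrite rdot0l add0r rdotNr opprK.
    by rewrite (itgE x z dps); ring.
  (* The first increment freezes the adjoint orbit, the second the trajectory. *)
  pose F r := (rdot (al r) (be x) - rdot (al z) (be r)) + (rdot (u r) (ga x) - rdot (u r) (ga r)).
  have i13 : mu.-integrable `]x, z] (EFin \o (fun r => rdot (al r) (be x) - rdot (al z) (be r))).
    by have := integrableB (mu := mu) mI i1 i3; apply: eq_integrable.
  have i24 : mu.-integrable `]x, z] (EFin \o (fun r => rdot (u r) (ga x) - rdot (u r) (ga r))).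
    by have := integrableB (mu := mu) mI i2 i4; apply: eq_integrable.
  have iF : mu.-integrable `]x, z] (EFin \o F).
    by have := integrableD (mu := mu) mI i13 i24; apply: eq_integrable.
  have DeE : De x z = I F x z.
    have -> : De x z = (rdot (al z) (ps z) - rdot (al z) (ps x)) +
        (rdot (al z) (ps x) - rdot (al x) (ps x)) - I (fun t => rdot (u t) (ga t)) x z.
      by rewrite /De; ring.
    by rewrite e1 e2 /F /I RintegralD// !RintegralB//; ring.
  have ce : continuous (fun _ : R => ep) by exact: cst_continuous.
  have ic : mu.-integrable `]x, z] (EFin \o (fun=> ep)).
    by apply: iS => //; exact: cts_integrable_oo.
  have iu : mu.-integrable `]x, z] (EFin \o (fun r => ep * rnorm (u r))).
    by have := integrableZl (mu := mu) mI ep i5; apply: eq_integrable => // r _ /=; rewrite EFinM.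
  have icu : mu.-integrable `]x, z] (EFin \o (fun r => ep + ep * rnorm (u r))).
    by have := integrableD (mu := mu) mI ic iu; apply: eq_integrable.
  have -> : ep * (z - x + I (fun r => rnorm (u r)) x z) = I (fun r => ep + ep * rnorm (u r)) x z.
    have dc (r : R) : is_derive r 1 (fun r => ep * r) ep.
      by have := rderivM (rderivC ep r) (is_derive_id r (1 : R)); rewrite mul0r add0r mulr1.
    have -> : I (fun r => ep + ep * rnorm (u r)) x z =
        I (fun=> ep) x z + I (fun r => ep * rnorm (u r)) x z by rewrite /I RintegralD.
    rewrite {2}/I integral_itg_oc// (itgE x z dc) /I RintegralZl//; ring.
  have LL : `|I F x z| <= I (fun r => `|F r|) x z by exact: le_normr_Rintegral.
  rewrite DeE; apply: (le_trans LL).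
  apply: le_Rintegral => //; first by have := integrable_abse iF.
  move=> r; rewrite /= in_itv /= => /andP[/ltW xr rz].
  have rr : x <= r <= z by rewrite xr.
  have xx : x <= x <= z by rewrite lexx.
  have zz : x <= z <= z by rewrite lexx andbT.
  rewrite /F; apply: le_trans (ler_normD _ _) _; apply: lerD.
    have := ab2 r x rr xx; have := ab2 z r zz rr.
    rewrite distrC => k1 k2; rewrite [ep]splitr.
    apply: le_trans (lerD k2 k1); apply: le_trans _ (ler_normD _ _).
    by rewrite addrA subrK.
  rewrite -rdotBr; apply: le_trans (rdot_norm _ _) _; rewrite mulrC ler_wpM2r ?rnorm_ge0//.
  have [_ _ gx] := close x xx; have [_ _ gr] := close r rr.
  apply: le_trans (rnorm_triB _ (ga t) _) _; rewrite [in X in _ + X]rnormB [ep]splitr.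
  by apply: lerD; apply: le_trans eta2.
Qed.

End Trajectory.

End Controllability.

Section Observability.
Implicit Types (phi psi : H) (s t : R).

Lemma revform_form (T : R) : 0 < T -> form_on D (revform T).
Proof.
move=> T0; apply: (obsform_form (@cst_continuous _ _ (1 : R)) (@rev_cts R T) (ltW T0)).
by move=> _; exact: ler01.
Qed.

(** The pairing identity on [e, T - e] for a control steering 0 to [h] yields
    [rdot h phi] as [e] tends to 0; the constant is the cost of this control. *)
Lemma controllable_dual (T : R) : 0 < T -> exactly_controllable B T ->
  forall h : H, exists2 C : R, 0 <= C & forall phi, D phi ->
    rdot h phi ^+ 2 <= C * revform T phi phi.
Proof.
move=> T0 ctrl h; have [u [y [uL yw yT]]] := ctrl 0 h.
have [yc y0 _] := yw.
have ui := L2_sqr_integrable uL.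
exists (\int[mu]_(t in `]0, T[) (rnorm (u t) ^+ 2)).
  by apply: Rintegral_ge0 => t _; exact: sqr_ge0.
move=> phi Dphi.
pose ga t := obs phi (T - t).
have ga_cts : continuous ga by exact: obs_rev_cts.
have gL : in_L2 T ga by exact: cts_in_L2.
have gi := L2_sqr_integrable gL.
have ugi := L2_rdot_integrable uL gL.
have -> : revform T phi phi = \int[mu]_(t in `]0, T[) (rnorm (ga t) ^+ 2).
  rewrite (obsform_integral (ltW T0) Dphi Dphi).
  by apply: eq_Rintegral => t _; rewrite rdotxx.
pose yh t := y (Num.max 0 (Num.min t T)).
have yh_cts : continuous yh by apply: clamp_cts => //; exact: ltW.
pose f e := rdot (yh (T - e)) (gadj (T - (T - e)) phi) - rdot (yh e) (gadj (T - e) phi).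
have f0 : f 0 = rdot h phi.
  rewrite /f subr0 subrr gadj0 /yh minxx (max_r (ltW T0)) yT.
  by rewrite (min_l (ltW T0)) maxxx y0 rdot0l subr0.
have fc : continuous f.
  have gc s : continuous (fun e => gadj (s - e) phi).
    move=> e; apply: (@cvg_cts_comp _ _ _ _ (fun e => s - e) (fun r => gadj r phi)).
      exact: rev_cts.
    exact: gadj_cvg.
  move=> e; apply: cvgB; apply: cvg_rdot.
  - by apply: cvg_cts_comp; [exact: rev_cts | exact: yh_cts].
  - under eq_fun do rewrite opprB addrCA subrr addr0.
    have -> : T - (T - e) = e by ring.
    exact: gadj_cvg.
  - exact: yh_cts.
  - exact: gc.
have cv : f e ^+ 2 @[e --> (0 : R)^'+] --> rdot h phi ^+ 2.
  rewrite -f0; apply: cvg_at_right_filter.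
  by apply: (@cvg_cts_comp _ _ _ _ f (fun r => r ^+ 2)); [exact: fc | exact: exprn_continuous].
apply: (cvgr_to_le cv); near=> e.
have e0 : 0 < e by near: e; exact: nbhs_right_gt.
have eT : e < T / 2 by near: e; apply: nbhs_right_lt; rewrite divr_gt0.
have sub : [set` `]e, T - e]] `<=` [set` `]0, T[].
  move=> t /=; rewrite !in_itv /= => /andP[h1 h2].
  by apply/andP; split; [exact: lt_trans h1 | apply: le_lt_trans h2 _; rewrite ltrBlDr ltrDl].
have -> : f e = \int[mu]_(t in `]e, T - e]) rdot (u t) (ga t).
  rewrite -(weak_solution_dual T0 uL yw Dphi)// ?ltrBlDr ?ltrDl//.
  by move: eT; lra.
have mE : measurable [set` `]e, T - e]] by [].
have sI g : mu.-integrable [set` `]0, T[] (EFin \o g) -> mu.-integrable [set` `]e, T - e]] (EFin \o g).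
  by apply: integrableS.
apply: le_trans (int_CS mE (sI _ ui) (sI _ ugi) (sI _ gi)) _.
apply: ler_pM.
- by apply: Rintegral_ge0 => t _; exact: sqr_ge0.
- by apply: Rintegral_ge0 => t _; exact: sqr_ge0.
- by apply: le_subset_Rintegral => // t; exact: sqr_ge0.
- by apply: le_subset_Rintegral => // t; exact: sqr_ge0.
Unshelve. all: by end_near. Qed.

(** The vectors of the domain whose observation has energy at most 1 are weakly
    bounded by [controllable_dual], hence bounded. *)
Lemma observability (T : R) : 0 < T -> exactly_controllable B T ->
  exists2 C : R, 0 <= C & forall phi, D phi -> rnorm phi ^+ 2 <= C * revform T phi phi.
Proof.
move=> T0 ctrl; have qf := revform_form T0.
pose E := [set phi | D phi /\ revform T phi phi <= 1].
have [|M hM] := @weakly_bounded _ _ _ E.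
  move=> x; have [C C0 hC] := controllable_dual T0 ctrl x.
  exists (C + 1) => phi [Dphi q1].
  rewrite -(ler_pXn2r (n:=2))// ?nnegrE ?addr_ge0// real_normK ?num_real//.
  apply: le_trans (hC _ Dphi) _; apply: (@le_trans _ _ C); first by rewrite ler_piMr.
  by rewrite sqrrD expr1n; have := sqr_ge0 C; lra.
exists (M ^+ 2); first exact: sqr_ge0.
move=> phi Dphi; have q0 := form_ge0 qf Dphi; set Q := revform T phi phi in q0 *.
apply/ler_addgt0Pl => e e0.
(* [Q] may vanish, hence the shift by [d] before normalizing. *)
pose d := e / (M ^+ 2 + 1).
have M1 : 0 < M ^+ 2 + 1 by rewrite ltr_wpDl ?sqr_ge0.
have d0 : 0 < d by exact: divr_gt0.
have Qd : 0 < Q + d by exact: ltr_wpDl.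
pose s := Num.sqrt (Q + d); have s0 : 0 < s by rewrite sqrtr_gt0.
have s2 : s ^+ 2 = Q + d by rewrite sqr_sqrtr// ltW.
have Ds : D (s^-1 *r phi) by exact: (form_domZ qf).
have /hM : E (s^-1 *r phi).
  split=> //; rewrite (form_Zl qf)// (form_Zr qf)// -/Q mulrA -invfM -expr2 s2.
  by rewrite mulrC ler_pdivrMr// mul1r lerDl ltW.
rewrite rnormrZ ger0_norm ?invr_ge0 ?(ltW s0)// mulrC ler_pdivrMr// => h.
apply: (@le_trans _ _ ((M * s) ^+ 2)).
  by rewrite ler_pXn2r ?nnegrE ?rnorm_ge0 ?(le_trans (rnorm_ge0 _) h).
rewrite exprMn s2 mulrDr addrC lerD2r /d mulrCA ger_pMr//.
by rewrite ler_pdivrMr// mul1r lerDl.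
Qed.

End Observability.

(** * The Gramian *)

Variables (M a lam : R).
Hypotheses (M1 : 1 <= M) (a0 : 0 <= a) (lam_a : 2 * a + 1 <= lam).
Hypothesis gadj_le : forall t x, rnorm (gadj t x) <= M * expR (a * `|t|) * rnorm x.

Section Gramian.
Implicit Types (phi psi : H) (s t : R).

(** The discounted Gramian of the observations on [- t, 0]. *)
Definition gram_at t phi psi : R :=
  obsform (fun s => expR (- lam * s)) (fun s => - s) 0 t phi psi.

Let gc phi psi : D phi -> D psi ->
  continuous (fun s => expR (- lam * s) * rdot (obs phi (- s)) (obs psi (- s))).
Proof. exact: (obsform_cts (@expR_scale_cts _ _) (@oppr_cts R)). Qed.

Lemma gram_at_form t : 0 <= t -> form_on D (gram_at t).
Proof.
by move=> t0; apply: (obsform_form (@expR_scale_cts _ _) (@oppr_cts R) t0) => s; exact: expR_ge0.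
Qed.

(** Observing [phi] before the time [- t] amounts to observing [gadj (- t)
    phi]. *)
Lemma gram_at_add t s phi psi : D phi -> D psi ->
  gram_at (t + s) phi psi =
  gram_at t phi psi + expR (- lam * t) * gram_at s (gadj (- t) phi) (gadj (- t) psi).
Proof.
move=> Dphi Dpsi; rewrite /gram_at /obsform -(itg_cat _ 0 t); congr (_ + _).
have := itg_affine t 1 0 s (gc Dphi Dpsi); rewrite !mul1r addr0 => <-.
rewrite -itgZ; last by apply: gc; exact: gadj_dom.
congr itg; apply/funext => r; rewrite mul1r !obs_gadj mulrDr expRD mulrA.
by rewrite opprD (addrC (- t)).
Qed.

Lemma gram_at_mono phi s t : D phi -> s <= t -> gram_at s phi phi <= gram_at t phi phi.
Proof.
move=> Dphi st; rewrite /gram_at /obsform -[leRHS](itg_cat _ 0 s) lerDl.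
apply: itg_ge0 => //; first exact: gc.
by move=> r _; rewrite mulr_ge0 ?expR_ge0// rdotxx sqr_ge0.
Qed.

Let M0 : 0 <= M. Proof. exact: le_trans M1. Qed.

Let lam0 : 0 <= lam. Proof. by move: a0 lam_a; lra. Qed.

Lemma gadj_sqr_le t x : rnorm (gadj t x) ^+ 2 <= M ^+ 2 * expR (2 * a * `|t|) * rnorm x ^+ 2.
Proof.
have -> : M ^+ 2 * expR (2 * a * `|t|) * rnorm x ^+ 2 = (M * expR (a * `|t|) * rnorm x) ^+ 2.
  have -> : 2 * a * `|t| = a * `|t| + a * `|t| by ring.
  by rewrite expRD; ring.
by rewrite ler_pXn2r ?nnegrE ?rnorm_ge0// !mulr_ge0 ?expR_ge0 ?rnorm_ge0.
Qed.

Let revE (T : R) phi : D phi -> itg (fun s => rnorm (obs phi (- s)) ^+ 2) 0 T =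
  revform T (gadj (- T) phi) (gadj (- T) phi).
Proof.
move=> Dphi; rewrite /obsform; congr itg; apply/funext => s.
by rewrite mul1r !obs_gadj rdotxx addrAC subrr add0r.
Qed.

Let sqrc phi : D phi -> continuous (fun s => rnorm (obs phi (- s)) ^+ 2).
Proof.
move=> Dphi; apply: (@rnorm_sqr_cts _ _ _ (fun s => obs phi (- s))) => s.
by apply: cvg_cts_comp; [exact: oppr_cts | exact: obs_cts].
Qed.

(** The contributions of the intervals of unit length decay geometrically,
    since [lam] exceeds twice the growth rate of the group. *)
Lemma gram_at_bound : exists2 C : R, 0 <= C & forall t phi, D phi ->
  gram_at t phi phi <= C * rnorm phi ^+ 2.
Proof.
have [C C0 hC] := admissible_bound ltr01.
pose K := C * (M ^+ 2 * expR (2 * a)).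
have K0 : 0 <= K by rewrite !mulr_ge0 ?sqr_ge0 ?expR_ge0.
have g1 phi : D phi -> gram_at 1 phi phi <= K * rnorm phi ^+ 2.
  move=> Dphi; apply: (@le_trans _ _ (itg (fun s => rnorm (obs phi (- s)) ^+ 2) 0 1)).
    apply: itg_le => //; [exact: gc|exact: sqrc|].
    move=> s /andP[s0 _]; rewrite rdotxx ler_piMl ?sqr_ge0// -expR0 ler_expR.
    by rewrite mulNr oppr_le0 mulr_ge0.
  rewrite revE//; apply: le_trans (hC _ (gadj_dom _ Dphi)) _.
  rewrite /K -mulrA ler_wpM2l//; apply: le_trans (gadj_sqr_le _ _) _.
  by rewrite normrN normr1 mulr1.
pose r := expR (- 1 : R).
have r0 : 0 < r by exact: expR_gt0.
have r1 : r < 1 by rewrite /r -[ltRHS]expR0 ltr_expR; lra.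
exists (K * M ^+ 2 / (1 - r)); first by rewrite divr_ge0 ?mulr_ge0 ?sqr_ge0// subr_ge0 (ltW r1).
move=> t phi Dphi.
have gn n : gram_at n%:R phi phi <= K * M ^+ 2 * rnorm phi ^+ 2 * ((1 - r ^+ n) / (1 - r)).
  elim: n => [|n ih]; first by rewrite /gram_at /obsform /itg subrr expr0 subrr mul0r mulr0.
  rewrite -addn1 natrD gram_at_add//.
  have e0 := expR_ge0 (- lam * n%:R).
  apply: (le_trans (lerD ih (ler_wpM2l e0 (g1 _ (gadj_dom _ Dphi))))).
  have -> : (1 - r ^+ (n + 1)) / (1 - r) = (1 - r ^+ n) / (1 - r) + r ^+ n.
    by rewrite addn1 exprS; field; rewrite subr_eq0 gt_eqF.
  rewrite [leRHS]mulrDr lerD2l.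
  have gs := gadj_sqr_le (- n%:R) phi.
  apply: (le_trans (ler_wpM2l e0 (ler_wpM2l K0 gs))).
  have -> : expR (- lam * n%:R) * (K * (M ^+ 2 * expR (2 * a * `|- n%:R|) * rnorm phi ^+ 2)) =
      K * M ^+ 2 * rnorm phi ^+ 2 * (expR (- lam * n%:R) * expR (2 * a * `|- n%:R|)) by ring.
  have P0 : 0 <= K * M ^+ 2 * rnorm phi ^+ 2 by apply: mulr_ge0 (mulr_ge0 K0 (sqr_ge0 _)) (sqr_ge0 _).
  apply: (ler_wpM2l P0); rewrite -expRD /r -expRM_natl ler_expR normrN ger0_norm//.
  have n0 : (0 : R) <= n%:R by [].
  have p0 : 0 <= lam - (2 * a + 1) by rewrite subr_ge0.
  by have := mulr_ge0 p0 n0; lra.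
have [n tn] : exists n, t <= n%:R.
  by exists (Num.bound `|t|); apply: ltW; apply: le_lt_trans (ler_norm _) (archi_boundP _).
apply: le_trans (gram_at_mono Dphi tn) _; apply: le_trans (gn n) _.
have -> : K * M ^+ 2 / (1 - r) * rnorm phi ^+ 2 = K * M ^+ 2 * rnorm phi ^+ 2 * (1 / (1 - r)) by ring.
have P0 : 0 <= K * M ^+ 2 * rnorm phi ^+ 2 by apply: mulr_ge0 (mulr_ge0 K0 (sqr_ge0 _)) (sqr_ge0 _).
apply: (ler_wpM2l P0); rewrite ler_wpM2r ?invr_ge0 ?subr_ge0 ?(ltW r1)//.
by rewrite gerBl exprn_ge0// ltW.
Qed.

(** On a bounded interval the discount is bounded below, and the observation of
    [phi] on [- T, 0] is the one of [gadj (- T) phi] on [0, T]. *)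
Lemma gram_at_coercive (T : R) : 0 < T -> exactly_controllable B T ->
  exists2 C : R, 0 <= C & forall phi, D phi -> rnorm phi ^+ 2 <= C * gram_at T phi phi.
Proof.
move=> T0 ctrl; have [C C0 hC] := observability T0 ctrl.
exists (M ^+ 2 * expR (2 * a * T) * (C * expR (lam * T))); first by rewrite !mulr_ge0 ?sqr_ge0 ?expR_ge0.
move=> phi Dphi.
rewrite -{1}[phi](gadjK T); apply: le_trans (gadj_sqr_le _ _) _.
rewrite (ger0_norm (ltW T0)) -[leRHS]mulrA ler_wpM2l ?mulr_ge0 ?sqr_ge0 ?expR_ge0//.
apply: le_trans (hC _ (gadj_dom _ Dphi)) _; rewrite -mulrA ler_wpM2l//.
rewrite -revE// /gram_at /obsform -itgZ; last exact: gc.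
apply: itg_le (ltW T0) _; [exact: sqrc| |].
  by move=> s; apply: cvgMl_tmp; exact: gc.
move=> s /andP[_ sT]; rewrite rdotxx mulrA ler_peMl ?sqr_ge0// -expRD -[leLHS]expR0 ler_expR.
by have : 0 <= lam * (T - s); [rewrite mulr_ge0// subr_ge0 | lra].
Qed.

Definition gram phi psi : R := lim (gram_at t phi psi @[t --> +oo]).

(** Monotone and bounded on the diagonal, then by polarization. *)
Lemma gram_at_cvg phi psi : D phi -> D psi ->
  gram_at t phi psi @[t --> +oo] --> gram phi psi.
Proof.
move=> Dphi Dpsi; have [D0 DD DZ] := adjoint_rsubspace.
have [C C0 hC] := gram_at_bound.
have diag x : D x -> cvg (gram_at t x x @[t --> +oo]).
  move=> Dx; apply/cvg_ex; eexists; apply: nondecreasing_cvgr.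
    by move=> s t; exact: gram_at_mono.
  by exists (C * rnorm x ^+ 2) => _ [t _ <-]; exact: hC.
have cv : 2^-1 * (gram_at t (phi + psi) (phi + psi) - gram_at t phi phi - gram_at t psi psi)
  @[t --> +oo] --> 2^-1 * (gram (phi + psi) (phi + psi) - gram phi phi - gram psi psi).
  by apply: cvgMl_tmp; apply: cvgB; [apply: cvgB|]; apply: diag => //; exact: DD.
have : cvg (gram_at t phi psi @[t --> +oo]); last by [].
apply/cvg_ex; eexists; refine (cvg_near_eq _ cv).
near=> t; have t0 : 0 <= t by near: t; exact: nbhs_pinfty_ge.
have qf := gram_at_form t0.
rewrite (form_Dl qf)//; last exact: DD.
by rewrite !(form_Dr qf)// (form_C qf Dpsi Dphi); field.
Unshelve. all: by end_near. Qed.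

Lemma gram_uniq phi psi (l : R) : D phi -> D psi ->
  gram_at t phi psi @[t --> +oo] --> l -> gram phi psi = l.
Proof. by move=> Dphi Dpsi; apply: rcvg_unique; exact: gram_at_cvg. Qed.

Lemma gram_ge phi t : D phi -> gram_at t phi phi <= gram phi phi.
Proof.
move=> Dphi; apply: (cvgr_to_ge (gram_at_cvg Dphi Dphi)).
by near=> s; apply: gram_at_mono => //; near: s; exact: nbhs_pinfty_ge.
Unshelve. all: by end_near. Qed.

Lemma gram_form : form_on D gram.
Proof.
have [D0 DD DZ] := adjoint_rsubspace.
have near0 (P : R -> Prop) : (forall t, 0 <= t -> P t) -> \forall t \near +oo, P t.
  by move=> h; near=> t; apply: h; near: t; exact: nbhs_pinfty_ge.
split; [exact: D0|exact: DD|exact: DZ| | | |].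
- move=> x y Dx Dy; apply: gram_uniq => //; apply: cvg_near_eq (gram_at_cvg Dy Dx).
  by apply: near0 => t t0; rewrite (form_C (gram_at_form t0) Dx Dy).
- move=> x y z Dx Dy Dz; apply: gram_uniq => //; first exact: DD.
  apply: cvg_near_eq (cvgD (gram_at_cvg Dx Dz) (gram_at_cvg Dy Dz)).
  by apply: near0 => t t0; rewrite (form_Dl (gram_at_form t0)).
- move=> r x y Dx Dy; apply: gram_uniq => //; first exact: DZ.
  apply: cvg_near_eq (cvgMl_tmp (a := r) (gram_at_cvg Dx Dy)).
  by apply: near0 => t t0; rewrite (form_Zl (gram_at_form t0)).
- by move=> x Dx; apply: le_trans (gram_ge 0 Dx); rewrite /gram_at /obsform /itg subrr.
Unshelve. all: by end_near. Qed.

Lemma gram_scale (c : scal R k) phi psi : D phi -> D psi ->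
  gram (c *: phi) psi = gram phi (scal_conj c *: psi).
Proof.
move=> Dphi Dpsi.
have Dc : D (c *: phi) by exact: adjoint_domZ.
have Dc' : D (scal_conj c *: psi) by exact: adjoint_domZ.
apply: gram_uniq => //; apply: cvg_near_eq (gram_at_cvg Dphi Dc'); apply: nearW => t.
rewrite /gram_at /obsform; congr itg; apply/funext => s.
by rewrite !obs_Z// rdotZ.
Qed.

(** The infinite horizon makes the Gramian reproduce itself under the group, up
    to a finite time term. The identity holds for times of both signs, so it
    can be differentiated at 0. *)
Lemma gram_shift t phi psi : D phi -> D psi -> gram phi psi =
  gram_at t phi psi + expR (- lam * t) * gram (gadj (- t) phi) (gadj (- t) psi).
Proof.
move=> Dphi Dpsi; apply: gram_uniq => //.
have cv : gram_at t phi psi + expR (- lam * t) * gram_at s (gadj (- t) phi) (gadj (- t) psi)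
    @[s --> +oo] -->
  gram_at t phi psi + expR (- lam * t) * gram (gadj (- t) phi) (gadj (- t) psi).
  by apply: cvgD; [exact: cvg_cst | apply: cvgMl_tmp; apply: gram_at_cvg; exact: gadj_dom].
rewrite -(cvg_shiftr t); refine (cvg_near_eq _ cv); apply: nearW => s.
by rewrite (addrC s) gram_at_add.
Qed.

Lemma gram_bound : exists2 C : R, 0 <= C & forall phi, D phi -> gram phi phi <= C * rnorm phi ^+ 2.
Proof.
have [C C0 hC] := gram_at_bound; exists C => // phi Dphi.
by apply: (cvgr_to_le (gram_at_cvg Dphi Dphi)); apply: nearW => t; exact: hC.
Qed.

Lemma gram_coercive (T : R) : 0 < T -> exactly_controllable B T ->
  exists2 C : R, 0 <= C & forall phi, D phi -> rnorm phi ^+ 2 <= C * gram phi phi.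
Proof.
move=> T0 ctrl; have [C C0 hC] := gram_at_coercive T0 ctrl; exists C => // phi Dphi.
by apply: le_trans (hC _ Dphi) _; rewrite ler_wpM2l//; exact: gram_ge.
Qed.

Lemma gram_integral phi : D phi ->
  (\int[mu]_(s in `[0%R, +oo[) (expR (- lam * s) * rnorm (obs phi (- s)) ^+ 2)%:E <=
   (gram phi phi)%:E)%E.
Proof.
move=> Dphi; pose f s := expR (- lam * s) * rnorm (obs phi (- s)) ^+ 2.
have fE : f = fun s => expR (- lam * s) * rdot (obs phi (- s)) (obs phi (- s)).
  by apply/funext => s; rewrite /f rdotxx.
have fc : continuous f by rewrite fE; exact: gc.
have f0 s : 0 <= f s by rewrite mulr_ge0 ?expR_ge0 ?sqr_ge0.
have mf : measurable_fun setT f by exact: cts_measurable.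
apply: (cvge_to_le (ge0_cvgn_integral f0 mf)); apply: nearW => n.
by rewrite integral_itg// lee_fin fE; exact: gram_ge.
Qed.

End Gramian.

(** * The closed loop *)

Variables (G : H -> H) (G_lin : linear G) (C : R) (C0 : 0 <= C).
Hypothesis G_le : forall x, rnorm (G x) <= C * rnorm x.
Hypothesis GD : forall phi psi, D phi -> D psi -> rdot (G phi) psi = gram phi psi.

Section ClosedLoop.
Implicit Types (phi psi w : H) (s t : R).

Let gadj_opp_vderiv phi t : D phi ->
  vderiv (fun s => gadj (- s) phi) t (- gadj (- t) (As phi)).
Proof. by move=> Dphi; apply: (@vderiv_opp _ _ _ (fun s => gadj s phi) t); exact: (@gadj_vderiv phi (- t) Dphi). Qed.

Let G_vderiv f t d : vderiv f t d -> vderiv (fun s => G (f s)) t (G d).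
Proof. by move=> fd; exact: vderiv_lin G_lin (ex_intro _ C G_le) fd. Qed.

(** The derivative of [gram_shift] at time 0. *)
Lemma lyapunov phi psi : D phi -> D psi ->
  lam * gram phi psi + rdot (G (As phi)) psi + rdot (G phi) (As psi) =
  rdot (Bs phi) (Bs psi).
Proof.
move=> Dphi Dpsi.
pose g s := expR (- lam * s) * rdot (obs phi (- s)) (obs psi (- s)).
have gc : continuous g.
  by apply: obsform_cts => //; [exact: expR_scale_cts | exact: oppr_cts].
have d1 := rderivM (rderiv_exp (- lam) 0)
  (vderiv_rdot (G_vderiv (@gadj_opp_vderiv phi 0 Dphi)) (@gadj_opp_vderiv psi 0 Dpsi)).
have d2 := rderivB (rderivC (gram phi psi + prim g 0) 0) (is_derive_prim 0 gc).
have fE : (fun t => expR (- lam * t) * rdot (G (gadj (- t) phi)) (gadj (- t) psi)) =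
    fun t => gram phi psi + prim g 0 - prim g t.
  apply/funext => t; rewrite GD//; try exact: gadj_dom.
  rewrite (gram_shift t Dphi Dpsi).
  by rewrite /gram_at /obsform /itg -/g; ring.
rewrite fE in d1; have := is_derive_unique d1 d2.
rewrite /g /obs oppr0 !gadj0 mulr0 expR0 !mulr1 !mul1r sub0r.
by rewrite (lin_opp G_lin) rdotNl rdotNr GD//; lra.
Qed.

(** The closed loop started at [G w]: the group conjugated by [G], with a
    discount. *)
Definition traj w t : H := expR (- lam * t) *r G (gadj (- t) w).

(** The feedback [- B^*], applied to [expR (- lam * t) *r gadj (- t) w]. *)
Definition ctl w t : U := - (expR (- lam * t) *r obs w (- t)).

(** The Lyapunov identity at [gadj (- t) w] cancels the term in [lam] and
    leaves the adjoint generator on the side of [phi] together with the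
    control. *)
Lemma traj_derive w phi t : D w -> D phi ->
  is_derive t 1 (fun t => rdot (traj w t) phi)
    (rdot (traj w t) (As phi) + rdot (ctl w t) (Bs phi)).
Proof.
move=> Dw Dphi; have [Dg Ag] := gadj_adjoint (- t) Dw.
have := rderivM (rderiv_exp (- lam) t)
  (vderiv_rdot (G_vderiv (@gadj_opp_vderiv w t Dw)) (@vderiv_cst _ _ _ phi t)).
have -> : (fun t => expR (- lam * t) * rdot (G (gadj (- t) w)) phi) =
  (fun t => rdot (traj w t) phi) by apply/funext => s; rewrite /traj rdotrZl.
move/is_derive_eq; apply; rewrite /traj /ctl rdotNl !rdotrZl rdot0r addr0.
have := lyapunov Dg Dphi; rewrite Ag (lin_opp G_lin) rdotNl -/(obs w (- t)).
rewrite -(GD Dg Dphi).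
by move=> <-; ring.
Qed.

Lemma gadj_opp_cts w : continuous (fun t => gadj (- t) w).
Proof.
move=> t; apply: (@cvg_cts_comp _ _ _ _ (fun t => - t) (fun r => gadj r w)).
  exact: oppr_cts.
exact: gadj_cvg.
Qed.

Lemma traj_cts w : continuous (traj w).
Proof.
move=> t; apply: cvg_rscale; first exact: expR_scale_cts.
by apply: cvg_cts_comp; [exact: gadj_opp_cts | exact: bound_continuous G_lin G_le _].
Qed.

Lemma ctl_cts w : D w -> continuous (ctl w).
Proof.
move=> Dw t; apply: cvgN; apply: cvg_rscale; first exact: expR_scale_cts.
by apply: cvg_cts_comp; [exact: oppr_cts | exact: obs_cts].
Qed.

Lemma traj_sub x w t : traj (x - w) t = traj x t - traj w t.
Proof.
by rewrite /traj (lin_sub (gadj_linear _)) (lin_sub G_lin) scalerBr.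
Qed.

Lemma ctl_sub x w t : D x -> D w -> ctl (x - w) t = ctl x t - ctl w t.
Proof.
by move=> Dx Dw; rewrite /ctl obs_B// scalerBr opprB opprK addrC.
Qed.

Lemma traj_le w t : 0 <= t -> rnorm (traj w t) <= C * M * expR ((a - lam) * t) * rnorm w.
Proof.
move=> t0; rewrite /traj rnormrZ ger0_norm ?expR_ge0//.
apply: (@le_trans _ _ (expR (- lam * t) * (C * (M * expR (a * t) * rnorm w)))).
  apply: ler_wpM2l; first exact: expR_ge0.
  apply: le_trans (G_le _) _; apply: ler_wpM2l => //.
  by have := gadj_le (- t) w; rewrite normrN (ger0_norm t0).
have -> : (a - lam) * t = - lam * t + a * t by ring.
by rewrite expRD le_eqVlt; apply/orP; left; apply/eqP; ring.
Qed.

End ClosedLoop.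

Section Feedback.
Implicit Types (phi psi w : H) (s t : R).

Lemma weak_form_dom w phi (T : R) theta : D w -> D phi -> 0 < T -> test_function T theta ->
  - (\int[mu]_(t in `]0, T[) rdot (traj w t) (derive1 theta t *r phi)) =
  \int[mu]_(t in `]0, T[) rdot (traj w t) (theta t *r As phi) +
  \int[mu]_(t in `]0, T[) rdot (ctl w t) (theta t *r Bs phi).
Proof.
move=> Dw Dphi T0 th.
have rc (V : hilbertType R k) (f : R -> V) (g : R -> R) (x : V) : continuous f -> continuous g ->
    continuous (fun t => rdot (f t) (g t *r x)).
  move=> fc gc t; apply: cvg_rdot; first exact: fc.
  by apply: cvg_rscale; [exact: gc | exact: cvg_cst].
have c1 := rc _ (traj w) _ phi (@traj_cts w) (test_derive_cts th).
have c2 := rc _ (traj w) _ (As phi) (@traj_cts w) (test_cts th).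
have c3 := rc _ (ctl w) _ (Bs phi) (ctl_cts Dw) (test_cts th).
rewrite /Rintegral !integral_itg_oo// ?(ltW T0)//=.
have d t : is_derive t 1 (fun t => theta t * rdot (traj w t) phi)
   (rdot (traj w t) (derive1 theta t *r phi) +
    (rdot (traj w t) (theta t *r As phi) + rdot (ctl w t) (theta t *r Bs phi))).
  have := rderivM (test_derive th t)
    (traj_derive t Dw Dphi).
  by move/is_derive_eq; apply; rewrite !rdotrZr mulrDr.
have := itgE 0 T d; rewrite !itgD//; last by move=> t; apply: cvgD; [exact: c2 | exact: c3].
rewrite (test_out th (x := T)) ?ltxx ?andbF// (test_out th (x := 0)) ?ltxx//.
by rewrite !mul0r subrr; lra.
Qed.

(** A general [w] is outside the domain, where its feedback makes no sense
    pointwise. The Gramian bounds the energy of the controls on the half-line,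
    so the controls of the approximations converge in mean square to a control
    of the limit trajectory. *)
Lemma feedback_control (v : nat -> H) w : (forall n, D (v n)) ->
  (forall n, gram (v n.+1 - v n) (v n.+1 - v n) <= 9^-1 ^+ n) ->
  v n @[n --> \oo] --> w ->
  exists u : R -> U, (forall T, 0 < T -> in_L2 T u) /\
    forall T phi theta, 0 < T -> D phi -> test_function T theta ->
    - (\int[mu]_(t in `]0, T[) rdot (traj w t) (derive1 theta t *r phi)) =
    \int[mu]_(t in `]0, T[) rdot (traj w t) (theta t *r As phi) +
    \int[mu]_(t in `]0, T[) rdot (u t) (theta t *r Bs phi).
Proof.
move=> Dv vq vw; pose E := [set` `[0 : R, +oo[].
have mE : measurable E by exact: measurable_itv.
have Dd n : D (v n.+1 - v n).
  apply: adjoint_domD => //.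
  by rewrite -scaleN1r; exact: adjoint_domZ.
have vc n : continuous (ctl (v n)) by exact: ctl_cts.
have [|u um uv] := @L2_limit _ _ _ E (fun n => ctl (v n)) 1 mE ler01 vc.
  move=> n; rewrite mul1r; have h := gram_integral (Dd n).
  have h' : ((gram (v n.+1 - v n) (v n.+1 - v n))%:E <= (9^-1 ^+ n)%:E)%E by rewrite lee_fin.
  apply: (le_trans _ (le_trans h h')).
  have mo (f : R -> R) : continuous f -> measurable_fun E (EFin \o f).
    by move=> fc; apply/measurable_EFinP; exact: (cts_measurable mE fc).
  have oc : continuous (fun t => obs (v n.+1 - v n) (- t)).
    by move=> t; apply: cvg_cts_comp; [exact: oppr_cts | exact: obs_cts].
  apply: le_integral_ge0 => //.
  - apply: mo; apply: (@rnorm_sqr_cts _ _ _ (fun t => ctl (v n.+1) t - ctl (v n) t)) => t.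
    by apply: cvgB; exact: vc.
  - apply: (mo (fun t => expR (- lam * t) * rnorm (obs (v n.+1 - v n) (- t)) ^+ 2)) => t.
    apply: cvgM; last exact: (@rnorm_sqr_cts _ _ _ (fun t => obs (v n.+1 - v n) (- t)) oc t).
    exact: expR_scale_cts.
  - by move=> t _; rewrite lee_fin sqr_ge0.
  - move=> t; rewrite /E /= in_itv /= andbT => t0; rewrite lee_fin.
    rewrite -ctl_sub// /ctl rnormN rnormrZ ger0_norm ?expR_ge0//.
    rewrite exprMn ler_wpM2r ?sqr_ge0// expr2 ler_piMr ?expR_ge0// -expR0 ler_expR.
    by rewrite mulNr oppr_le0 mulr_ge0//; move: a0 lam_a; lra.
have sub (T : R) : [set` `]0, T[] `<=` E.
  by move=> t; rewrite /E /= !in_itv /= andbT => /andP[/ltW].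
have umT (T : R) : strongly_measurable [set` `]0, T[] u by exact: strongly_measurableS um.
have uvT (T : R) n : (\int[mu]_(t in `]0%R, T[) (rnorm (u t - ctl (v n) t) ^+ 2)%:E <=
    (8 * 1 * 4^-1 ^+ n)%:E)%E.
  apply: le_trans (uv n); apply: ge0_subset_integral => //; last by move=> t _; rewrite lee_fin sqr_ge0.
  by apply/measurable_EFinP; exact: strong_measurable_dist.
have uL (T : R) : in_L2 T u.
  by apply: (L2_of_dist (umT T) (vc 0%N)); apply: le_lt_trans (uvT T 0%N) _; rewrite ltey.
have geo : 8 * 1 * 4^-1 ^+ n @[n --> \oo] --> (0 : R).
  have cv : 8 * 1 * 4^-1 ^+ n @[n --> \oo] --> 8 * 1 * (0 : R).
    by apply: cvgMl_tmp; apply: cvg_expr; rewrite ger0_norm ?invr_ge0// invf_lt1// ltr1n.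
  by move: cv; rewrite mulr0.
have sq0 T (V : hilbertType R k) (f : R -> V) (g : nat -> R -> V) (b : nat -> R) :
    (forall n, (\int[mu]_(t in `]0%R, T[) (rnorm (f t - g n t) ^+ 2)%:E <= (b n)%:E)%E) ->
    b n @[n --> \oo] --> (0 : R) ->
    (\int[mu]_(t in `]0%R, T[) (rnorm (f t - g n t) ^+ 2)%:E)%E @[n --> \oo] --> 0%E.
  move=> fb b0; apply: (squeeze_cvge (f := fun=> 0%E) (h := fun n => (b n)%:E)).
  - by apply: nearW => n; rewrite fb integral_ge0// => t _; rewrite lee_fin sqr_ge0.
  - exact: cvg_cst.
  - by apply/cvg_EFin => //; exact: nearW.
exists u; split=> [T _|T phi theta T0 Dphi th]; first exact: uL.
have cL (V : hilbertType R k) (x : V) (f : R -> R) : continuous f -> in_L2 T (fun t => f t *r x).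
  move=> fc; apply: cts_in_L2 => t.
  by apply: cvg_rscale; [exact: fc | exact: cvg_cst].
have uc := sq0 T _ _ _ _ (uvT T) geo.
have yc : (\int[mu]_(t in `]0%R, T[) (rnorm (traj w t - traj (v n) t) ^+ 2)%:E)%E @[n --> \oo] --> 0%E.
  apply: (sq0 T _ _ _ (fun n => (C * M * rnorm (v n - w)) ^+ 2 * T)).
    move=> n; rewrite integral_itg_oo ?(ltW T0)//; last first.
      by apply: (@rnorm_sqr_cts _ _ _ (fun t => traj w t - traj (v n) t)) => t; apply: cvgB; exact: traj_cts.
    have dT (t : R) : is_derive t 1 (fun t => (C * M * rnorm (v n - w)) ^+ 2 * t) ((C * M * rnorm (v n - w)) ^+ 2).
      by have := rderivM (rderivC ((C * M * rnorm (v n - w)) ^+ 2) t) (is_derive_id t (1 : R)); rewrite mul0r add0r mulr1.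
    rewrite lee_fin; have -> : (C * M * rnorm (v n - w)) ^+ 2 * T =
        itg (fun=> (C * M * rnorm (v n - w)) ^+ 2) 0 T by rewrite (itgE 0 T dT); ring.
    apply: itg_le (ltW T0) _.
    - by apply: (@rnorm_sqr_cts _ _ _ (fun t => traj w t - traj (v n) t)) => t; apply: cvgB; exact: traj_cts.
    - exact: cst_continuous.
    - move=> t /andP[t0 _]; rewrite -traj_sub.
      have M0 : 0 <= M := le_trans ler01 M1.
      rewrite ler_pXn2r ?nnegrE ?mulr_ge0 ?rnorm_ge0//.
      apply: le_trans (traj_le _ t0) _.
      rewrite -[in leRHS]rnormB ler_wpM2r ?rnorm_ge0// ler_piMr ?mulr_ge0// -expR0 ler_expR.
      by rewrite mulr_le0_ge0//; move: a0 lam_a; lra.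
  have cv : (C * M * rnorm (v n - w)) ^+ 2 * T @[n --> \oo] --> (C * M * 0) ^+ 2 * T.
    apply: cvgMr_tmp; apply: (@cvg_cts_comp _ _ _ _ (fun n => C * M * rnorm (v n - w)) (fun r => r ^+ 2)).
      by apply: cvgMl_tmp; exact/cvg_rnormP.
    exact: exprn_continuous.
  by move: cv; rewrite mulr0 expr0n mul0r.
have l1 := L2_rdot_cvg (cts_in_L2 T (@traj_cts w)) (fun n => @traj_cts (v n)) (cL _ phi _ (test_derive_cts th)) yc.
have l2 := L2_rdot_cvg (cts_in_L2 T (@traj_cts w)) (fun n => @traj_cts (v n)) (cL _ (As phi) _ (test_cts th)) yc.
have l3 := L2_rdot_cvg (uL T) vc (cL _ (Bs phi) _ (test_cts th)) uc.
apply: rcvg_unique (cvgN l1) _; under eq_fun do rewrite weak_form_dom//.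
exact: cvgD.
Qed.

End Feedback.

End ControlSystem.

(** * Rapid stabilization *)

Section DiagonalSemigroup.
Variables (R : realType) (k : scalars) (H K : hilbertType R k).
Variables (F : R -> H -> H) (E : R -> K -> K).
Hypotheses (F_lin : forall t, linear (F t)) (E_lin : forall t, linear (E t)).

(** Two decoupled evolutions, as one semigroup on the product. *)
Definition diag_map t (z : H * K) : H * K := (F t z.1, E t z.2).

Lemma diag_linear t : linear (diag_map t).
Proof. by move=> c x y; rewrite /diag_map /= F_lin E_lin. Qed.

Definition diag t : {linear H * K -> H * K}%type :=
  HB.pack (diag_map t) (GRing.isLinear.Build _ _ _ _ _ (diag_linear t)).

Lemma prod_norm_le t (D : R) (z : H * K) : 0 <= D ->
  rnorm (F t z.1) <= D * rnorm z.1 -> rnorm (E t z.2) <= D * rnorm z.2 ->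
  prod_norm (diag t z) <= D * prod_norm z.
Proof.
move=> D0 h1 h2; rewrite /prod_norm /=.
have n0 : 0 <= rnorm z.1 ^+ 2 + rnorm z.2 ^+ 2 by rewrite addr_ge0 ?sqr_ge0.
rewrite -(ler_pXn2r (n:=2))// ?nnegrE ?mulr_ge0 ?sqrtr_ge0//.
rewrite exprMn !sqr_sqrtr ?addr_ge0 ?sqr_ge0// mulrDr -!exprMn.
by apply: lerD; rewrite ler_pXn2r ?nnegrE ?mulr_ge0 ?rnorm_ge0.
Qed.

Lemma diag_c0_semigroup (C : R -> R) :
  (forall t, 0 <= t -> forall x, rnorm (F t x) <= C t * rnorm x) ->
  (forall t, 0 <= t -> forall x, rnorm (E t x) <= C t * rnorm x) ->
  (forall x, F 0 x = x) -> (forall x, E 0 x = x) ->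
  (forall s t x, F (s + t) x = F s (F t x)) -> (forall s t x, E (s + t) x = E s (E t x)) ->
  (forall x, F t x @[t --> 0^'+] --> x) -> (forall x, E t x @[t --> 0^'+] --> x) ->
  c0_semigroup diag.
Proof.
move=> FC EC F0 E0 FD ED Fc Ec; split.
- move=> t t0 z; apply: (@cvg_pair _ _ _ _ (nbhs (F t z.1)) (nbhs (E t z.2))).
    apply: (@cvg_comp _ _ _ fst (F t) _ (nbhs z.1)); first exact: cvg_fst.
    exact: (bound_continuous (F_lin t) (FC t t0)).
  apply: (@cvg_comp _ _ _ snd (E t) _ (nbhs z.2)); first exact: cvg_snd.
  exact: (bound_continuous (E_lin t) (EC t t0)).
- by move=> [x y]; rewrite /= /diag_map /= F0 E0.
- by move=> s t [x y] _ _; rewrite /= /diag_map /= FD ED.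
- move=> [x y]; apply: (@cvg_pair _ _ _ _ (nbhs x) (nbhs y)); [exact: Fc | exact: Ec].
Qed.

End DiagonalSemigroup.

Theorem proposition2p1 (R : realType) (k : scalars) (H U : hilbertType R k)
    (S : R -> {linear H -> H}) (A : operator H)
    (S_group : c0_group S) (A_gen : is_generator S A)
    (B : {linear U -> antidual (adjoint A)}) (B_cont : continuous B)
    (B_adm : admissible B S)
    (AB_ctrl : exists T : R, 0 < T /\ exactly_controllable B T) :
  rapidly_dynamically_stabilizable B.
Proof.
move=> nu nu0; have [T [T0 ctrl]] := AB_ctrl.
have [M M1 [a a0 S_le]] := group_bound S_group.
have M0 : 0 <= M := le_trans ler01 M1.
have gadj_le := gadj_bound S_group M0 S_le.
(* The discount must make the Gramian converge and exceed [a + nu], since the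
   adjoint orbits grow at the rate [a]. *)
pose lam := 2 * a + 1 + nu.
have lam_a : 2 * a + 1 <= lam by rewrite /lam; lra.
have qf := gram_form S_group A_gen B_cont B_adm M1 a0 lam_a gadj_le.
have [C C0 qC] := gram_bound S_group A_gen B_cont B_adm M1 a0 lam_a gadj_le.
have [c c0 qc] := gram_coercive S_group A_gen B_cont B_adm M1 a0 lam_a gadj_le T0 ctrl.
have dD := adjoint_dense S_group A_gen.
have Ds (b : scal R k) phi : dom (adjoint A) phi -> dom (adjoint A) (b *: phi).
  exact: (adjoint_domZ S_group A_gen).
have qs := gram_scale S_group A_gen B_cont B_adm M1 a0 lam_a gadj_le.
have [G [G_lin G_le GD]] := form_operator qf dD Ds qs C0 qC.
have G_coer := form_operator_coercive dD c0 qc G_lin G_le GD.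
have G_inj x y : G x = G y -> x = y.
  move=> e; apply/eqP; rewrite -subr_eq0; apply/eqP/rnorm0_eq0/eqP.
  have := G_coer (x - y); rewrite (lin_sub G_lin) e subrr rnorm0 mulr0 => h.
  by rewrite eq_le h rnorm_ge0.
have /choice[N hN] y : exists x, G x = y /\ exists v : nat -> H,
    [/\ forall n, dom (adjoint A) (v n),
        forall n, gram S B lam (v n.+1 - v n) (v n.+1 - v n) <= 9^-1 ^+ n &
        v n @[n --> \oo] --> x].
  have [v [x [v1 v2 v3 v4]]] := form_operator_onto qf dD c0 qc G_lin G_le GD y.
  by exists x; split=> //; exists v.
have GN y : G (N y) = y by exact: (hN y).1.
have NG x : N (G x) = x by apply: G_inj; rewrite GN.
have N_lin : linear N.
  by move=> b x y; apply: G_inj; rewrite G_lin !GN.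
have N_le y : rnorm (N y) <= c * rnorm y by rewrite -{2}(GN y).
(* [N] is the inverse of [G]; the added component decays at the required rate. *)
pose F t y := traj S lam G (N y) t.
pose E t (z : H) := scal_of k (expR (- nu * t)) *: z.
have F_lin t : linear (F t).
  move=> b x y; rewrite /F /traj N_lin (gadj_linear S_group (- t)) G_lin scalerDr.
  by rewrite !scalerA mulrC.
have E_lin t : linear (E t).
  by move=> b x y; rewrite /E scalerDr !scalerA mulrC.
pose K1 := C * M * c + 1.
have K1_gt0 : 0 < K1 by rewrite ltr_wpDl// !mulr_ge0.
have expD (r s t : R) : expR (r * (s + t)) = expR (r * s) * expR (r * t) by rewrite mulrDr expRD.
have F_le t : 0 <= t -> forall y, rnorm (F t y) <= K1 * expR (- nu * t) * rnorm y.
  move=> t0 y; apply: le_trans (traj_le lam gadj_le C0 G_le (N y) t0) _.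
  have e1 : expR ((a - lam) * t) <= expR (- nu * t).
    by rewrite ler_expR ler_wpM2r// /lam; move: a0; lra.
  apply: (@le_trans _ _ (C * M * expR (- nu * t) * (c * rnorm y))).
    by apply: ler_pM; rewrite ?rnorm_ge0 ?mulr_ge0 ?expR_ge0// ler_wpM2l ?mulr_ge0.
  have -> : C * M * expR (- nu * t) * (c * rnorm y) = C * M * c * (expR (- nu * t) * rnorm y) by ring.
  by rewrite -[leRHS]mulrA ler_wpM2r ?mulr_ge0 ?expR_ge0 ?rnorm_ge0// lerDl.
have E_le t : 0 <= t -> forall z, rnorm (E t z) <= K1 * expR (- nu * t) * rnorm z.
  move=> t0 z; rewrite /E rnormrZ ger0_norm ?expR_ge0// -mulrA ler_peMl//.
    by rewrite mulr_ge0 ?expR_ge0 ?rnorm_ge0.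
  by rewrite /K1 lerDr !mulr_ge0.
have F0 x : F 0 x = x.
  by rewrite /F /traj mulr0 expR0 scal_of1 scale1r oppr0 (gadj0 S_group).
exists H, K1, (diag F_lin E_lin); split=> //.
- apply: (diag_c0_semigroup F_lin E_lin F_le E_le) => //.
  + by move=> x; rewrite /E mulr0 expR0 scal_of1 scale1r.
  + move=> s t x; rewrite /F /traj expD scal_ofM -scalerA (opprD s t) (gadjD S_group).
    by rewrite (lin_scale N_lin) NG (lin_scale (gadj_linear S_group _)) (lin_scale G_lin).
  + move=> s t x; rewrite /E expD scal_ofM scalerA //.
  + move=> x; rewrite -[in X in _ --> X](F0 x); apply: cvg_at_right_filter.
    exact: (traj_cts S_group A_gen G_lin G_le).
  + move=> x; have cv : E t x @[t --> (0 : R)^'+] --> E 0 x.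
      apply: cvg_at_right_filter; apply: cvg_rscale; last exact: cvg_cst.
      exact: expR_scale_cts.
    by move: cv; rewrite {2}/E mulr0 expR0 scal_of1 scale1r.
- move=> t t0 z; apply: prod_norm_le; [|exact: F_le|exact: E_le].
  by rewrite mulr_ge0 ?expR_ge0// ltW.
move=> y0 k0; have [_ [v [Dv vq vN]]] := hN y0.
have [u [uL hu]] := feedback_control S_group A_gen B_cont B_adm M1 a0 lam_a gadj_le G_lin C0 G_le GD Dv vq vN.
exists u; split=> // tau tau0.
have yc : continuous (F^~ y0) by exact: (traj_cts S_group A_gen G_lin G_le).
split; [exact: continuous_subspaceT | exact: F0 |].
(* The factor [b] is moved onto [phi], where the real identity applies. *)
move=> phi Dphi theta th; apply: scal_int_eqN => b.
have Db := Ds (scal_conj b) _ Dphi.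
have mulE (V : hilbertType R k) (x y : V) (r : R) :
    scal_re (b * (scal_of k r * dotp x y)) = rdot x (scal_of k r *: (scal_conj b *: y)).
  by rewrite /rdot !dotpZr scal_conj_of scal_conjK mulrCA.
have As_b : adjoint A (scal_conj b *: phi) = scal_conj b *: adjoint A phi.
  have [D0 A0] := adjoint_0 S_group A_gen.
  by have [_] := adjoint_lin S_group A_gen (scal_conj b) Dphi D0; rewrite A0 !addr0.
have Bs_b := control_adjointZ S_group A_gen B_cont (scal_conj b) Dphi.
under eq_Rintegral do rewrite mulE.
under [in RHS]eq_Rintegral do rewrite mulrDr mulrDr scal_reD !mulE.
have := hu tau _ _ tau0 Db th; rewrite As_b Bs_b => ->.
have cL (V : hilbertType R k) (x : V) : in_L2 tau (fun t => scal_of k (theta t) *: x).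
  apply: cts_in_L2 => t; apply: cvg_rscale; first exact: (test_cts th).
  exact: cvg_cst.
rewrite RintegralD//.
  by apply: L2_rdot_integrable => //; exact: cts_in_L2.
by apply: L2_rdot_integrable => //; exact: uL.
Qed.
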